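(* The system $\mathsf{Z}_2^{\Omega}+\mathsf{QF\text{-}AC}^{0,1}$ proves $\mathsf{HBU}$, while for no $k\geq 1$ does the system $\Pi^1_k\text{-}\mathsf{CA}_0^{\omega}$ prove $\mathsf{HBU}$. Here $\mathsf{HBU}$ (the Cousin lemma) is the statement $$(\forall \Psi:\mathbb{R}\to\mathbb{R}^+)(\exists \langle y_1,\dots,y_k\rangle)(\forall x\in[0,1])(\exists i\leq k)\big(x\in I^{\Psi}_{y_i}\big),\qquad I^{\Psi}_y:=(y-\Psi(y),\,y+\Psi(y)),$$ with $y_1,\dots,y_k$ a finite sequence of reals in $[0,1]$.
   Context: The metatheory is $\mathsf{ZFC}$. Language and base theory. Finite types: $0$ (natural numbers) is a type, and if $\sigma,\tau$ are types then so is $\sigma\to\tau$ (mappings); $1:=0\to 0$ and $n+1:=n\to 0$; $\rho^*$ is the type of finite sequences of type-$\rho$ objects (suitably coded). Superscripts on variables indicate types. $\mathsf{L}_\omega$ is the language with variables of all finite types, constants $0,1,<_0,+_0,\times_0,=_0$, the combinators and recursors. Equality $=_\tau$ and $\leq_\tau$ at type $\tau=\tau_1\to\dots\to\tau_k\to 0$ are defined pointwise from $=_0$, $\leq_0$. Quantifier-free formulas may contain variables of any type. The axiom $\mathsf{QF\text{-}AC}^{\sigma,\tau}$ is $(\forall x^\sigma)(\exists y^\tau)A(x,y)\to(\exists Y^{\sigma\to\tau})(\forall x^\sigma)A(x,Y(x))$ for all quantifier-free $A$. The (classical) system $\mathsf{RCA}_0^\omega$ consists of: the ordered semi-ring axioms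 for $0,1,<_0,+_0,\times_0$; the defining axioms of the $\Pi$ and $\Sigma$ (i.e. $K$ and $S$) combinators, yielding $\lambda$-abstraction; the recursor $\mathbf{R}_0$ with $\mathbf{R}_0(f,m,0)=m$ and $\mathbf{R}_0(f,m,n+1)=f(\mathbf{R}_0(f,m,n))$ for $m^0,f^1$; the axiom of extensionality $x=_\rho y\to\varphi(x)=_\tau\varphi(y)$ for all types $\rho,\tau$; induction for quantifier-free formulas; and $\mathsf{QF\text{-}AC}^{1,0}$. Reals. A real is coded by $q_{(\cdot)}:\mathbb{N}\to\mathbb{Q}$ with $|q_n-q_{n+i}|<2^{-n}$ for all $n,i$; $x=_{\mathbb{R}}y$ means $|q_n-r_n|\leq 2^{-(n-1)}$ for all $n$, and $<_{\mathbb{R}}$ is defined similarly. A function $F:\mathbb{R}\to\mathbb{R}$ is given by a $\Phi^{1\to1}$ with $x=_{\mathbb{R}}y\to\Phi(x)=_{\mathbb{R}}\Phi(y)$; $\mathbb{R}^+$ is the set of positive reals. Stronger systems. For $f^1$, $g^1$, $\overline{g}n=\langle g(0),\dots,g(n-1)\rangle$. For $k\geq1$, $(S_k^2)$ states the existence of a functional $S_k^2\leq_2 1$ deciding $\Sigma^1_k$-formulas: $S_k(f)=0$ iff $(\exists g_1^1)(\forall g_2^1)\cdots(\exists g_k^1)(\forall n^0)(f(\langle\overline{g_1}n,\dots,\overline{g_k}n\rangle)=0)$ for odd $k$, and similarly with final block $(\forall g_k^1)(\exists n^0)$ for even $k$. For $k=1$ this is the Suslin functional: $S(f)=0\leftrightarrow(\exists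 g^1)(\forall n^0)(f(\overline{g}n)=0)$. Put $\Pi^1_k\text{-}\mathsf{CA}_0^\omega:=\mathsf{RCA}_0^\omega+(S_k^2)$. The axiom $(\exists^3)$ is $(\exists E^3\leq_3 1)(\forall Y^2)[(\exists f^1)(Y(f)=0)\leftrightarrow E(Y)=0]$, and $\mathsf{Z}_2^\Omega:=\mathsf{RCA}_0^\omega+(\exists^3)$. *)

(* Defs.v *)
From Stdlib Require Import List.
Import ListNotations.

Inductive ty : Set :=
| Nat : ty
| Arr : ty -> ty -> ty.

(** The pure types: [pure 0] is the base type and [pure (n+1)] is [pure n -> 0]. *)
Fixpoint pure (n : nat) : ty :=
  match n with
  | 0 => Nat
  | S m => Arr (pure m) Nat
  end.

(** A context gives the variables available at each type.  Sentences live in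
    the empty context; binders extend the context by one variable. *)
Definition ctx := ty -> Set.

Definition empty_ctx : ctx := fun _ => Empty_set.

Inductive ext (V : ctx) (s : ty) : ctx :=
| vz : ext V s s
| vs : forall t, V t -> ext V s t.
Arguments vz {V s}.
Arguments vs {V s t} _.

(** [Kc], [Sc] are the combinators Pi and Sigma. *)
Inductive tm (V : ctx) : ty -> Set :=
| Var : forall s, V s -> tm V s
| App : forall s t, tm V (Arr s t) -> tm V s -> tm V t
| Zero : tm V Nat
| One : tm V Nat
| Plus : tm V (Arr Nat (Arr Nat Nat))
| Times : tm V (Arr Nat (Arr Nat Nat))
| Kc : forall s t, tm V (Arr s (Arr t s))
| Sc : forall r s t, tm V (Arr (Arr r (Arr s t)) (Arr (Arr r s) (Arr r t)))
| Rec0 : tm V (Arr (Arr Nat Nat) (Arr Nat (Arr Nat Nat))).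
Arguments Var {V s} _.
Arguments App {V s t} _ _.
Arguments Zero {V}.
Arguments One {V}.
Arguments Plus {V}.
Arguments Times {V}.
Arguments Kc {V} s t.
Arguments Sc {V} r s t.
Arguments Rec0 {V}.

Inductive fm (V : ctx) : Set :=
| Eq : tm V Nat -> tm V Nat -> fm V
| Lt : tm V Nat -> tm V Nat -> fm V
| Bot : fm V
| Imp : fm V -> fm V -> fm V
| All : forall s, fm (ext V s) -> fm V.
Arguments Eq {V} _ _.
Arguments Lt {V} _ _.
Arguments Bot {V}.
Arguments Imp {V} _ _.
Arguments All {V} s _.

(** The logic is classical, so the remaining connectives are abbreviations. *)
Definition Not {V} (p : fm V) : fm V := Imp p Bot.
Definition And {V} (p q : fm V) : fm V := Not (Imp p (Not q)).
Definition Or {V} (p q : fm V) : fm V := Imp (Not p) q.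
Definition Iff {V} (p q : fm V) : fm V := And (Imp p q) (Imp q p).
Definition Ex {V} (s : ty) (p : fm (ext V s)) : fm V := Not (All s (Not p)).

Fixpoint qf {V} (p : fm V) : Prop :=
  match p with
  | Eq _ _ | Lt _ _ | Bot => True
  | Imp p q => qf p /\ qf q
  | All _ _ => False
  end.

Fixpoint ren_tm {V W : ctx} (r : forall t, V t -> W t) {s} (a : tm V s) : tm W s :=
  match a with
  | Var v => Var (r _ v)
  | App a b => App (ren_tm r a) (ren_tm r b)
  | Zero => Zero
  | One => One
  | Plus => Plus
  | Times => Times
  | Kc s t => Kc s t
  | Sc r s t => Sc r s t
  | Rec0 => Rec0
  end.

Definition up_ren {V W : ctx} (r : forall t, V t -> W t) (s : ty) :
    forall t, ext V s t -> ext W s t :=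
  fun t v => match v with
             | vz => vz
             | vs v => vs (r _ v)
             end.

Fixpoint ren_fm {V W : ctx} (r : forall t, V t -> W t) (p : fm V) : fm W :=
  match p with
  | Eq a b => Eq (ren_tm r a) (ren_tm r b)
  | Lt a b => Lt (ren_tm r a) (ren_tm r b)
  | Bot => Bot
  | Imp p q => Imp (ren_fm r p) (ren_fm r q)
  | All s p => All s (ren_fm (up_ren r s) p)
  end.

Fixpoint subst_tm {V W : ctx} (f : forall t, V t -> tm W t) {s} (a : tm V s) : tm W s :=
  match a with
  | Var v => f _ v
  | App a b => App (subst_tm f a) (subst_tm f b)
  | Zero => Zero
  | One => One
  | Plus => Plus
  | Times => Times
  | Kc s t => Kc s t
  | Sc r s t => Sc r s t
  | Rec0 => Rec0
  end.

Definition scons {V W : ctx} {s} (a : tm W s) (f : forall t, V t -> tm W t) :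
    forall t, ext V s t -> tm W t :=
  fun t v => match v in ext _ _ t return tm W t with
             | vz => a
             | vs v => f _ v
             end.

Definition up_subst {V W : ctx} (f : forall t, V t -> tm W t) (s : ty) :
    forall t, ext V s t -> tm (ext W s) t :=
  scons (Var vz) (fun t v => ren_tm (fun _ => vs) (f t v)).

Fixpoint subst_fm {V W : ctx} (f : forall t, V t -> tm W t) (p : fm V) : fm W :=
  match p with
  | Eq a b => Eq (subst_tm f a) (subst_tm f b)
  | Lt a b => Lt (subst_tm f a) (subst_tm f b)
  | Bot => Bot
  | Imp p q => Imp (subst_fm f p) (subst_fm f q)
  | All s p => All s (subst_fm (up_subst f s) p)
  end.

Definition inst {V s} (p : fm (ext V s)) (a : tm V s) : fm V :=
  subst_fm (scons a (fun _ => Var)) p.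

(** An axiom may have free variables; these are implicitly universally
    quantified, as rule [nd_ax] applies in any context and under any assumptions. *)
Definition theory := forall V : ctx, fm V -> Prop.

Definition tunion (T U : theory) : theory := fun V p => T V p \/ U V p.

Inductive nd (T : theory) : forall V : ctx, list (fm V) -> fm V -> Prop :=
| nd_ass : forall V G p, In p G -> nd T V G p
| nd_ax : forall V G p, T V p -> nd T V G p
| nd_imp_intro : forall V G p q, nd T V (p :: G) q -> nd T V G (Imp p q)
| nd_imp_elim : forall V G p q, nd T V G (Imp p q) -> nd T V G p -> nd T V G q
| nd_raa : forall V G p, nd T V (Not p :: G) Bot -> nd T V G p
| nd_all_intro : forall V G s (p : fm (ext V s)),
    nd T (ext V s) (map (ren_fm (fun _ => vs)) G) p -> nd T V G (All s p)
| nd_all_elim : forall V G s (p : fm (ext V s)) a,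
    nd T V G (All s p) -> nd T V G (inst p a).

Definition proves (T : theory) (p : fm empty_ctx) : Prop := nd T empty_ctx [] p.

(** [wk] (written [↑]) moves a term from the context in which it was formed to
    the current, larger one; the inclusion is found by instance search. *)
Class Sub (V W : ctx) := sub_ren : forall t, V t -> W t.
#[export] Instance sub_refl V : Sub V V := fun _ v => v.
#[export] Instance sub_ext V W s (i : Sub V W) : Sub V (ext W s) :=
  fun t v => vs (i t v).

Definition wk {V W} {i : Sub V W} {s} (a : tm V s) : tm W s := ren_tm sub_ren a.

Definition all_var {V} s (F : tm (ext V s) s -> fm (ext V s)) : fm V := All s (F (Var vz)).
Definition ex_var {V} s (F : tm (ext V s) s -> fm (ext V s)) : fm V := Ex s (F (Var vz)).

Declare Scope ho_scope.
Delimit Scope ho_scope with ho.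
Local Open Scope ho_scope.

Notation "↑ a" := (wk a) (at level 9, a at level 9, format "↑ a") : ho_scope.
Notation "a ⋅ b" := (App a b) (at level 33, left associativity) : ho_scope.
Notation "a ⊗ b" := (Times ⋅ a ⋅ b) (at level 40, left associativity) : ho_scope.
Notation "a ⊕ b" := (Plus ⋅ a ⋅ b) (at level 50, left associativity) : ho_scope.
Notation "a ≐ b" := (Eq a b) (at level 70, no associativity) : ho_scope.
Notation "a ≺ b" := (Lt a b) (at level 70, no associativity) : ho_scope.
Notation "a ≼ b" := (Or (Lt a b) (Eq a b)) (at level 70, no associativity) : ho_scope.
Notation "p ∧∧ q" := (And p q) (at level 80, right associativity) : ho_scope.
Notation "p ∨∨ q" := (Or p q) (at level 85, right associativity) : ho_scope.
Notation "p ⟶ q" := (Imp p q) (at level 90, right associativity) : ho_scope.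
Notation "p ⟷ q" := (Iff p q) (at level 95, no associativity) : ho_scope.
Notation "∀[ x ∷ s ] p" := (all_var s (fun x => p))
  (at level 98, x name, s at level 97, p at level 98, right associativity) : ho_scope.
Notation "∃[ x ∷ s ] p" := (ex_var s (fun x => p))
  (at level 98, x name, s at level 97, p at level 98, right associativity) : ho_scope.

(** Equality and [<=] at higher types are defined pointwise. *)
Fixpoint eq_ty {V} (s : ty) : tm V s -> tm V s -> fm V :=
  match s with
  | Nat => fun a b => a ≐ b
  | Arr s t => fun a b => ∀[ x ∷ s ] eq_ty t (↑a ⋅ x) (↑b ⋅ x)
  end.

Fixpoint le_ty {V} (s : ty) : tm V s -> tm V s -> fm V :=
  match s with
  | Nat => fun a b => a ≼ b
  | Arr s t => fun a b => ∀[ x ∷ s ] le_ty t (↑a ⋅ x) (↑b ⋅ x)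
  end.

(** [(∀x)(∃y)A(x,y) -> (∃Y)(∀x)A(x,Y(x))] for quantifier-free [A]; in [A], the
    innermost variable is [y] and the next one is [x]. *)
Inductive QF_AC (s t : ty) : theory :=
| qf_ac : forall V (A : fm (ext (ext V s) t)), qf A ->
    QF_AC s t V
      (All s (Ex t A) ⟶
       ∃[ Y ∷ Arr s t ] ∀[ x ∷ s ]
         subst_fm (scons (↑Y ⋅ x) (scons x (fun _ v => Var (vs (vs v))))) A).

(** The ordered semi-ring axioms are taken in their discretely ordered form.
    Congruence of [Eq] for function application is an instance of [ext_ax]. *)
Inductive RCA0w : theory :=
| eq_refl_ax : forall V a, RCA0w V (a ≐ a)
| eq_sym_ax : forall V a b, RCA0w V (a ≐ b ⟶ b ≐ a)
| eq_trans_ax : forall V a b c, RCA0w V (a ≐ b ⟶ b ≐ c ⟶ a ≐ c)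
| eq_lt_ax : forall V a b c d, RCA0w V (a ≐ b ⟶ c ≐ d ⟶ a ≺ c ⟶ b ≺ d)
| add_assoc_ax : forall V a b c, RCA0w V (a ⊕ (b ⊕ c) ≐ (a ⊕ b) ⊕ c)
| add_comm_ax : forall V a b, RCA0w V (a ⊕ b ≐ b ⊕ a)
| add_zero_ax : forall V a, RCA0w V (a ⊕ Zero ≐ a)
| mul_assoc_ax : forall V a b c, RCA0w V (a ⊗ (b ⊗ c) ≐ (a ⊗ b) ⊗ c)
| mul_comm_ax : forall V a b, RCA0w V (a ⊗ b ≐ b ⊗ a)
| mul_one_ax : forall V a, RCA0w V (a ⊗ One ≐ a)
| mul_zero_ax : forall V a, RCA0w V (a ⊗ Zero ≐ Zero)
| distr_ax : forall V a b c, RCA0w V (a ⊗ (b ⊕ c) ≐ (a ⊗ b) ⊕ (a ⊗ c))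
| lt_irrefl_ax : forall V a, RCA0w V (Not (a ≺ a))
| lt_trans_ax : forall V a b c, RCA0w V (a ≺ b ⟶ b ≺ c ⟶ a ≺ c)
| lt_total_ax : forall V a b, RCA0w V (a ≺ b ∨∨ a ≐ b ∨∨ b ≺ a)
| lt_add_ax : forall V a b c, RCA0w V (a ≺ b ⟶ a ⊕ c ≺ b ⊕ c)
| lt_mul_ax : forall V a b c, RCA0w V (Zero ≺ c ⟶ a ≺ b ⟶ a ⊗ c ≺ b ⊗ c)
| lt_zero_ax : forall V a, RCA0w V (Not (a ≺ Zero))
| lt_discrete_ax : forall V a b, RCA0w V (a ≺ b ⟷ a ⊕ One ≼ b)
| K_ax : forall V s t (a : tm V s) (b : tm V t),
    RCA0w V (eq_ty s (Kc s t ⋅ a ⋅ b) a)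
| S_ax : forall V r s t (a : tm V (Arr r (Arr s t))) (b : tm V (Arr r s)) (c : tm V r),
    RCA0w V (eq_ty t (Sc r s t ⋅ a ⋅ b ⋅ c) (a ⋅ c ⋅ (b ⋅ c)))
| Rec0_zero_ax : forall V f m, RCA0w V (Rec0 ⋅ f ⋅ m ⋅ Zero ≐ m)
| Rec0_succ_ax : forall V f m n,
    RCA0w V (Rec0 ⋅ f ⋅ m ⋅ (n ⊕ One) ≐ f ⋅ (Rec0 ⋅ f ⋅ m ⋅ n))
| ext_ax : forall V s t (f : tm V (Arr s t)) (a b : tm V s),
    RCA0w V (eq_ty s a b ⟶ eq_ty t (f ⋅ a) (f ⋅ b))
| ind_ax : forall V (A : fm (ext V Nat)), qf A ->
    RCA0w V
      (inst A Zero ⟶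
       All Nat (A ⟶ subst_fm (scons (Var vz ⊕ One) (fun _ v => Var (vs v))) A) ⟶
       All Nat A)
| qf_ac10_ax : forall V p, QF_AC (pure 1) (pure 0) V p -> RCA0w V p.

Definition singleton (q : forall V, fm V) : theory := fun V p => p = q V.

Definition one_fun {V} (s : ty) : tm V (Arr s Nat) := Kc Nat s ⋅ One.

Definition Exists3 {V} : fm V :=
  ∃[ E ∷ pure 3 ]
    (le_ty (pure 3) E (one_fun (pure 2)) ∧∧
     ∀[ Y ∷ pure 2 ] ((∃[ f ∷ pure 1 ] ↑Y ⋅ f ≐ Zero) ⟷ ↑E ⋅ Y ≐ Zero)).

Definition Z2Omega : theory := tunion RCA0w (singleton (@Exists3)).

(** Injective pairing [(a+b)^2 + a], and tuples with [<a> = a]. *)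
Definition cpair {V} (a b : tm V Nat) : tm V Nat := (a ⊕ b) ⊗ (a ⊕ b) ⊕ a.

Fixpoint tuple {V} (l : list (tm V Nat)) : tm V Nat :=
  match l with
  | [] => Zero
  | [a] => a
  | a :: l => cpair a (tuple l)
  end.

(** [h(n)] is the code of [<g(0),...,g(n-1)>] for all [n]; the empty sequence is
    coded by 0 and the extension of the sequence coded by [c] with the entry
    [a] by [cpair c a + 1]. *)
Definition is_bar {V} (g h : tm V (pure 1)) : fm V :=
  h ⋅ Zero ≐ Zero ∧∧
  ∀[ n ∷ Nat ] ↑h ⋅ (n ⊕ One) ≐ cpair (↑h ⋅ n) (↑g ⋅ n) ⊕ One.

(** [sigma k b hs f] prefixes [k] alternating type-1 quantifiers, the first
    existential iff [b], and then a number quantifier of the next kind in the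
    alternation; [hs] holds the initial segment functions of the variables
    already quantified. *)
Fixpoint sigma (k : nat) (b : bool) {V} (hs : list (tm V (pure 1)))
    (f : tm V (pure 1)) : fm V :=
  match k with
  | 0 =>
      (if b then @ex_var V Nat else @all_var V Nat)
        (fun n => ↑f ⋅ tuple (map (fun h => ↑h ⋅ n) hs) ≐ Zero)
  | S k =>
      (if b then @ex_var V (pure 1) else @all_var V (pure 1))
        (fun g => ∃[ h ∷ pure 1 ]
           (is_bar ↑g h ∧∧ sigma k (negb b) (map wk hs ++ [h]) ↑f))
  end.

Definition S2 (k : nat) {V} : fm V :=
  ∃[ F ∷ pure 2 ]
    (le_ty (pure 2) F (one_fun (pure 1)) ∧∧
     ∀[ f ∷ pure 1 ] (↑F ⋅ f ≐ Zero ⟷ sigma k true [] f)).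

Definition Pi1kCA0w (k : nat) : theory := tunion RCA0w (singleton (@S2 k)).

(** Syntactic fractions [(qpos - qneg) / qden], with [qden] denoting a positive number. *)
Record qexp (V : ctx) : Set := Qexp { qpos : tm V Nat; qneg : tm V Nat; qden : tm V Nat }.
Arguments Qexp {V} _ _ _.
Arguments qpos {V} _.
Arguments qneg {V} _.
Arguments qden {V} _.

Definition qwk {V W} {i : Sub V W} (a : qexp V) : qexp W :=
  Qexp ↑(qpos a) ↑(qneg a) ↑(qden a).

Definition qopp {V} (a : qexp V) : qexp V := Qexp (qneg a) (qpos a) (qden a).
Definition qadd {V} (a b : qexp V) : qexp V :=
  Qexp (qpos a ⊗ qden b ⊕ qpos b ⊗ qden a) (qneg a ⊗ qden b ⊕ qneg b ⊗ qden a) (qden a ⊗ qden b).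
Definition qsub {V} (a b : qexp V) : qexp V := qadd a (qopp b).

Definition qeq {V} (a b : qexp V) : fm V :=
  qpos a ⊗ qden b ⊕ qneg b ⊗ qden a ≐ qpos b ⊗ qden a ⊕ qneg a ⊗ qden b.
Definition qlt {V} (a b : qexp V) : fm V :=
  qpos a ⊗ qden b ⊕ qneg b ⊗ qden a ≺ qpos b ⊗ qden a ⊕ qneg a ⊗ qden b.
Definition qle {V} (a b : qexp V) : fm V := qlt a b ∨∨ qeq a b.
Definition qabs_lt {V} (a b : qexp V) : fm V := qlt a b ∧∧ qlt (qopp a) b.
Definition qabs_le {V} (a b : qexp V) : fm V := qle a b ∧∧ qle (qopp a) b.

(** [2^n], by iterating [fun x => x + x = S Plus I]. *)
Definition pow2 {V} (n : tm V Nat) : tm V Nat :=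
  Rec0 ⋅ (Sc Nat Nat Nat ⋅ Plus ⋅ (Sc Nat (Arr Nat Nat) Nat ⋅ Kc Nat (Arr Nat Nat) ⋅ Kc Nat Nat)) ⋅ One ⋅ n.

(** [inv_pow2_pred n] is [2^(-(n-1))], also for [n = 0]. *)
Definition inv_pow2 {V} (n : tm V Nat) : qexp V := Qexp One Zero (pow2 n).
Definition inv_pow2_pred {V} (n : tm V Nat) : qexp V := Qexp (One ⊕ One) Zero (pow2 n).

(** The rational [(a - b) / (c + 1)] is coded by [<a,b,c>]. *)
Definition ratcode {V} (a b c : tm V Nat) : tm V Nat := tuple [a; b; c].

(** [decode c F]: the number [c] codes a rational satisfying [F]. *)
Definition decode {V} (c : tm V Nat)
    (F : qexp (ext (ext (ext V Nat) Nat) Nat) -> fm (ext (ext (ext V Nat) Nat) Nat)) : fm V :=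
  ∃[ x ∷ Nat ] ∃[ y ∷ Nat ] ∃[ z ∷ Nat ]
    (↑c ≐ ratcode ↑x ↑y z ∧∧ F (Qexp ↑x ↑y (z ⊕ One))).

Definition is_real {V} (x : tm V (pure 1)) : fm V :=
  ∀[ n ∷ Nat ] ∀[ i ∷ Nat ]
    decode (↑x ⋅ ↑n) (fun a => decode (↑x ⋅ (↑n ⊕ ↑i)) (fun b =>
      qabs_lt (qsub (qwk a) b) (inv_pow2 ↑n))).

Definition req {V} (x y : tm V (pure 1)) : fm V :=
  ∀[ n ∷ Nat ]
    decode (↑x ⋅ n) (fun a => decode (↑y ⋅ ↑n) (fun b =>
      qabs_le (qsub (qwk a) b) (inv_pow2_pred ↑n))).

Definition rlt {V} (x y : tm V (pure 1)) : fm V :=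
  ∃[ n ∷ Nat ]
    decode (↑x ⋅ n) (fun a => decode (↑y ⋅ ↑n) (fun b =>
      qlt (qadd (qwk a) (inv_pow2_pred ↑n)) b)).

Definition rle {V} (x y : tm V (pure 1)) : fm V := Not (rlt y x).

(** [u] represents [x + y], resp. [x - y]; the index shift by one ensures that
    [u] converges at the required rate. *)
Definition is_radd {V} (x y u : tm V (pure 1)) : fm V :=
  ∀[ n ∷ Nat ]
    decode (↑x ⋅ (n ⊕ One)) (fun a => decode (↑y ⋅ (↑n ⊕ One)) (fun b =>
      decode (↑u ⋅ ↑n) (fun c => qeq c (qadd (qwk a) (qwk b))))).

Definition is_rsub {V} (x y u : tm V (pure 1)) : fm V :=
  ∀[ n ∷ Nat ]
    decode (↑x ⋅ (n ⊕ One)) (fun a => decode (↑y ⋅ (↑n ⊕ One)) (fun b =>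
      decode (↑u ⋅ ↑n) (fun c => qeq c (qsub (qwk a) (qwk b))))).

Definition rzero {V} : tm V (pure 1) := Kc Nat Nat ⋅ ratcode Zero Zero Zero.
Definition rone {V} : tm V (pure 1) := Kc Nat Nat ⋅ ratcode One Zero Zero.

Definition in_unit {V} (x : tm V (pure 1)) : fm V :=
  is_real x ∧∧ rle rzero x ∧∧ rle x rone.

(** The values of [P] at sequences that do not code a real are arbitrary. *)
Definition is_posfun {V} (P : tm V (Arr (pure 1) (pure 1))) : fm V :=
  (∀[ x ∷ pure 1 ] (is_real x ⟶ is_real (↑P ⋅ x) ∧∧ rlt rzero (↑P ⋅ x))) ∧∧
  (∀[ x ∷ pure 1 ] ∀[ y ∷ pure 1 ]
     (is_real ↑x ⟶ is_real y ⟶ req ↑x y ⟶ req (↑P ⋅ ↑x) (↑P ⋅ y))).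

Definition in_interval {V} (P : tm V (Arr (pure 1) (pure 1))) (y x : tm V (pure 1)) : fm V :=
  ∃[ u ∷ pure 1 ] ∃[ v ∷ pure 1 ]
    (is_rsub ↑y (↑P ⋅ ↑y) ↑u ∧∧ is_radd ↑y (↑P ⋅ ↑y) v ∧∧
     rlt ↑u ↑x ∧∧ rlt ↑x v).

(** A finite sequence of reals is given by its length [k] and a [w] of type
    [0 -> 1] of which only the values at [i < k] matter. *)
Definition HBU {V} : fm V :=
  ∀[ P ∷ Arr (pure 1) (pure 1) ]
    (is_posfun P ⟶
     ∃[ k ∷ Nat ] ∃[ w ∷ Arr Nat (pure 1) ]
       ((∀[ i ∷ Nat ] (i ≺ ↑k ⟶ in_unit (↑w ⋅ i))) ∧∧
        ∀[ x ∷ pure 1 ]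
          (in_unit x ⟶
           ∃[ i ∷ Nat ] (i ≺ ↑k ∧∧ in_interval ↑P (↑w ⋅ i) ↑x)))).

(* Main.v *)
(** Positive part.  By a Henkin completeness theorem it suffices to prove [HBU] in
    every extensional model of the theory, whose numbers may be nonstandard and are
    embedded into an ordered field.  There [∃^3] decides all formulas with quantifiers
    of types 0 and 1, so that induction and [QF-AC^{0,1}] hold for them.  Call a dyadic
    cell good if a single ball of the cover contains its points.  If no level consists
    of good cells only, let [i_n] be the last [i] such that the cells to the left of
    [i / 2^n] are good at some level.  The numbers [i_n / 2^n] converge to a real of the
    model, whose ball contains the cell [[i_n / 2^n, (i_n + 1) / 2^n]] for large [n]:
    this contradicts the choice of [i_n].  So some level is good, and choice picks the
    centres.

    Negative part.  Programs are combinators with oracles; they are evaluated relative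
    to a partial oracle [X] that assigns programs to functions.  By Zorn's lemma there is
    a maximal [X] such that the program assigned to a function computes it with the help
    of [X].  Its domain consists of all functions that are computable with its help, and
    as programs determine what they compute, [X] is injective.  The hereditarily realized
    functionals form a model of [RCA0w].  Oracles for witnesses make its functions an
    elementary substructure of all functions, so that it contains [S_k^2] for all [k].
    It also contains the functional that maps a real to [2^-(e+3)], where [e] is the code
    of the program that [X] assigns to a representative of that real.  Distinct reals
    have distinct codes, so finitely many of these intervals have total length below 1
    and miss a rational of the unit interval. *)

From HB Require Import structures.
From Stdlib Require Import Program.Equality Cantor ClassicalEpsilon.
From mathcomp Require Import all_boot all_order all_algebra.
From mathcomp Require Import generic_quotient boolp classical_sets.
From mathcomp Require Import zify ring lra.
Require Import Defs.

Set Implicit Arguments.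
Unset Strict Implicit.
Unset Printing Implicit Defensive.

Import Order.TTheory GRing.Theory Num.Theory.

Local Open Scope quotient_scope.
Local Open Scope ho_scope.

(** * Substitution *)

(** Semantic reasoning replaces formal derivations in [nd], but as the numbers may be nonstandard,
    each induction or choice must be an instance of an internal scheme for a concrete formula; this
    is why cells and coverings are written as syntax. Subtraction is not among the axioms and comes
    from such an induction as well; the ordered field depends on it.

    The obstacle in the negative part is a circularity. An injection of the functions of the model
    into the numbers must itself belong to the model, so it helps to compute further functions,
    which in turn need codes. Evaluation refers to [X] only positively: an answer of a still partial
    [X] is never invalidated by an extension, and totality comes only at the end, from maximality.
    The oracle is asked about functions, not programs, and has at most one answer, which makes the
    resulting functional extensional.

    A code belongs to a Cauchy sequence, not to a real, whence the fixed representatives. With the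
    exponent [e + 3] the lengths [2 * 2^-(e+3)] add up to at most 1/2; the other half pays for
    rational approximations of the centres. *)

Definition ren_of {V W : ctx} (r : forall t, V t -> W t) : forall t, V t -> tm W t :=
  fun t v => Var (r t v).

Lemma up_subst_ren_of (V W : ctx) (r : forall t, V t -> W t) s :
  up_subst (ren_of r) s = ren_of (up_ren r s).
Proof. by apply: functional_extensionality_dep => t; apply: funext => -[]. Qed.

Lemma ren_tmE (V W : ctx) (r : forall t, V t -> W t) s (a : tm V s) :
  ren_tm r a = subst_tm (ren_of r) a.
Proof. by elim: a => //= s0 t a -> b ->. Qed.

Lemma ren_fmE (V : ctx) (p : fm V) :
  forall (W : ctx) (r : forall t, V t -> W t), ren_fm r p = subst_fm (ren_of r) p.
Proof.
elim: p => {V} [V a b|V a b|V|V p IHp q IHq|V s p IHp] W r //=; rewrite ?ren_tmE //.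
- by rewrite IHp IHq.
- by rewrite IHp up_subst_ren_of.
Qed.

Lemma subst_ren_tm (V W X : ctx) (r : forall t, V t -> W t) (f : forall t, W t -> tm X t)
    s (a : tm V s) :
  subst_tm f (ren_tm r a) = subst_tm (fun t v => f t (r t v)) a.
Proof. by elim: a => //= s0 t a -> b ->. Qed.

Lemma ren_subst_tm (V W X : ctx) (f : forall t, V t -> tm W t) (r : forall t, W t -> X t)
    s (a : tm V s) :
  ren_tm r (subst_tm f a) = subst_tm (fun t v => ren_tm r (f t v)) a.
Proof. by elim: a => //= s0 t a -> b ->. Qed.

Lemma subst_subst_tm (V W X : ctx) (f : forall t, V t -> tm W t) (g : forall t, W t -> tm X t)
    s (a : tm V s) :
  subst_tm g (subst_tm f a) = subst_tm (fun t v => subst_tm g (f t v)) a.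
Proof. by elim: a => //= s0 t a -> b ->. Qed.

Lemma subst_tm_id (V : ctx) s (a : tm V s) : subst_tm (fun t v => Var v) a = a.
Proof. by elim: a => //= s0 t a -> b ->. Qed.

Lemma up_subst_comp (V W X : ctx) (f : forall t, V t -> tm W t) (g : forall t, W t -> tm X t) s :
  (fun t v => subst_tm (up_subst g s) (up_subst f s t v)) =
  up_subst (fun t v => subst_tm g (f t v)) s.
Proof.
apply: functional_extensionality_dep => t; apply: funext => -[] //= t' v.
by rewrite subst_ren_tm ren_subst_tm.
Qed.

Lemma subst_subst_fm (V : ctx) (p : fm V) : forall (W X : ctx) (f : forall t, V t -> tm W t)
    (g : forall t, W t -> tm X t),
  subst_fm g (subst_fm f p) = subst_fm (fun t v => subst_tm g (f t v)) p.
Proof.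
elim: p => {V} [V a b|V a b|V|V p IHp q IHq|V s p IHp] W X f g //=; rewrite ?subst_subst_tm //.
- by rewrite IHp IHq.
- by rewrite IHp up_subst_comp.
Qed.

Lemma up_subst_Var (V : ctx) s : up_subst (fun t (v : V t) => Var v) s = fun t v => Var v.
Proof. by apply: functional_extensionality_dep => t; apply: funext => -[]. Qed.

Lemma subst_fm_id (V : ctx) (p : fm V) : subst_fm (fun t v => Var v) p = p.
Proof.
elim: p => {V} [V a b|V a b|V|V p IHp q IHq|V s p IHp] //=; rewrite ?subst_tm_id //.
- by rewrite IHp IHq.
- by rewrite up_subst_Var IHp.
Qed.

Lemma subst_inst (V W : ctx) (f : forall t, V t -> tm W t) s (p : fm (ext V s)) (a : tm V s) :
  subst_fm f (inst p a) = inst (subst_fm (up_subst f s) p) (subst_tm f a).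
Proof.
rewrite /inst !subst_subst_fm; congr subst_fm.
apply: functional_extensionality_dep => t; apply: funext => -[] //= t' v.
by rewrite subst_ren_tm subst_tm_id.
Qed.

Lemma inst_up_subst (V W : ctx) (f : forall t, V t -> tm W t) s (p : fm (ext V s)) (a : tm W s) :
  inst (subst_fm (up_subst f s) p) a = subst_fm (scons a f) p.
Proof.
rewrite /inst !subst_subst_fm; congr subst_fm.
apply: functional_extensionality_dep => t; apply: funext => -[] //= t' v.
by rewrite subst_ren_tm subst_tm_id.
Qed.

Lemma subst_wk (V W : ctx) (f : forall t, V t -> tm W t) s :
  (fun (p : fm V) => subst_fm (up_subst f s) (ren_fm (fun t v => vs v) p)) =
  (fun p => ren_fm (fun t v => vs v) (subst_fm f p)).
Proof.
apply: funext => p; rewrite !ren_fmE !subst_subst_fm; congr subst_fm.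
by apply: functional_extensionality_dep => t; apply: funext => v /=; rewrite ren_tmE.
Qed.

Lemma subst_eq_ty s : forall (V W : ctx) (f : forall t, V t -> tm W t) (a b : tm V s),
  subst_fm f (eq_ty s a b) = eq_ty s (subst_tm f a) (subst_tm f b).
Proof.
elim: s => [|s _ t IHt] V W f a b //=.
by rewrite /all_var /= IHt /= /wk !subst_ren_tm !ren_subst_tm.
Qed.

(** Axioms are schemes over all contexts. This closure lets a whole derivation be substituted into,
    which gives both generalisation over a fresh variable and the return from open terms to the
    empty context. *)
Definition subst_closed (T : theory) := forall (V W : ctx) (f : forall t, V t -> tm W t) p,
  T V p -> T W (subst_fm f p).

Lemma nd_weaken (T : theory) V G p : nd T V G p -> forall G',
  (forall q : fm V, List.In q G -> List.In q G') -> nd T V G' p.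
Proof.
elim=> {V G p} [V G p h|V G p h|V G p q _ IH|V G p q _ IH1 _ IH2|V G p _ IH|V G s p _ IH
  |V G s p a _ IH] G' sub.
- exact/nd_ass/sub.
- exact: nd_ax.
- by apply/nd_imp_intro/IH => r /= [<-|/sub]; [left|right].
- exact: nd_imp_elim (IH1 _ sub) (IH2 _ sub).
- by apply/nd_raa/IH => r /= [<-|/sub]; [left|right].
- apply/nd_all_intro/IH => r /List.in_map_iff [x [<- /sub hx]].
  exact: List.in_map.
- exact/nd_all_elim/IH.
Qed.

Lemma nd_subst (T : theory) (hT : subst_closed T) V G p : nd T V G p ->
  forall W (f : forall t, V t -> tm W t), nd T W (List.map (subst_fm f) G) (subst_fm f p).
Proof.
elim=> {V G p} [V G p h|V G p h|V G p q _ IH|V G p q _ IH1 _ IH2|V G p _ IH|V G s p _ IH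
  |V G s p a _ IH] W f /=.
- exact/nd_ass/List.in_map.
- exact/nd_ax/hT.
- exact/nd_imp_intro/IH.
- exact: nd_imp_elim (IH1 _ f) (IH2 _ f).
- exact/nd_raa/IH.
- apply/nd_all_intro.
  by move: (IH _ (up_subst f s)); rewrite !List.map_map subst_wk.
- by rewrite subst_inst; exact/nd_all_elim/IH.
Qed.

Lemma qf_subst V (p : fm V) : forall W (f : forall t, V t -> tm W t), qf p -> qf (subst_fm f p).
Proof.
by elim: p => {V} [V a b|V a b|V|V p IHp q IHq|V s p IHp] W f //= [/IHp ? /IHq].
Qed.

Lemma QF_AC_subst s t : subst_closed (QF_AC s t).
Proof.
move=> V W f p h; case: h f => {V p} V A hA f.
have -> : subst_fm f (All s (Ex t A) ⟶
       ∃[ Y ∷ Arr s t ] ∀[ x ∷ s ]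
         subst_fm (scons (↑Y ⋅ x) (scons x (fun _ v => Var (vs (vs v))))) A) =
  (All s (Ex t (subst_fm (up_subst (up_subst f s) t) A)) ⟶
       ∃[ Y ∷ Arr s t ] ∀[ x ∷ s ]
         subst_fm (scons (↑Y ⋅ x) (scons x (fun _ v => Var (vs (vs v)))))
         (subst_fm (up_subst (up_subst f s) t) A)).
  rewrite /ex_var /all_var /Ex /Not /=; do 6 f_equal.
  rewrite !subst_subst_fm; congr subst_fm.
  apply: functional_extensionality_dep => t'; apply: funext => v.
  case: v => [|t'' v] //=; case: v => [|? v] //=.
  by rewrite !subst_ren_tm /= !ren_tmE subst_subst_tm.
exact/qf_ac/qf_subst.
Qed.

Lemma RCA0w_subst : subst_closed RCA0w.
Proof.
move=> V W f p h; case: h f => {V p} V;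
  try (by intros; simpl; rewrite ?subst_eq_ty; constructor).
- move=> A hA f /=; rewrite subst_inst /=.
  have -> : subst_fm (up_subst f Nat)
      (subst_fm (scons (Var vz ⊕ One) (fun t v => Var (vs v))) A) =
    subst_fm (scons (Var vz ⊕ One) (fun t v => Var (vs v))) (subst_fm (up_subst f Nat) A).
    rewrite !subst_subst_fm; congr subst_fm.
    apply: functional_extensionality_dep => t; apply: funext => -[] //= t' v.
    by rewrite subst_ren_tm ren_tmE.
  exact/ind_ax/qf_subst.
- by move=> p hp f; apply/qf_ac10_ax/QF_AC_subst.
Qed.

(** * Models *)

(** The domains form a [ctx], so that elements of a model can themselves serve as variables.
    Formulas [Eq] are read as Leibniz equality, which forces the term model to be a genuine
    quotient. *)
Record model := Model {
  dom :> ty -> Set;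
  ap : forall s t, dom (Arr s t) -> dom s -> dom t;
  zeroM : dom Nat;
  oneM : dom Nat;
  plusM : dom (Arr Nat (Arr Nat Nat));
  timesM : dom (Arr Nat (Arr Nat Nat));
  kM : forall s t, dom (Arr s (Arr t s));
  sM : forall r s t, dom (Arr (Arr r (Arr s t)) (Arr (Arr r s) (Arr r t)));
  recM : dom (Arr (Arr Nat Nat) (Arr Nat (Arr Nat Nat)));
  ltM : dom Nat -> dom Nat -> Prop }.
Arguments ap {m s t} _ _.

Definition env (M : model) (V : ctx) := forall t, V t -> M t.

Definition econs (M : model) (V : ctx) s (d : M s) (rho : env M V) : env M (ext V s) :=
  fun t v => match v in ext _ _ t return M t with vz => d | vs _ v => rho _ v end.

Fixpoint ev (M : model) (V : ctx) (rho : env M V) s (a : tm V s) : M s :=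
  match a with
  | Var _ v => rho _ v
  | App _ _ a b => ap (ev rho a) (ev rho b)
  | Zero => zeroM M
  | One => oneM M
  | Plus => plusM M
  | Times => timesM M
  | Kc s t => kM M s t
  | Sc r s t => sM M r s t
  | Rec0 => recM M
  end.

Fixpoint sat (M : model) (V : ctx) (p : fm V) : env M V -> Prop :=
  match p with
  | Eq a b => fun rho => ev rho a = ev rho b
  | Lt a b => fun rho => ltM (ev rho a) (ev rho b)
  | Bot => fun _ => False
  | Imp p q => fun rho => sat p rho -> sat q rho
  | All s p => fun rho => forall d : M s, sat p (econs d rho)
  end.

Section Sat.
Variable M : model.

Lemma ev_ren (V W : ctx) (r : forall t, V t -> W t) (rho : env M W) s (a : tm V s) :
  ev rho (ren_tm r a) = ev (fun t v => rho t (r t v)) a.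
Proof. by elim: a => //= s0 t a -> b ->. Qed.

Lemma ev_subst (V W : ctx) (f : forall t, V t -> tm W t) (rho : env M W) s (a : tm V s) :
  ev rho (subst_tm f a) = ev (fun t v => ev rho (f t v)) a.
Proof. by elim: a => //= s0 t a -> b ->. Qed.

Lemma sat_subst (V : ctx) (p : fm V) : forall (W : ctx) (f : forall t, V t -> tm W t)
  (rho : env M W), sat (subst_fm f p) rho = sat p (fun t v => ev rho (f t v)).
Proof.
elim: p => {V} [V a b|V a b|V|V p IHp q IHq|V s p IHp] W f rho //=; rewrite ?ev_subst //.
- by rewrite IHp IHq.
- apply: eq_forall => d; rewrite IHp; congr sat.
  apply: functional_extensionality_dep => t; apply: funext => -[] //= t' v.
  by rewrite ev_ren.
Qed.

Lemma sat_ren (V W : ctx) (r : forall t, V t -> W t) (p : fm V) (rho : env M W) :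
  sat (ren_fm r p) rho = sat p (fun t v => rho t (r t v)).
Proof. by rewrite ren_fmE sat_subst. Qed.

Lemma sat_inst (V : ctx) s (p : fm (ext V s)) a (rho : env M V) :
  sat (inst p a) rho = sat p (econs (ev rho a) rho).
Proof.
rewrite /inst sat_subst; congr sat.
by apply: functional_extensionality_dep => t; apply: funext => -[].
Qed.

Lemma ev_wk (V W : ctx) (i : Sub V W) (rho : env M W) s (a : tm V s) :
  ev rho (wk a) = ev (fun t v => rho t (i t v)) a.
Proof. exact: ev_ren. Qed.

Lemma sat_Not (V : ctx) (p : fm V) (rho : env M V) : sat (Not p) rho = ~ sat p rho.
Proof. by []. Qed.

Lemma sat_And (V : ctx) (p q : fm V) (rho : env M V) :
  sat (And p q) rho = (sat p rho /\ sat q rho).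
Proof.
apply: propext; rewrite /=; split; last by case=> hp hq h; exact: h hp hq.
by move=> h; split; apply: contrapT => h'; apply: h.
Qed.

Lemma sat_Or (V : ctx) (p q : fm V) (rho : env M V) :
  sat (Or p q) rho = (sat p rho \/ sat q rho).
Proof.
apply: propext; rewrite /=; split; last by case.
by move=> h; case: (EM (sat p rho)) => [|/h]; [left|right].
Qed.

Lemma sat_Iff (V : ctx) (p q : fm V) (rho : env M V) :
  sat (Iff p q) rho = (sat p rho <-> sat q rho).
Proof. by rewrite sat_And. Qed.

Lemma sat_Ex (V : ctx) s (p : fm (ext V s)) (rho : env M V) :
  sat (Ex s p) rho = exists d, sat p (econs d rho).
Proof.
apply: propext; rewrite /=; split; last by case=> d hd /(_ d).
by move=> h; apply: contrapT => h'; apply: h => d hd; apply: h'; exists d.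
Qed.

Lemma sat_Imp (V : ctx) (p q : fm V) (rho : env M V) :
  sat (Imp p q) rho = (sat p rho -> sat q rho).
Proof. by []. Qed.

Lemma sat_All (V : ctx) s (p : fm (ext V s)) (rho : env M V) :
  sat (All s p) rho = forall d, sat p (econs d rho).
Proof. by []. Qed.

Lemma sat_all_var (V : ctx) s F (rho : env M V) :
  sat (all_var s F) rho = forall d : M s, sat (F (Var vz)) (econs d rho).
Proof. by []. Qed.

Lemma sat_ex_var (V : ctx) s F (rho : env M V) :
  sat (ex_var s F) rho = exists d : M s, sat (F (Var vz)) (econs d rho).
Proof. exact: sat_Ex. Qed.

Lemma soundness (T : theory) (hT : forall V p (rho : env M V), T V p -> sat p rho) V G p :
  nd T V G p -> forall rho : env M V, (forall q, List.In q G -> sat q rho) -> sat p rho.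
Proof.
elim=> {V G p} [V G p h|V G p h|V G p q _ IH|V G p q _ IH1 _ IH2|V G p _ IH|V G s p _ IH
  |V G s p a _ IH] rho hG /=.
- exact: hG.
- exact: hT.
- by move=> hp; apply: IH => r /= [<-|/hG].
- exact: (IH1 rho hG (IH2 rho hG)).
- by apply: contrapT => hp; apply: (IH rho) => r /= [<-|/hG].
- move=> d; apply: IH => r /List.in_map_iff [q [<- /hG]].
  by rewrite sat_ren.
- by rewrite sat_inst; apply: IH.
Qed.

Definition extensional := forall s t (f g : M (Arr s t)),
  (forall x, ap f x = ap g x) -> f = g.

Lemma sat_eq_ty (hM : extensional) s : forall V (a b : tm V s) (rho : env M V),
  sat (eq_ty s a b) rho = (ev rho a = ev rho b).
Proof.
elim: s => [|s _ t IHt] V a b rho //=.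
apply: propext; split=> [h|h d].
  by apply: hM => x; move: (h x); rewrite IHt /= /wk !ev_ren.
by rewrite IHt /= /wk !ev_ren /= -/(ev rho a) h.
Qed.

End Sat.

(** * Bracket abstraction *)

Fixpoint lam (V : ctx) s t (a : tm (ext V s) t) : tm V (Arr s t) :=
  match a in tm _ t return tm V (Arr s t) with
  | Var _ v => match v in ext _ _ t return tm V (Arr s t) with
             | vz => Sc s (Arr s s) s ⋅ Kc s (Arr s s) ⋅ Kc s s
             | vs _ v => Kc _ s ⋅ Var v
             end
  | App _ _ a b => Sc _ _ _ ⋅ lam a ⋅ lam b
  | Zero => Kc _ s ⋅ Zero
  | One => Kc _ s ⋅ One
  | Plus => Kc _ s ⋅ Plus
  | Times => Kc _ s ⋅ Times
  | Kc s' t => Kc _ s ⋅ Kc s' t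
  | Sc r s' t => Kc _ s ⋅ Sc r s' t
  | Rec0 => Kc _ s ⋅ Rec0
  end.

Definition combinatory (M : model) :=
  (forall s t (a : M s) (b : M t), ap (ap (kM M s t) a) b = a) /\
  (forall r s t (a : M (Arr r (Arr s t))) (b : M (Arr r s)) (c : M r),
    ap (ap (ap (sM M r s t) a) b) c = ap (ap a c) (ap b c)).

Lemma ev_lam (M : model) (hM : combinatory M) (V : ctx) s t (a : tm (ext V s) t)
    (rho : env M V) (d : M s) :
  ap (ev rho (lam a)) d = ev (econs d rho) a.
Proof.
have [hK hS] := hM.
elim: a => //= [s0 v|s0 t0 a <- b <-]; rewrite ?hS ?hK //.
by case: v => [|s1 v] /=; rewrite ?hS !hK.
Qed.

(** * Completeness *)

Definition pr (a b : nat) : nat := Cantor.to_nat (a, b).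

Lemma pr_inj a b c d : pr a b = pr c d -> a = c /\ b = d.
Proof. by move/Cantor.to_nat_inj => [-> ->]. Qed.

Fixpoint code_ty (s : ty) : nat :=
  match s with Nat => 0 | Arr s t => S (pr (code_ty s) (code_ty t)) end.

Lemma code_ty_inj s t : code_ty s = code_ty t -> s = t.
Proof.
by elim: s t => [|s IHs s' IHs'] [|t t'] //= [] /pr_inj [/IHs -> /IHs' ->].
Qed.

Lemma eq_ty_dec (s t : ty) : {s = t} + {s <> t}.
Proof. decide equality. Defined.

(** The type arguments of [Kc] and [Sc] are determined by the type of the term; only the argument
    type of an application is invisible there and has to be recorded. Injectivity is proved on
    dependent pairs because two applications may a priori differ in that type. *)
Fixpoint code_tm (V : ctx) (e : forall t, V t -> nat) s (a : tm V s) : nat :=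
  match a with
  | Var s v => pr 0 (e s v)
  | App s _ a b => pr 1 (pr (code_ty s) (pr (code_tm e a) (code_tm e b)))
  | Zero => pr 2 0
  | One => pr 3 0
  | Plus => pr 4 0
  | Times => pr 5 0
  | Kc _ _ => pr 6 0
  | Sc _ s _ => pr 7 0
  | Rec0 => pr 8 0
  end.

Lemma code_tm_inj_sig (V : ctx) (e : forall t, V t -> nat)
    (he : forall t v w, e t v = e t w -> v = w) s (a : tm V s) : forall t (b : tm V t),
  s = t -> code_tm e a = code_tm e b -> existT (tm V) s a = existT (tm V) t b.
Proof.
elim: a => [s0 v|s0 t a IHa b IHb|||||s0 t|r s0 t|] _ [s1 w|s1 t1 a' b'|||||s1 t1|r1 s1 t1|] //=;
  try by move=> _ /pr_inj [].
- by move=> ?; subst => /pr_inj [_ /he ->].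
- move=> ?; subst => /pr_inj [_ /pr_inj [/code_ty_inj h /pr_inj [ha hb]]]; subst.
  have e1 := Eqdep_dec.inj_pair2_eq_dec _ eq_ty_dec _ _ _ _ (IHa _ _ erefl ha).
  have e2 := Eqdep_dec.inj_pair2_eq_dec _ eq_ty_dec _ _ _ _ (IHb _ _ erefl hb).
  by rewrite e1 e2.
- by case=> ? ?; subst.
- by case=> ? ? ?; subst.
Qed.

Lemma code_tm_inj (V : ctx) (e : forall t, V t -> nat)
    (he : forall t v w, e t v = e t w -> v = w) s (a b : tm V s) :
  code_tm e a = code_tm e b -> a = b.
Proof.
move/(code_tm_inj_sig he erefl); exact: Eqdep_dec.inj_pair2_eq_dec eq_ty_dec _ _ _ _.
Qed.

Definition code_ext (V : ctx) (e : forall t, V t -> nat) s t (v : ext V s t) : nat :=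
  match v with vz => 0 | vs _ v => S (e _ v) end.

Fixpoint code_fm (V : ctx) (p : fm V) : (forall t, V t -> nat) -> nat :=
  match p with
  | Eq a b => fun e => pr 0 (pr (code_tm e a) (code_tm e b))
  | Lt a b => fun e => pr 1 (pr (code_tm e a) (code_tm e b))
  | Bot => fun _ => pr 2 0
  | Imp p q => fun e => pr 3 (pr (code_fm p e) (code_fm q e))
  | All s p => fun e => pr 4 (pr (code_ty s) (code_fm p (@code_ext _ e s)))
  end.

Lemma code_fm_inj (V : ctx) (p : fm V) : forall (e : forall t, V t -> nat)
    (he : forall t v w, e t v = e t w -> v = w) q,
  code_fm p e = code_fm q e -> p = q.
Proof.
elim: p => {V} [V a b|V a b|V|V p IHp q IHq|V s p IHp] e he [a' b'|a' b'||p' q'|s' p'] //=;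
  try by move=> /pr_inj [].
- by move=> /pr_inj [_ /pr_inj [/(code_tm_inj he) -> /(code_tm_inj he) ->]].
- by move=> /pr_inj [_ /pr_inj [/(code_tm_inj he) -> /(code_tm_inj he) ->]].
- by move=> /pr_inj [_ /pr_inj [/(IHp _ he) -> /(IHq _ he) ->]].
- move=> /pr_inj [_ /pr_inj [/code_ty_inj h]]; subst s' => /IHp -> //.
  move=> t v; case: v => {t} [|t v] w; dependent destruction w => //= -[] /he ->.
  by [].
Qed.

(** * Variables occurring in a formula *)

Fixpoint all_tm (V : ctx) (P : forall t, V t -> Prop) s (a : tm V s) : Prop :=
  match a with
  | Var s v => P s v
  | App _ _ a b => all_tm P a /\ all_tm P b
  | _ => True
  end.

Definition all_ext (V : ctx) (P : forall t, V t -> Prop) s t (v : ext V s t) : Prop :=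
  match v with vz => True | vs _ v => P _ v end.

Fixpoint all_fm (V : ctx) (p : fm V) : (forall t, V t -> Prop) -> Prop :=
  match p with
  | Eq a b | Lt a b => fun P => all_tm P a /\ all_tm P b
  | Bot => fun _ => True
  | Imp p q => fun P => all_fm p P /\ all_fm q P
  | All s p => fun P => all_fm p (@all_ext _ P s)
  end.

Lemma subst_tm_agree (V W : ctx) (P : forall t, V t -> Prop) (f g : forall t, V t -> tm W t)
    (hfg : forall t v, P t v -> f t v = g t v) s (a : tm V s) :
  all_tm P a -> subst_tm f a = subst_tm g a.
Proof. by elim: a => //= s0 t a IHa b IHb [/IHa -> /IHb ->]. Qed.

Lemma subst_fm_agree (V : ctx) (p : fm V) : forall (W : ctx) (P : forall t, V t -> Prop)
    (f g : forall t, V t -> tm W t) (hfg : forall t v, P t v -> f t v = g t v),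
  all_fm p P -> subst_fm f p = subst_fm g p.
Proof.
elim: p => {V} [V a b|V a b|V|V p IHp q IHq|V s p IHp] W P f g hfg //=.
- by move=> [/(subst_tm_agree hfg) -> /(subst_tm_agree hfg) ->].
- by move=> [/(subst_tm_agree hfg) -> /(subst_tm_agree hfg) ->].
- by move=> [/(IHp _ _ _ _ hfg) -> /(IHq _ _ _ _ hfg) ->].
- move=> hp; congr All; apply: IHp hp => t [|t' v] //= /hfg.
  by rewrite /up_subst /= => ->.
Qed.

Lemma all_tm_mono (V : ctx) (P Q : forall t, V t -> Prop) (h : forall t v, P t v -> Q t v)
    s (a : tm V s) : all_tm P a -> all_tm Q a.
Proof. by elim: a => //= s0 t a IHa b IHb [/IHa ? /IHb]. Qed.

Lemma all_fm_mono (V : ctx) (p : fm V) : forall (P Q : forall t, V t -> Prop)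
  (h : forall t v, P t v -> Q t v), all_fm p P -> all_fm p Q.
Proof.
elim: p => {V} [V a b|V a b|V|V p IHp q IHq|V s p IHp] P Q h //=.
- by move=> [/(all_tm_mono h) ? /(all_tm_mono h)].
- by move=> [/(all_tm_mono h) ? /(all_tm_mono h)].
- by move=> [/(IHp _ _ h) ? /(IHq _ _ h)].
- by apply: IHp => t [|t' v] //= /h.
Qed.

Lemma bounded_tm (V : ctx) (e : forall t, V t -> nat) s (a : tm V s) :
  exists k, all_tm (fun t v => (e t v < k)%N) a.
Proof.
elim: a => /= [s0 v|s0 t a [k ha] b [l hb]|||||s0 t|r s0 t|]; try by exists 0.
  by exists (e s0 v).+1.
exists (maxn k l); split; [apply: all_tm_mono ha|apply: all_tm_mono hb] => t' v; lia.
Qed.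

Lemma bounded_fm (V : ctx) (p : fm V) : forall e : forall t, V t -> nat,
  exists k, all_fm p (fun t v => (e t v < k)%N).
Proof.
have two (V' : ctx) (e : forall t, V' t -> nat) s (a : tm V' s) (b : tm V' s) :
    exists k, all_tm (fun t v => (e t v < k)%N) a /\ all_tm (fun t v => (e t v < k)%N) b.
  have [[k ha] [l hb]] := (bounded_tm e a, bounded_tm e b).
  exists (maxn k l); split; [apply: all_tm_mono ha|apply: all_tm_mono hb] => t' v; lia.
elim: p => {V} [V a b|V a b|V|V p IHp q IHq|V s p IHp] e /=; try exact: two.
- by exists 0.
- have [[k hp] [l hq]] := (IHp e, IHq e).
  exists (maxn k l); split; [apply: all_fm_mono hp|apply: all_fm_mono hq] => t' v; lia.
- have [k hp] := IHp (@code_ext _ e s); exists k.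
  by apply: all_fm_mono hp => t [|t' v] //=; lia.
Qed.

(** Countably many variables at each type: they play the part of the Henkin constants, so the
    language is never extended. *)
Definition hctx : ctx := fun _ => nat.

(** Undoes the instantiation of a quantifier by a fresh variable [y]. *)
Definition abstract_var (s : ty) (y : nat) : forall t, hctx t -> tm (ext hctx s) t :=
  fun t v => match eq_ty_dec s t with
             | left e => if v == y then Var (eq_rect s (ext hctx s) vz t e) else Var (vs v)
             | right _ => Var (vs v)
             end.

Lemma abstract_var_y (s : ty) (y : nat) : abstract_var s y (y : hctx s) = Var vz.
Proof.
rewrite /abstract_var; case: eq_ty_dec => // e.
by rewrite eqxx (Prop_irrelevance e erefl).
Qed.

Lemma abstract_var_lt (s : ty) (y : nat) t (v : hctx t) :
  (v < y)%N -> abstract_var s y v = Var (vs v).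
Proof.
move=> h; rewrite /abstract_var; case: eq_ty_dec => // e.
by case: eqP h => // ->; rewrite ltnn.
Qed.

Fixpoint some_tm (V : ctx) (s : ty) : tm V s :=
  match s with Nat => Zero | Arr s t => Kc t s ⋅ some_tm V t end.

(** * Maximal consistent sets with counterexamples *)

Section Henkin.
Variable T : theory.
Hypothesis T_subst : subst_closed T.
Hypothesis T_RCA : forall V p, RCA0w V p -> @T V p.

Notation der G p := (nd T hctx G p).
Definition con (G : list (fm hctx)) := ~ der G Bot.

Lemma nd_cut V G (p q : fm V) : nd T V (p :: G) q -> nd T V G p -> nd T V G q.
Proof. by move=> h1 h2; apply: (nd_imp_elim T V G p q) => //; apply: nd_imp_intro. Qed.

Lemma nd_absurd V G (p : fm V) : nd T V G (Not p) -> nd T V G p -> nd T V G Bot.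
Proof. exact: nd_imp_elim. Qed.

(** The whole derivation is pushed along [abstract_var s y]. By the bounds this acts as weakening on
    [G] and turns the instance at [y] back into [p], which is the premise of [nd_all_intro]. *)
Lemma nd_fresh G s (p : fm (ext hctx s)) y :
  (forall q, List.In q G -> all_fm q (fun t v => (v < y)%N)) ->
  all_fm (All s p) (fun t v => (v < y)%N) ->
  der G (inst p (Var (y : hctx s))) -> der G (All s p).
Proof.
move=> hG hp h; apply: nd_all_intro.
have := nd_subst T_subst h (abstract_var s y).
have -> : subst_fm (abstract_var s y) (inst p (Var (y : hctx s))) = p.
  rewrite /inst subst_subst_fm -[RHS]subst_fm_id.
  apply: (subst_fm_agree (P := @all_ext _ _ s) _ hp) => t [|t' v] /=.
    by rewrite abstract_var_y.
  exact: abstract_var_lt.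
congr nd; apply: List.map_ext_in => q /hG hq.
by rewrite ren_fmE; apply: subst_fm_agree hq => t v; exact: abstract_var_lt.
Qed.

Definition decided (G : list (fm hctx)) (p : fm hctx) :=
  List.In p G \/ (List.In (Not p) G /\
    match p with All s q => exists a, List.In (Not (inst q a)) G | _ => True end).

(** If [p] is inconsistent with [G], then [Not p] is consistent with it. For [p = All s q] a
    counterexample at a fresh variable may be added too: were it refutable, [nd_fresh] would derive
    [All s q]. *)
Lemma decide_step G p : con G -> exists G', [/\ List.incl G G', con G' & decided G' p].
Proof.
move=> cG; case: (EM (con (p :: G))) => cp.
  by exists (p :: G); split=> //; [move=> q; right|left; left].
have {}cp : der (p :: G) Bot by apply: contrapT.
have cN : con (Not p :: G).
  by move=> h; apply: cG; apply: (nd_cut h); apply: nd_imp_intro.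
have simple : exists G', [/\ List.incl G G', con G' & List.In (Not p) G'].
  by exists (Not p :: G); split=> //; [move=> q; right|left].
case: p cp cN simple => [a b|a b||p q|s q] cp cN simple;
  try by have [G' [? ? ?]] := simple; exists G'; split=> //; right.
have [k hk] : exists k, forall r, List.In r (All s q :: Not (All s q) :: G) ->
    all_fm r (fun t v => (v < k)%N).
  elim: (All s q :: Not (All s q) :: G) => [|r L [k hk]]; first by exists 0.
  have [l hl] := bounded_fm r (fun t (v : hctx t) => v).
  exists (maxn k l) => r' /= [<-|/hk {}hk]; [apply: all_fm_mono hl|apply: all_fm_mono hk]
    => t v; lia.
exists (Not (inst q (Var (k : hctx s))) :: Not (All s q) :: G); split.
- by move=> r; right; right.
- move=> h; apply: cN; apply: nd_absurd (nd_ass _ _ _ _ _) _; first by left.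
  apply: (nd_fresh (y := k)); last exact: nd_raa.
    by move=> r hr; apply: hk; right.
  by apply: hk; left.
- by right; split; [right; left|exists (Var (k : hctx s)); left].
Qed.

Definition code (p : fm hctx) : nat := code_fm p (fun t v => v).

Lemma code_inj p q : code p = code q -> p = q.
Proof. exact: code_fm_inj. Qed.

Lemma stage_step (G : {G | con G}) (n : nat) : exists G' : {G | con G},
  List.incl (sval G) (sval G') /\ forall p, code p = n -> decided (sval G') p.
Proof.
case: (EM (exists p, code p = n)) => [[p hp]|h]; last first.
  by exists G; split=> [q|p hp] //; case: h; exists p.
have [G' [h1 h2 h3]] := decide_step p (svalP G).
by exists (exist _ G' h2); split=> //= q; rewrite -hp => /code_inj ->.
Qed.

Variable G0 : {G | con G}.

Fixpoint stage (n : nat) : {G | con G} :=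
  match n with 0 => G0 | S n => sval (cid (stage_step (stage n) n)) end.

Lemma stage_mono m n : (m <= n)%N -> List.incl (sval (stage m)) (sval (stage n)).
Proof.
elim: n => [|n IH]; first by rewrite leqn0 => /eqP -> q.
rewrite leq_eqVlt => /orP [/eqP -> q //|/IH {}IH] q /IH hq.
by rewrite /=; case: cid => G' /= [+ _]; apply.
Qed.

Definition truth (p : fm hctx) := exists n, List.In p (sval (stage n)).

Lemma stage_decided p : decided (sval (stage (code p).+1)) p.
Proof. by rewrite /=; case: cid => G' /= [_]; apply. Qed.

Lemma truth_common (G : list (fm hctx)) : (forall q, List.In q G -> truth q) ->
  exists n, List.incl G (sval (stage n)).
Proof.
elim: G => [|p G IH] h; first by exists 0.
have [q hq|n hn] := IH; first by apply: h; right.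
have [|m hm] := h p; first by left.
exists (maxn m n) => q /= [<-|/hn].
  exact: (stage_mono (leq_maxl m n) hm).
exact: (stage_mono (leq_maxr m n)).
Qed.

Lemma truth_con p : truth p -> truth (Not p) -> False.
Proof.
move=> hp hn; have [|n hG] := @truth_common [:: p; Not p].
  by move=> q /= [<-|[<-|]].
apply: (svalP (stage n)); apply: (nd_absurd (p := p)); apply/nd_ass/hG; first by right; left.
by left.
Qed.

Lemma truth_nd G p : (forall q, List.In q G -> truth q) -> der G p -> truth p.
Proof.
move=> hG h; case: (stage_decided p) => [hp|[hp _]]; first by exists (code p).+1.
have [|n hn] := @truth_common (Not p :: G).
  by move=> q /= [<-|/hG//]; exists (code p).+1.
case: (svalP (stage n)); apply: (nd_absurd (p := p)); first by apply/nd_ass/hn; left.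
by apply: (nd_weaken h) => q hq; apply: hn; right.
Qed.

Lemma truth_ax p : @T hctx p -> truth p.
Proof. by move=> h; apply: (@truth_nd [::]) => //; apply: nd_ax. Qed.

Lemma truth_Bot : ~ truth Bot.
Proof. by move=> [n hn]; apply: (svalP (stage n)); apply: nd_ass. Qed.

Lemma truth_mp p q : truth (Imp p q) -> truth p -> truth q.
Proof.
move=> h1 h2; apply: (@truth_nd [:: Imp p q; p]); first by move=> r /= [<-|[<-|]].
by apply: (nd_imp_elim T _ _ p); apply: nd_ass; [left|right; left].
Qed.

Lemma truth_Not p : truth (Not p) <-> ~ truth p.
Proof.
split=> [h h'|h]; first exact: truth_con h' h.
by case: (stage_decided p) => [hp|[hp _]]; [case: h; exists (code p).+1|exists (code p).+1].
Qed.

Lemma truth_Imp p q : truth (Imp p q) <-> (truth p -> truth q).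
Proof.
split=> [h|h]; first exact: truth_mp.
case: (EM (truth p)) => hp.
  apply: (@truth_nd [:: q]); first by move=> r /= [<-|//]; apply: h.
  by apply/nd_imp_intro/nd_ass; right; left.
apply: (@truth_nd [:: Not p]); first by move=> r /= [<-|//]; apply/truth_Not.
apply/nd_imp_intro/nd_raa; apply: (nd_absurd (p := p)); apply: nd_ass; first by right; right; left.
by right; left.
Qed.

Lemma truth_All s (p : fm (ext hctx s)) : truth (All s p) <-> forall a, truth (inst p a).
Proof.
split=> [h a|h].
  apply: (@truth_nd [:: All s p]); first by move=> r /= [<-|].
  by apply/nd_all_elim/nd_ass; left.
case: (stage_decided (All s p)) => [hp|[_ [a ha]]]; first by exists (code (All s p)).+1.
by case: (truth_con (h a)); exists (code (All s p)).+1.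
Qed.

(** * The term model *)

Definition eqv s (a b : tm hctx s) := truth (eq_ty s a b).

Lemma eqv_arr s t (f g : tm hctx (Arr s t)) :
  eqv f g <-> forall a, eqv (f ⋅ a) (g ⋅ a).
Proof.
rewrite /eqv /= /all_var truth_All.
have h a : inst (eq_ty t (↑f ⋅ Var vz) (↑g ⋅ Var vz)) a = eq_ty t (f ⋅ a) (g ⋅ a).
  rewrite /inst subst_eq_ty /= /wk !subst_ren_tm /sub_ren /=.
  by rewrite (subst_tm_id f) (subst_tm_id g).
by split=> H a; move: (H a); rewrite h.
Qed.

Lemma eqv_refl s (a : tm hctx s) : eqv a a.
Proof.
elim: s a => [|s _ t IH] a; last by apply/eqv_arr.
exact/truth_ax/T_RCA/eq_refl_ax.
Qed.

Lemma eqv_sym s (a b : tm hctx s) : eqv a b -> eqv b a.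
Proof.
elim: s a b => [|s _ t IH] a b; last by move=> /eqv_arr h; apply/eqv_arr => c; apply: IH.
exact/truth_mp/truth_ax/T_RCA/eq_sym_ax.
Qed.

Lemma eqv_trans s (a b c : tm hctx s) : eqv a b -> eqv b c -> eqv a c.
Proof.
elim: s a b c => [|s _ t IH] a b c.
  by move=> h; apply/truth_mp; move: h; exact/truth_mp/truth_ax/T_RCA/eq_trans_ax.
by move=> /eqv_arr h /eqv_arr h'; apply/eqv_arr => d; apply: IH (h d) (h' d).
Qed.

Lemma eqv_app s t (f g : tm hctx (Arr s t)) a b : eqv f g -> eqv a b -> eqv (f ⋅ a) (g ⋅ b).
Proof.
move=> /eqv_arr /(_ a) h h'; apply: (eqv_trans h); move: h'.
exact/truth_mp/truth_ax/T_RCA/ext_ax.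
Qed.

(** A chosen representative of each class: the quotient becomes a subtype of the terms, which stays
    in [Set] and has Leibniz equality. *)
Definition nf s (a : tm hctx s) : tm hctx s := epsilon (inhabits (some_tm hctx s)) (eqv a).

Lemma nf_eqv s (a : tm hctx s) : eqv a (nf a).
Proof. by apply: epsilon_spec; exists a; apply: eqv_refl. Qed.

Lemma nf_eq s (a b : tm hctx s) : eqv a b -> nf a = nf b.
Proof.
move=> h; rewrite /nf; congr epsilon; apply: funext => c; apply: propext; split=> h'.
  exact: eqv_trans (eqv_sym h) h'.
exact: eqv_trans h h'.
Qed.

Definition hdom (s : ty) : Set := {a : tm hctx s | nf a = a}.

Definition cls s (a : tm hctx s) : hdom s := exist _ (nf a) (esym (nf_eq (nf_eqv a))).

Lemma cls_eq s (a b : tm hctx s) : cls a = cls b <-> eqv a b.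
Proof.
split=> [[h]|h]; first by apply: eqv_trans (nf_eqv a) _; rewrite h; apply/eqv_sym/nf_eqv.
rewrite /cls; move: (esym _) (esym _); rewrite (nf_eq h) => e1 e2.
by rewrite (Prop_irrelevance e1 e2).
Qed.

Lemma cls_sval s (d : hdom s) : cls (sval d) = d.
Proof.
case: d => a ha; rewrite /cls /=; move: (esym _); rewrite ha => e.
by rewrite (Prop_irrelevance e ha).
Qed.

Lemma eqv_sval_cls s (a : tm hctx s) : eqv (sval (cls a)) a.
Proof. exact/eqv_sym/nf_eqv. Qed.

Definition henkin : model :=
  @Model hdom (fun s t f a => cls (sval f ⋅ sval a)) (cls Zero) (cls One) (cls Plus) (cls Times)
    (fun s t => cls (Kc s t)) (fun r s t => cls (Sc r s t)) (cls Rec0)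
    (fun a b => truth (sval a ≺ sval b)).

Lemma henkin_ev (V : ctx) (f : forall t, V t -> tm hctx t) s (a : tm V s) :
  ev (M := henkin) (fun t v => cls (f t v)) a = cls (subst_tm f a).
Proof.
elim: a => //= s0 t a -> b ->; apply/cls_eq/eqv_app; exact: eqv_sval_cls.
Qed.

Lemma henkin_truth (V : ctx) (p : fm V) : forall f : forall t, V t -> tm hctx t,
  sat (M := henkin) p (fun t v => cls (f t v)) <-> truth (subst_fm f p).
Proof.
elim: p => {V} [V a b|V a b|V|V p IHp q IHq|V s p IHp] f /=.
- by rewrite !henkin_ev cls_eq.
- have lt_eqv (c d c' d' : tm hctx Nat) : eqv c c' -> eqv d d' ->
      truth (c ≺ d) -> truth (c' ≺ d').
    move=> h1 h2 h3; apply: truth_mp h3; apply: truth_mp h2; apply: truth_mp h1.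
    exact/truth_ax/T_RCA/eq_lt_ax.
  rewrite !henkin_ev; split; apply: lt_eqv; try exact: eqv_sval_cls;
    exact/eqv_sym/eqv_sval_cls.
- by split=> // /truth_Bot.
- by rewrite truth_Imp IHp IHq.
- rewrite truth_All; split=> h.
    move=> a; rewrite inst_up_subst -IHp; move: (h (cls a)); congr sat.
    by apply: functional_extensionality_dep => t; apply: funext => -[].
  move=> d; move: (h (sval d)); rewrite inst_up_subst -IHp; congr sat.
  by apply: functional_extensionality_dep => t; apply: funext => -[] //=; rewrite cls_sval.
Qed.

Lemma henkin_theory V p (rho : env henkin V) : @T V p -> sat p rho.
Proof.
move=> hp; have -> : rho = fun t v => cls (sval (rho t v)).
  by apply: functional_extensionality_dep => t; apply: funext => v; rewrite cls_sval.
exact/henkin_truth/truth_ax/T_subst.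
Qed.

Lemma henkin_ext : extensional henkin.
Proof.
move=> s t f g h; rewrite -[f]cls_sval -[g]cls_sval; apply/cls_eq/eqv_arr => a.
have /cls_eq h' := h (cls a).
have e (f' : hdom (Arr s t)) : eqv (sval f' ⋅ a) (sval f' ⋅ sval (cls a)).
  by apply: eqv_app; [exact: eqv_refl|exact/eqv_sym/eqv_sval_cls].
exact: eqv_trans (e f) (eqv_trans h' (eqv_sym (e g))).
Qed.

End Henkin.

Theorem completeness (T : theory) (phi : fm empty_ctx) :
  subst_closed T -> (forall V p, RCA0w V p -> T V p) ->
  (forall M : model, extensional M -> (forall V p (rho : env M V), T V p -> sat p rho) ->
    forall rho : env M empty_ctx, sat phi rho) ->
  proves T phi.
Proof.
move=> hT hR h; apply: contrapT => nphi.
pose f : forall t, empty_ctx t -> tm hctx t := fun t v => match v with end.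
have c0 : con T [:: Not (subst_fm f phi)].
  move=> /nd_raa h0; apply: nphi.
  (* Closed terms replace all the free variables, which brings the derivation back to the empty
     context. *)
  have := nd_subst hT h0 (fun t _ => some_tm empty_ctx t).
  by rewrite subst_subst_fm -[in X in _ -> X](subst_fm_id phi); congr proves;
    apply/(f_equal (fun f => subst_fm f phi))/functional_extensionality_dep => t;
    apply: funext => -[].
pose G0 : {G | con T G} := exist _ _ c0.
have := h (henkin hT hR G0) (@henkin_ext _ hT hR G0) (@henkin_theory _ hT hR G0)
  (fun t v => cls hT hR G0 (f t v)).
move/henkin_truth; apply/(truth_Not hT); exists 0.
by left.
Qed.

(** * Functionals deciding formulas *)

Section Deciders.
Variable M : model.

Definition addM (a b : M Nat) : M Nat := ap (ap (plusM M) a) b.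
Definition mulM (a b : M Nat) : M Nat := ap (ap (timesM M) a) b.
Notation "0M" := (zeroM M).
Notation "1M" := (oneM M).

Record rca : Prop := {
  rca_ext : extensional M;
  rca_comb : combinatory M;
  rca_addA : forall a b c, addM a (addM b c) = addM (addM a b) c;
  rca_addC : forall a b, addM a b = addM b a;
  rca_add0 : forall a, addM a 0M = a;
  rca_mulA : forall a b c, mulM a (mulM b c) = mulM (mulM a b) c;
  rca_mulC : forall a b, mulM a b = mulM b a;
  rca_mul1 : forall a, mulM a 1M = a;
  rca_mul0 : forall a, mulM a 0M = 0M;
  rca_distr : forall a b c, mulM a (addM b c) = addM (mulM a b) (mulM a c);
  rca_lt_irr : forall a : M Nat, ~ ltM a a;
  rca_lt_tr : forall a b c : M Nat, ltM a b -> ltM b c -> ltM a c;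
  rca_lt_tot : forall a b : M Nat, [\/ ltM a b, a = b | ltM b a];
  rca_lt_add : forall a b c, ltM a b -> ltM (addM a c) (addM b c);
  rca_lt_mul : forall a b c, ltM 0M c -> ltM a b -> ltM (mulM a c) (mulM b c);
  rca_lt_0 : forall a, ~ ltM a 0M;
  rca_lt_discrete : forall a b, ltM a b <-> ltM (addM a 1M) b \/ addM a 1M = b;
  rca_rec0 : forall f m, ap (ap (ap (recM M) f) m) 0M = m;
  rca_recS : forall f m n,
    ap (ap (ap (recM M) f) m) (addM n 1M) = ap f (ap (ap (ap (recM M) f) m) n);
  rca_ind : forall V (A : fm (ext V Nat)) (rho : env M V), qf A ->
    sat A (econs 0M rho) ->
    (forall n, sat A (econs n rho) -> sat A (econs (addM n 1M) rho)) ->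
    forall n, sat A (econs n rho);
  rca_ac : forall V (A : fm (ext (ext V (pure 1)) (pure 0))) (rho : env M V), qf A ->
    (forall x : M (pure 1), exists y : M (pure 0), sat A (econs y (econs x rho))) ->
    exists Y : M (Arr (pure 1) (pure 0)), forall x, sat A (econs (ap Y x) (econs x rho)) }.

Lemma sat_QF_AC s t V (A : fm (ext (ext V s) t)) (rho : env M V) :
  sat (All s (Ex t A) ⟶
       ∃[ Y ∷ Arr s t ] ∀[ x ∷ s ]
         subst_fm (scons (↑Y ⋅ x) (scons x (fun _ v => Var (vs (vs v))))) A) rho <->
  ((forall x : M s, exists y : M t, sat A (econs y (econs x rho))) ->
   exists Y : M (Arr s t), forall x, sat A (econs (ap Y x) (econs x rho))).
Proof.
rewrite sat_Imp sat_ex_var sat_All.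
have e1 : (forall x : M s, sat (Ex t A) (econs x rho)) =
    (forall x : M s, exists y : M t, sat A (econs y (econs x rho))).
  by apply: eq_forall => x; rewrite sat_Ex.
have e2 (Y : M (Arr s t)) (x : M s) : sat (subst_fm (scons (@wk _ _ (sub_ext _ _ s (sub_refl (ext V (Arr s t)))) _ (Var vz) ⋅ Var vz)
    (scons (Var vz) (fun _ v => Var (vs (vs v))))) A) (econs x (econs Y rho)) =
    sat A (econs (ap Y x) (econs x rho)).
  rewrite sat_subst; congr sat; apply: functional_extensionality_dep => t'.
  by apply: funext => -[|t'' v] //=; case: v.
rewrite e1; split=> h1 h2; have [Y hY] := h1 h2; exists Y => x.
  by rewrite -e2; exact: hY.
by move: (hY x); rewrite -e2.
Qed.

(** The elements of a model serve as the variables of a context. *)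
Definition self : env M (dom M) := fun t v => v.

Lemma rca_of_sat : extensional M ->
  (forall V p (rho : env M V), RCA0w V p -> sat p rho) -> rca.
Proof.
move=> hext hM.
have ax p : RCA0w (dom M) p -> sat p self by exact: hM.
have disc a b : ltM a b <-> ltM (addM a 1M) b \/ addM a 1M = b.
  by have := ax _ (@lt_discrete_ax (dom M) (Var a) (Var b)); rewrite sat_Iff sat_Or.
split=> //.
- split=> [s t a b|r s t a b c].
    by have := ax _ (@K_ax (dom M) s t (Var a) (Var b)); rewrite sat_eq_ty.
  by have := ax _ (@S_ax (dom M) r s t (Var a) (Var b) (Var c)); rewrite sat_eq_ty.
- by move=> a b c; have := ax _ (@add_assoc_ax (dom M) (Var a) (Var b) (Var c)).
- by move=> a b; have := ax _ (@add_comm_ax (dom M) (Var a) (Var b)).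
- by move=> a; have := ax _ (@add_zero_ax (dom M) (Var a)).
- by move=> a b c; have := ax _ (@mul_assoc_ax (dom M) (Var a) (Var b) (Var c)).
- by move=> a b; have := ax _ (@mul_comm_ax (dom M) (Var a) (Var b)).
- by move=> a; have := ax _ (@mul_one_ax (dom M) (Var a)).
- by move=> a; have := ax _ (@mul_zero_ax (dom M) (Var a)).
- by move=> a b c; have := ax _ (@distr_ax (dom M) (Var a) (Var b) (Var c)).
- by move=> a; have := ax _ (@lt_irrefl_ax (dom M) (Var a)).
- by move=> a b c; have := ax _ (@lt_trans_ax (dom M) (Var a) (Var b) (Var c)).
- move=> a b; have := ax _ (@lt_total_ax (dom M) (Var a) (Var b)).
  by rewrite !sat_Or => -[h|[h|h]]; [apply: Or31|apply: Or32|apply: Or33].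
- by move=> a b c; have := ax _ (@lt_add_ax (dom M) (Var a) (Var b) (Var c)).
- by move=> a b c; have := ax _ (@lt_mul_ax (dom M) (Var a) (Var b) (Var c)).
- by move=> a; have := ax _ (@lt_zero_ax (dom M) (Var a)).
- by move=> f m; have := ax _ (@Rec0_zero_ax (dom M) (Var f) (Var m)).
- by move=> f m n; have := ax _ (@Rec0_succ_ax (dom M) (Var f) (Var m) (Var n)).
- move=> V A rho hA h0 hS n.
  have := hM _ _ rho (ind_ax _ _ hA); rewrite /= sat_inst => /(_ h0) h; apply: h => m hm.
  rewrite sat_subst; move: (hS m hm); congr sat.
  by apply: functional_extensionality_dep => t; apply: funext => -[].
- move=> V A rho hA.
  by have /sat_QF_AC := hM _ _ rho (qf_ac10_ax _ _ (qf_ac _ _ _ _ hA)).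
Qed.

Hypothesis hcomb : combinatory M.
Variables (eqb ltb impb : M (Arr Nat (Arr Nat Nat))) (Q : ty -> Prop).
Variable E : forall s, M (Arr (Arr s Nat) Nat).

Record decides : Prop := {
  one_neq0 : 1M <> 0M;
  eqbP : forall a b, ap (ap eqb a) b = 0M <-> a = b;
  ltbP : forall a b, ap (ap ltb a) b = 0M <-> ltM a b;
  impbP : forall a b, ap (ap impb a) b = 0M <-> (a = 0M -> b = 0M);
  EP : forall s, Q s -> forall Y, ap (E s) Y = 0M <-> exists x, ap Y x = 0M }.

Fixpoint low V (p : fm V) : Prop :=
  match p with
  | Eq _ _ | Lt _ _ | Bot => True
  | Imp p q => low p /\ low q
  | All s p => Q s /\ low p
  end.

Hypothesis hdec : decides.

(** The characteristic term mentions the deciding functionals, so [cst] has to name every element of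
    [M] by a variable that [rho] interprets correctly. [E] decides existence whereas [All] is
    primitive, hence the two negations in the quantifier case. *)
Lemma char_fm V (p : fm V) : forall cst : forall t, M t -> V t, low p ->
  exists c : tm V Nat, forall rho : env M V, (forall t d, rho t (cst t d) = d) ->
    (ev rho c = 0M <-> sat p rho).
Proof.
elim: p => {V} [V a b|V a b|V|V p IHp q IHq|V s p IHp] cst /=.
- move=> _; exists (Var (cst _ eqb) ⋅ a ⋅ b) => rho h /=.
  by rewrite h; apply: eqbP.
- move=> _; exists (Var (cst _ ltb) ⋅ a ⋅ b) => rho h /=.
  by rewrite h; apply: ltbP.
- by move=> _; exists One => rho h /=; split=> // /(one_neq0 hdec).
- move=> [/(IHp cst) [c hc] /(IHq cst) [d hd]].
  exists (Var (cst _ impb) ⋅ c ⋅ d) => rho h /=.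
  by rewrite h (impbP hdec) hc // hd.
- move=> [hs /(IHp (fun t d => vs (cst t d))) [c hc]].
  pose neg (W : ctx) (k : forall t, M t -> W t) (a : tm W Nat) : tm W Nat := Var (k _ impb) ⋅ a ⋅ One.
  have negP (W : ctx) (k : forall t, M t -> W t) a (rho : env M W) : rho _ (k _ impb) = impb ->
      ev rho (neg W k a) = 0M <-> ~ ev rho a = 0M.
    move=> h /=; rewrite h (impbP hdec); split=> h1 h2; first exact: one_neq0 (h1 h2).
    by case: (h1 h2).
  exists (neg V cst (Var (cst _ (E s)) ⋅ lam (neg _ (fun t d => vs (cst t d)) c))) => rho h.
  have evE X : ev rho (Var (cst _ (E s)) ⋅ X) = ap (E s) (ev rho X) by rewrite /= h.
  rewrite negP ?h // evE (EP hdec hs) -forallNE; split=> h1 d.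
    have := h1 d; rewrite ev_lam // negP; last exact: h.
    by move=> /contrapT /(hc (econs d rho) h).
  rewrite ev_lam // negP; last exact: h.
  by apply; exact/(hc (econs d rho) h).
Qed.

Lemma low_ren V (p : fm V) : forall (W : ctx) (r : forall t, V t -> W t),
  low p -> low (ren_fm r p).
Proof.
by elim: p => {V} [V a b|V a b|V|V q IHq q' IHq'|V t q IHq] W r //= [h1 h2]; split; auto.
Qed.

Lemma decide1 V s (p : fm (ext V s)) (rho : env M V) : low p ->
  exists F : M (Arr s Nat), forall x, ap F x = 0M <-> sat p (econs x rho).
Proof.
move=> /(low_ren (up_ren rho s)) /(@char_fm _ _ (fun t d => vs d)) [c hc].
exists (ev self (lam c)) => x; rewrite ev_lam // hc // sat_ren.
suff -> : (fun t v => econs x self (up_ren rho s t v)) = econs x rho by [].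
by apply: functional_extensionality_dep => t; apply: funext => -[].
Qed.

Lemma decide2 V s t (p : fm (ext (ext V s) t)) (rho : env M V) : low p ->
  exists F : M (Arr s (Arr t Nat)), forall x y,
    ap (ap F x) y = 0M <-> sat p (econs y (econs x rho)).
Proof.
move=> /(low_ren (up_ren (up_ren rho s) t)) /(@char_fm _ _ (fun t d => vs (vs d))) [c hc].
exists (ev self (lam (lam c))) => x y; rewrite !ev_lam // hc // sat_ren.
suff -> : (fun t' v => econs y (econs x self) (up_ren (up_ren rho s) t t' v)) =
  econs y (econs x rho) by [].
by apply: functional_extensionality_dep => t'; apply: funext => -[|t'' v] //=; case: v.
Qed.

(** A low formula is equivalent to the quantifier-free [F x y = 0] with the parameter [F]. *)
Lemma ac_low s t :
  (forall V (A : fm (ext (ext V s) t)) (rho : env M V), qf A ->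
    (forall x : M s, exists y : M t, sat A (econs y (econs x rho))) ->
    exists Y : M (Arr s t), forall x, sat A (econs (ap Y x) (econs x rho))) ->
  forall V (A : fm (ext (ext V s) t)) (rho : env M V), low A ->
    (forall x : M s, exists y : M t, sat A (econs y (econs x rho))) ->
    exists Y : M (Arr s t), forall x, sat A (econs (ap Y x) (econs x rho)).
Proof.
move=> ac V A rho /(decide2 rho) [F hF] hA.
pose B : fm (ext (ext (dom M) s) t) := Var (vs (vs F)) ⋅ Var (vs vz) ⋅ Var vz ≐ Zero.
have [|Y hY] := ac _ B self I; first by move=> x; have [y /hF hy] := hA x; exists y.
by exists Y => x; apply/hF/hY.
Qed.

Lemma ind_low : rca -> forall V (A : fm (ext V Nat)) (rho : env M V), low A ->
  sat A (econs 0M rho) ->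
  (forall n, sat A (econs n rho) -> sat A (econs (addM n 1M) rho)) ->
  forall n, sat A (econs n rho).
Proof.
move=> hM V A rho /(decide1 rho) [F hF] h0 hS n.
pose B : fm (ext (dom M) Nat) := Var (vs F) ⋅ Var vz ≐ Zero.
apply/hF; apply: (rca_ind hM (A := B) (rho := self)) => //; first exact/hF.
by move=> m /hF /hS /hF.
Qed.

End Deciders.

(** Case distinctions come from choice: for quantifier-free [R] the functional [Y] of [rca_ac]
    decides [R] at functions. Two numbers are passed to [Y] as one function with the values [x] and
    [x + y] at 0 and 1, and the relations are shifted by [x] to match. *)
Lemma rca_deciders (M : model) : rca M -> exists eqb ltb impb : M (Arr Nat (Arr Nat Nat)),
  [/\ forall a b, ap (ap eqb a) b = zeroM M <-> a = b,
      forall a b, ap (ap ltb a) b = zeroM M <-> ltM a b &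
      forall a b, ap (ap impb a) b = zeroM M <-> (a = zeroM M -> b = zeroM M)].
Proof.
move=> hM.
have lt01 : ltM (zeroM M) (oneM M).
  by apply/(rca_lt_discrete hM); right; rewrite (rca_addC hM) (rca_add0 hM).
have one0 : oneM M <> zeroM M.
  by move=> e; move: lt01; rewrite e; exact: rca_lt_irr.
pose x0 : tm (ext (ext (dom M) (pure 1)) (pure 0)) Nat := Var (vs vz) ⋅ Zero.
pose x1 : tm (ext (ext (dom M) (pure 1)) (pure 0)) Nat := Var (vs vz) ⋅ One.
have main (R : fm (ext (ext (dom M) (pure 1)) (pure 0))) (R' : M Nat -> M Nat -> Prop) : qf R ->
    (forall f y, sat R (econs y (econs f (@self M))) <-> R' (ap f (zeroM M)) (ap f (oneM M))) ->
    exists b : M (Arr Nat (Arr Nat Nat)), forall x y,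
      ap (ap b x) y = zeroM M <-> R' x (addM x y).
  move=> hR RP.
  have [|f|Y hY] := rca_ac hM (A := Iff R (Var vz ≐ Zero)) (rho := @self M); first by [].
    case: (EM (R' (ap f (zeroM M)) (ap f (oneM M)))) => h.
      by exists (zeroM M); rewrite sat_Iff RP.
    by exists (oneM M); rewrite sat_Iff RP; split.
  have hc := rca_comb hM.
  (* [body] is the function [n => x + n * y], with values [x], [x + y] at [0], [1]. *)
  pose body : tm (ext (ext (ext (dom M) Nat) Nat) Nat) Nat :=
    Var (vs (vs vz)) ⊕ Var vz ⊗ Var (vs vz).
  exists (ev (@self M) (lam (lam (Var (vs (vs Y)) ⋅ lam body)))) => x y.
  rewrite !ev_lam // -[ev _ (_ ⋅ _)]/(ap Y (ev _ (lam body))).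
  set f := ev _ (lam body); have fE n : ap f n = addM x (mulM n y) by rewrite /f ev_lam.
  have := hY f; rewrite sat_Iff RP !fE /= => <-.
  by rewrite !(rca_mulC hM _ y) (rca_mul0 hM) (rca_mul1 hM) (rca_add0 hM).
have [|eqb heq] := @main (x0 ⊕ x0 ≐ x1) (fun a b => addM a a = b) I; first by [].
have [|ltb hlt] := @main (x0 ⊕ x0 ≺ x1) (fun a b => ltM (addM a a) b) I; first by [].
have [|impb himp] := @main (x0 ≐ Zero ⟶ x1 ≐ Zero)
  (fun a b => a = zeroM M -> b = zeroM M) (conj I I); first by [].
have lt_addE (a b c : M Nat) : ltM (addM c a) (addM c b) <-> ltM a b.
  rewrite !(rca_addC hM c); split; last exact: rca_lt_add.
  move=> h; case: (rca_lt_tot hM a b) => // [e|/(rca_lt_add hM c) h'].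
    by move: h; rewrite e => /(rca_lt_irr hM).
  by case: (rca_lt_irr hM (rca_lt_tr hM h h')).
exists eqb, ltb, impb; split=> a b.
- rewrite heq; split=> [e|->//]; case: (rca_lt_tot hM a b) => // /(lt_addE _ _ a);
    by rewrite e => /(rca_lt_irr hM).
- by rewrite hlt lt_addE.
- rewrite himp; split=> h e; have := h e; rewrite e (rca_addC hM) (rca_add0 hM) //.
Qed.

(** * The ordered field generated by an ordered semiring *)

Section FractionField.
Local Open Scope ring_scope.
Variables (N : comPzSemiRingType) (lt : N -> N -> Prop).
Hypothesis lt_irr : forall a, ~ lt a a.
Hypothesis lt_tr : forall a b c, lt a b -> lt b c -> lt a c.
Hypothesis lt_tot : forall a b, [\/ lt a b, a = b | lt b a].
Hypothesis lt_add : forall a b c, lt a b -> lt (a + c) (b + c).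
Hypothesis lt_mul : forall a b c, lt 0 c -> lt a b -> lt (a * c) (b * c).
Hypothesis lt_0 : forall a, ~ lt a 0.
Hypothesis lt_01 : lt 0 1.
Hypothesis lt_sub : forall a b, lt a b -> exists c, b = a + c + 1.

Implicit Types a b c d p q r u v w : N.

Let lt_add2 a b c d : lt a b -> ~ lt d c -> lt (a + c) (b + d).
Proof.
move=> h h'; case: (lt_tot c d) => [cd|<-|//]; last exact: lt_add.
by apply: (lt_tr (lt_add c h)); rewrite (addrC b c) (addrC b d); apply: lt_add.
Qed.

Let posS c : lt 0 (c + 1).
Proof. by have := lt_add2 lt_01 (@lt_0 c); rewrite addr0 addrC. Qed.

Let add_cancel a b c : a + c = b + c -> a = b.
Proof.
move=> h; case: (lt_tot a b) => // /(@lt_add _ _ c); rewrite h => /lt_irr //.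
Qed.

Let mul_cancel a b c : a * (c + 1) = b * (c + 1) -> a = b.
Proof.
move=> h; case: (lt_tot a b) => // /(lt_mul (posS c)); rewrite h => /lt_irr //.
Qed.

Definition fraw := (N * N * N)%type.

(* [(a, b, c)] stands for [(a - b) / (c + 1)]. *)
Definition fequiv (x y : fraw) : bool :=
  x.1.1 * (y.2 + 1) + y.1.2 * (x.2 + 1) == y.1.1 * (x.2 + 1) + x.1.2 * (y.2 + 1).

Lemma fequiv_refl : reflexive fequiv.
Proof. by move=> x; rewrite /fequiv. Qed.

Lemma fequiv_sym : symmetric fequiv.
Proof. by move=> x y; rewrite /fequiv eq_sym. Qed.

Lemma fequiv_trans : transitive fequiv.
Proof.
move=> [[a' b'] c'] [[a b] c] [[a'' b''] c'']; rewrite /fequiv /= => /eqP h1 /eqP h2.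
(* There is no subtraction, so the middle fraction is eliminated by multiplying with its denominator
   and adding both parts of its numerator to the two sides. *)
apply/eqP/(@mul_cancel _ _ c')/(@add_cancel _ _ ((b' + a') * (c + 1) * (c'' + 1))).
transitivity ((a * (c' + 1) + b' * (c + 1)) * (c'' + 1) +
  (a' * (c'' + 1) + b'' * (c' + 1)) * (c + 1)); first by ring.
by rewrite h1 h2; ring.
Qed.

Canonical fequiv_rel := EquivRel fequiv fequiv_refl fequiv_sym fequiv_trans.
Definition ffrac := {eq_quot fequiv}.
HB.instance Definition _ := Choice.on ffrac.

Definition fr (a b c : N) : ffrac := \pi_ffrac (a, b, c).

Lemma frE (a b c a' b' c' : N) : fr a b c = fr a' b' c' <->
  a * (c' + 1) + b' * (c + 1) = a' * (c + 1) + b * (c' + 1).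
Proof.
rewrite /fr; split=> [/eqmodP /eqP //|h]; apply/eqmodP; exact/eqP.
Qed.

Lemma frP x : exists a b c, x = fr a b c.
Proof. by case E: (repr x) => [[a b] c]; exists a, b, c; rewrite /fr -E reprK. Qed.

Definition nu (x : ffrac) := (repr x).1.1.
Definition de (x : ffrac) := (repr x).1.2.
Definition dn (x : ffrac) := (repr x).2.

Lemma fr_rep a b c : fr (nu (fr a b c)) (de (fr a b c)) (dn (fr a b c)) = fr a b c.
Proof. by rewrite /fr /nu /de /dn -!surjective_pairing reprK. Qed.

(** The last component is the product of the denominators less one:
    [(c+1)(c'+1) = (cc'+c+c') + 1]. *)
Definition faddr (x y : ffrac) := fr (nu x * (dn y + 1) + nu y * (dn x + 1))
  (de x * (dn y + 1) + de y * (dn x + 1)) (dn x * dn y + dn x + dn y).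
Definition fmulr (x y : ffrac) := fr (nu x * nu y + de x * de y)
  (nu x * de y + de x * nu y) (dn x * dn y + dn x + dn y).
Definition foppr (x : ffrac) := fr (de x) (nu x) (dn x).

Lemma faddE a b c a' b' c' : faddr (fr a b c) (fr a' b' c') =
  fr (a * (c' + 1) + a' * (c + 1)) (b * (c' + 1) + b' * (c + 1)) (c * c' + c + c').
Proof.
rewrite /faddr; move: (fr_rep a b c) (fr_rep a' b' c') => /frE h /frE h'; apply/frE.
move: (nu _) (de _) (dn _) (nu _) (de _) (dn _) h h' => x' y' z' x y z h h'.
transitivity ((x * (c + 1) + b * (z + 1)) * ((z' + 1) * (c' + 1)) +
 (x' * (c' + 1) + b' * (z' + 1)) * ((z + 1) * (c + 1))); first by ring.
by rewrite h h'; ring.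
Qed.

Let fmul_congr (p q r a b c a' b' c' : N) : fr a b c = fr a' b' c' ->
  fr (p * a + q * b) (p * b + q * a) (r * c + r + c) =
  fr (p * a' + q * b') (p * b' + q * a') (r * c' + r + c').
Proof.
move=> /frE h; apply/frE.
transitivity ((r + 1) * (p * (a * (c' + 1) + b' * (c + 1)) +
  q * (a' * (c + 1) + b * (c' + 1)))); first by ring.
by rewrite -h [X in p * X]h; ring.
Qed.

Lemma fmulE a b c a' b' c' : fmulr (fr a b c) (fr a' b' c') =
  fr (a * a' + b * b') (a * b' + b * a') (c * c' + c + c').
Proof.
rewrite /fmulr (fmul_congr _ _ _ (fr_rep a' b' c')).
have := fmul_congr a' b' c' (fr_rep a b c).
by congr (_ = _); congr fr; ring.
Qed.

Lemma foppE a b c : foppr (fr a b c) = fr b a c.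
Proof.
rewrite /foppr; have /frE h := fr_rep a b c; apply/frE.
by rewrite addrC -h addrC.
Qed.

Definition fnonneg (x : ffrac) := ~ lt (nu x) (de x).

Let lt_mul_iff a b c : lt (a * (c + 1)) (b * (c + 1)) <-> lt a b.
Proof.
split=> [h|]; last exact/lt_mul.
case: (lt_tot a b) => [//|e|/(lt_mul (posS c)) h']; first by move: h; rewrite e => /lt_irr.
by case: (lt_irr (lt_tr h h')).
Qed.

Lemma fnonnegE a b c : fnonneg (fr a b c) <-> ~ lt a b.
Proof.
rewrite /fnonneg; have /frE h := fr_rep a b c.
move: (nu _) (de _) (dn _) h => x y z h.
have e u v u' v' w w' : u * (w' + 1) + v' * (w + 1) = u' * (w + 1) + v * (w' + 1) ->
    lt u v -> lt u' v'.
  move=> h1 /(lt_mul_iff _ _ w') h2; apply: contrapT => /(contra_not (lt_mul_iff _ _ w).1) h3.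
  by have := lt_add2 h2 h3; rewrite h1 addrC => /lt_irr.
by split=> h1 h2; apply: h1; move: h2; apply: e; [symmetry|]; exact: h.
Qed.

Let faddA : associative faddr.
Proof.
move=> x y z; have [? [? [? ->]]] := frP x; have [? [? [? ->]]] := frP y.
by have [? [? [? ->]]] := frP z; rewrite !faddE; apply/frE; ring.
Qed.

Let faddC : commutative faddr.
Proof.
move=> x y; have [? [? [? ->]]] := frP x; have [? [? [? ->]]] := frP y.
by rewrite !faddE; apply/frE; ring.
Qed.

Let fadd0 : left_id (fr 0 0 0) faddr.
Proof. by move=> x; have [? [? [? ->]]] := frP x; rewrite !faddE; apply/frE; ring. Qed.

Let faddN : left_inverse (fr 0 0 0) foppr faddr.
Proof. by move=> x; have [? [? [? ->]]] := frP x; rewrite foppE !faddE; apply/frE; ring. Qed.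

HB.instance Definition _ := GRing.isZmodule.Build ffrac faddA faddC fadd0 faddN.

Let fmulA : associative fmulr.
Proof.
move=> x y z; have [? [? [? ->]]] := frP x; have [? [? [? ->]]] := frP y.
by have [? [? [? ->]]] := frP z; rewrite !fmulE; apply/frE; ring.
Qed.

Let fmulC : commutative fmulr.
Proof.
move=> x y; have [? [? [? ->]]] := frP x; have [? [? [? ->]]] := frP y.
by rewrite !fmulE; apply/frE; ring.
Qed.

Let fmul1 : left_id (fr 1 0 0) fmulr.
Proof. by move=> x; have [? [? [? ->]]] := frP x; rewrite !fmulE; apply/frE; ring. Qed.

Let fmulD : left_distributive fmulr +%R.
Proof.
move=> x y z; have [? [? [? ->]]] := frP x; have [? [? [? ->]]] := frP y.
have [? [? [? ->]]] := frP z; rewrite -![_ + _]/(faddr _ _) !(faddE, fmulE).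
by apply/frE; ring.
Qed.

Let f1_neq0 : fr 1 0 0 != 0.
Proof.
apply/eqP => /frE h; have e : 1 = 0 :> N; last by apply: (@lt_irr 0); rewrite -[X in lt _ X]e.
by transitivity (1 * (0 + 1) + 0 * (0 + 1) : N); [ring|rewrite h; ring].
Qed.

HB.instance Definition _ :=
  GRing.Zmodule_isComNzRing.Build ffrac fmulA fmulC fmul1 fmulD f1_neq0.

(** By [lt_sub] a nonzero numerator has the form [d + 1] up to sign, which is exactly the form of a
    denominator. *)
Lemma finv_ex (x : ffrac) : exists y, (x != 0 -> y * x = 1) /\ (x = 0 -> y = 0).
Proof.
have [-> |/eqP x0] := EM (x = 0); first by exists 0; rewrite eqxx.
suff [y hy] : exists y, y * x = 1 by exists y; split=> // /eqP; rewrite (negbTE x0).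
move: x0; have [a [b [c ->]]] := frP x => /eqP x0.
case: (lt_tot a b) => [/lt_sub [d ->]|h|/lt_sub [d ->]].
- exists (fr 0 (c + 1) d); rewrite -[LHS]/(fmulr _ _) fmulE; apply/frE; ring.
- by case: x0; apply/frE; rewrite h; ring.
- exists (fr (c + 1) 0 d); rewrite -[LHS]/(fmulr _ _) fmulE; apply/frE; ring.
Qed.

Definition finv (x : ffrac) : ffrac := sval (cid (finv_ex x)).

Let fmulV x : x != 0 -> finv x * x = 1.
Proof. exact: (svalP (cid (finv_ex x))).1. Qed.

Let finv0 : finv 0 = 0.
Proof. exact: (svalP (cid (finv_ex 0))).2. Qed.

HB.instance Definition _ := GRing.ComNzRing_isField.Build ffrac fmulV finv0.

Definition fle (x y : ffrac) : bool := `[< fnonneg (y - x) >].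
Definition flt (x y : ffrac) : bool := (y != x) && fle x y.
Definition fnorm (x : ffrac) : ffrac := if fle 0 x then x else - x.

Let nlt_add u v u' v' : ~ lt u v -> ~ lt u' v' -> ~ lt (u + u') (v + v').
Proof.
move=> h h' h''; case: (lt_tot u v) => // [e|/lt_add2 /(_ h') /lt_tr /(_ h'') /lt_irr//].
subst v; case: (lt_tot u' v') => // [e|/lt_add2 /(_ h)]; first by subst v'; exact: lt_irr h''.
by rewrite addrC (addrC u') => /lt_tr /(_ h'') /lt_irr.
Qed.

Let nlt_sub a b : ~ lt a b -> exists d, a = b + d.
Proof.
case: (lt_tot a b) => // [->|/lt_sub [d ->]] _; first by exists 0; rewrite addr0.
by exists (d + 1); rewrite addrA.
Qed.

Let fle0 x : fle 0 x = `[< fnonneg x >].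
Proof. by rewrite /fle subr0. Qed.

Let fleD x y : fle 0 x -> fle 0 y -> fle 0 (x + y).
Proof.
have [a [b [c ->]]] := frP x; have [a' [b' [c' ->]]] := frP y.
rewrite !fle0 => /asboolP /fnonnegE h /asboolP /fnonnegE h'; apply/asboolP.
rewrite -[_ + _]/(faddr _ _) faddE; apply/fnonnegE => h''.
by move: h''; apply: nlt_add => /lt_mul_iff.
Qed.

Let fleM x y : fle 0 x -> fle 0 y -> fle 0 (x * y).
Proof.
have [a [b [c ->]]] := frP x; have [a' [b' [c' ->]]] := frP y.
rewrite !fle0 => /asboolP /fnonnegE h /asboolP /fnonnegE h'; apply/asboolP.
rewrite -[_ * _]/(fmulr _ _) fmulE; apply/fnonnegE.
have [d ->] := nlt_sub h; have [d' ->] := nlt_sub h'.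
have -> : (b + d) * (b' + d') + b * b' = (b + d) * b' + b * (b' + d') + d * d' by ring.
move: (_ + _) (d * d') => u v huv; case: (lt_tot 0 v) => [/lt_add h0|v0|/lt_0//].
  by have := h0 u; rewrite add0r addrC => /lt_tr /(_ huv) /lt_irr.
by move: huv; rewrite -v0 addr0 => /lt_irr.
Qed.

Let fle_anti x : fle 0 x -> fle x 0 -> x = 0.
Proof.
have [a [b [c ->]]] := frP x; rewrite fle0 /fle sub0r => /asboolP /fnonnegE h /asboolP.
rewrite -[- _]/(foppr _) foppE => /fnonnegE h'; apply/frE.
by case: (lt_tot a b) => // ->; ring.
Qed.

Let fsub_ge0 x y : fle 0 (y - x) = fle x y.
Proof. by rewrite fle0. Qed.

Let fle_total x : fle 0 x || fle x 0.
Proof.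
have [a [b [c ->]]] := frP x; apply/orP; rewrite fle0 /fle sub0r.
rewrite -[- _]/(foppr _) foppE; case: (EM (lt a b)) => h; [right|left];
  apply/asboolP/fnonnegE => // h'; exact: lt_irr (lt_tr h h').
Qed.

Let fnormN x : fnorm (- x) = fnorm x.
Proof.
rewrite /fnorm; case: ifP => h; case: ifP => h'; rewrite ?opprK //.
- have h0 : fle x 0 by rewrite -fsub_ge0 sub0r.
  by rewrite (fle_anti h' h0) oppr0.
- by have := fle_total x; rewrite h' /= -fsub_ge0 sub0r h.
Qed.

Let fnorm_ge0 x : fle 0 x -> fnorm x = x.
Proof. by rewrite /fnorm => ->. Qed.

HB.instance Definition _ := Num.IntegralDomain_isLeReal.Build ffrac
  fleD fleM fle_anti fsub_ge0 fle_total fnormN fnorm_ge0 (fun x y => erefl (flt x y)).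

Theorem ordered_field_embedding : exists (K : realFieldType) (f : N -> K),
  [/\ f 0 = 0, f 1 = 1, forall a b, f (a + b) = f a + f b,
      forall a b, f (a * b) = f a * f b & forall a b, lt a b <-> f a < f b].
Proof.
exists (ffrac : realFieldType), (fun a => fr a 0 0); split=> //.
- by move=> a b; rewrite -[RHS]/(faddr _ _) faddE; apply/frE; ring.
- by move=> a b; rewrite -[RHS]/(fmulr _ _) fmulE; apply/frE; ring.
- move=> a b; rewrite ltNge -[(_ <= _)]/(fle _ _) /fle.
  rewrite -[_ - _]/(faddr _ (foppr _)) foppE faddE; split=> [h|].
    by apply/asboolP => /fnonnegE; apply; rewrite !(mul0r, mulr1, addr0, add0r, mulr0).
  move=> /asboolPn h; apply: contrapT => h'; apply: h; apply/fnonnegE => h; apply: h'; move: h.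
  by rewrite !(mul0r, mulr1, addr0, add0r, mulr0).
Qed.

End FractionField.

(** * Rationals and reals in a model *)

Record embedding (M : model) (K : realFieldType) (f : M Nat -> K) : Prop := {
  emb0 : f (zeroM M) = 0%R;
  emb1 : f (oneM M) = 1%R;
  embD : forall a b, f (addM a b) = (f a + f b)%R;
  embM : forall a b, f (mulM a b) = (f a * f b)%R;
  emb_lt : forall a b, ltM a b <-> (f a < f b)%R }.

Section Reals.
Local Open Scope ring_scope.
Variables (M : model) (hM : rca M) (K : realFieldType) (f : M Nat -> K).
Hypothesis hf : embedding f.
Let f0 := emb0 hf.
Let f1 := emb1 hf.
Let fD := embD hf.
Let fM := embM hf.
Let flt := emb_lt hf.

Lemma f_inj a b : f a = f b -> a = b.
Proof. by case: (rca_lt_tot hM a b) => // /flt h e; move: h; rewrite e ltxx. Qed.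

Lemma f_ge0 a : 0 <= f a.
Proof. by rewrite leNgt -f0; apply/negP => /flt /(rca_lt_0 hM). Qed.

Lemma f_lt_discrete a b : f a < f b <-> f a + 1 <= f b.
Proof.
split=> [/flt /(rca_lt_discrete hM) [/flt h|<-]|h].
- by rewrite -f1 -fD ltW.
- by rewrite fD f1.
- by apply: lt_le_trans h; rewrite ltrDl.
Qed.

Definition pairM (a b : M Nat) : M Nat := addM (mulM (addM a b) (addM a b)) a.
Definition codeM (a b c : M Nat) : M Nat := pairM a (pairM b c).

Lemma f_pairM a b : f (pairM a b) = (f a + f b) * (f a + f b) + f a.
Proof. by rewrite /pairM fD fM !fD. Qed.

(** Since [s^2 + a < (s+1)^2] for [s = a + b], the sum can be read off the code, and then [a].
    Discreteness of the numbers inside [K] turns [s < s'] into [s + 1 <= s']. *)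
Lemma pairM_inj a b c d : pairM a b = pairM c d -> a = c /\ b = d.
Proof.
move=> /(congr1 f); rewrite !f_pairM => h.
have lt_absurd (x y x' y' : M Nat) : f x + f y < f x' + f y' ->
    (f x + f y) * (f x + f y) + f x <> (f x' + f y') * (f x' + f y') + f x'.
  rewrite -!fD => /f_lt_discrete; rewrite !fD.
  move: (f_ge0 x) (f_ge0 y) (f_ge0 x') (f_ge0 y').
  by move: (f x) (f y) (f x') (f y') => u v u' v' hu hv hu' hv' hs hh; nra.
have e : f a + f b = f c + f d.
  by case: (ltgtP (f a + f b) (f c + f d)) => // /lt_absurd; [move/(_ h)|move/(_ (esym h))].
have eac : f a = f c by move: h; rewrite e => /addrI.
by split; apply: f_inj => //; move: e; rewrite eac => /addrI.
Qed.

Definition dec (c : M Nat) (q : K) :=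
  exists x y z, c = codeM x y z /\ q = (f x - f y) / (f z + 1).

Definition isdec (c : M Nat) := exists q, dec c q.

Definition qof (c : M Nat) : K := xget 0 (dec c).

Lemma dec_uniq c q r : dec c q -> dec c r -> q = r.
Proof.
move=> [x [y [z [-> ->]]]] [x' [y' [z' [+ ->]]]].
by rewrite /codeM => /pairM_inj [-> /pairM_inj [-> ->]].
Qed.

Lemma qofE c q : dec c q -> qof c = q.
Proof. by move=> h; rewrite /qof; case: xgetP => [_ -> /dec_uniq|/(_ q)]; [apply|]. Qed.

Lemma isdec_qof c : isdec c -> dec c (qof c).
Proof. by move=> [q hq]; rewrite (qofE hq). Qed.

Definition p2M (n : M Nat) : M Nat := ev (econs n (self (M := M))) (pow2 (Var vz)).

Lemma p2M0 : p2M (zeroM M) = oneM M.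
Proof. exact: rca_rec0 hM _ _. Qed.

Lemma p2MS n : p2M (addM n (oneM M)) = addM (p2M n) (p2M n).
Proof.
rewrite {1}/p2M /= (rca_recS hM).
by have [hK hS] := rca_comb hM; rewrite !hS !hK.
Qed.

Definition t2 (n : M Nat) : K := (f (p2M n))^-1.

(** The exponent may be nonstandard, so this is an internal induction on a quantifier-free formula,
    as is [p2MD]. *)
Lemma p2M_gt0 n : 0 < f (p2M n).
Proof.
rewrite -f0; apply/flt; move: n.
apply: (rca_ind hM (A := Zero ≺ pow2 (Var vz)) (rho := self (M := M))) => //.
  by rewrite -[sat _ _]/(ltM _ (p2M (zeroM M))) p2M0; apply/flt; rewrite f0 f1.
move=> n /flt h; rewrite -[sat _ _]/(ltM (zeroM M) (p2M (addM n (oneM M)))).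
by apply/flt; rewrite p2MS fD f0 addr_gt0 //; move: h; rewrite -[X in _ < f X]/(p2M n) f0.
Qed.

Lemma p2MD m n : p2M (addM m n) = mulM (p2M m) (p2M n).
Proof.
pose A : fm (ext (dom M) Nat) :=
  pow2 (Var (vs m) ⊕ Var vz) ≐ pow2 (Var (vs m)) ⊗ pow2 (Var vz).
have e k : sat A (econs k (self (M := M))) = (p2M (addM m k) = mulM (p2M m) (p2M k)) by [].
move: n; have := rca_ind hM (A := A) (rho := self (M := M)) I.
rewrite !e (rca_add0 hM) p2M0 (rca_mul1 hM) => /(_ erefl) h n.
rewrite -e; apply: h => {}n; rewrite !e => h.
by rewrite (rca_addA hM) !p2MS h (rca_distr hM).
Qed.

Lemma t2_gt0 n : 0 < t2 n.
Proof. by rewrite invr_gt0 p2M_gt0. Qed.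

Lemma t2S n : t2 (addM n (oneM M)) = t2 n / 2.
Proof.
have /lt0r_neq0 h := p2M_gt0 n.
by rewrite /t2 p2MS fD; field; rewrite h -mulr2n mulrn_eq0 /= h.
Qed.

Lemma t2D m n : t2 (addM m n) = t2 m * t2 n.
Proof. by rewrite /t2 p2MD fM invfM. Qed.

Lemma t2_p2 n : t2 n * f (p2M n) = 1.
Proof. by rewrite mulVf // lt0r_neq0 // p2M_gt0. Qed.

(** * Rational expressions in a model *)

Definition qv V (rho : env M V) (e : qexp V) : K :=
  (f (ev rho (qpos e)) - f (ev rho (qneg e))) / f (ev rho (qden e)).

Definition qok V (rho : env M V) (e : qexp V) := 0 < f (ev rho (qden e)).

Lemma qok_add V (rho : env M V) a b : qok rho a -> qok rho b -> qok rho (qadd a b).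
Proof. by rewrite /qok /= -/(mulM _ _) fM; exact: mulr_gt0. Qed.

Lemma qok_sub V (rho : env M V) a b : qok rho a -> qok rho b -> qok rho (qsub a b).
Proof. exact: qok_add. Qed.

Lemma qok_pow2 V (rho : env M V) n : qok rho (inv_pow2 n).
Proof. exact: p2M_gt0. Qed.

Lemma qok_pow2_pred V (rho : env M V) n : qok rho (inv_pow2_pred n).
Proof. exact: p2M_gt0. Qed.

Lemma qv_opp V (rho : env M V) a : qv rho (qopp a) = - qv rho a.
Proof. by rewrite /qv /= -mulNr opprB. Qed.

Lemma qv_add V (rho : env M V) a b : qok rho a -> qok rho b ->
  qv rho (qadd a b) = qv rho a + qv rho b.
Proof.
rewrite /qok /qv /= -!/(mulM _ _) -!/(addM _ _) !(fM, fD) => /lt0r_neq0 ha /lt0r_neq0 hb.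
by field; rewrite ha hb.
Qed.

Lemma qv_sub V (rho : env M V) a b : qok rho a -> qok rho b ->
  qv rho (qsub a b) = qv rho a - qv rho b.
Proof. by move=> ha hb; rewrite qv_add // qv_opp. Qed.

Lemma qv_pow2 V (rho : env M V) n : qv rho (inv_pow2 n) = t2 (ev rho n).
Proof. by rewrite /qv /= f0 f1 subr0 mul1r. Qed.

Lemma qv_pow2_pred V (rho : env M V) n : qv rho (inv_pow2_pred n) = 2 * t2 (ev rho n).
Proof. by rewrite /qv /= -/(addM _ _) f0 fD f1 subr0. Qed.

Lemma sat_qlt V (rho : env M V) a b : qok rho a -> qok rho b ->
  sat (qlt a b) rho <-> qv rho a < qv rho b.
Proof.
rewrite /qok /= -!/(mulM _ _) -!/(addM _ _) flt !(fM, fD) => ha hb.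
rewrite /qv ltr_pdivrMr // mulrAC ltr_pdivlMr // !mulrBl.
by rewrite ltrBlDr addrAC ltrBrDr.
Qed.

Lemma sat_qeq V (rho : env M V) a b : qok rho a -> qok rho b ->
  sat (qeq a b) rho <-> qv rho a = qv rho b.
Proof.
rewrite /qok /= -!/(mulM _ _) -!/(addM _ _) => ha hb.
have -> : qv rho a = qv rho b <->
   (f (ev rho (qpos a)) - f (ev rho (qneg a))) * f (ev rho (qden b)) =
   (f (ev rho (qpos b)) - f (ev rho (qneg b))) * f (ev rho (qden a)).
  rewrite /qv; split=> [/eqP|h]; last apply/eqP.
    by rewrite eqr_div ?lt0r_neq0 // => /eqP ->; rewrite mulrC.
  by rewrite eqr_div ?lt0r_neq0 // h mulrC.
split=> [/(congr1 f)|h]; last apply: f_inj; rewrite !(fD, fM).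
  by move=> h; rewrite !mulrBl; lra.
by move: h; rewrite !mulrBl; lra.
Qed.

Lemma sat_qle V (rho : env M V) a b : qok rho a -> qok rho b ->
  sat (qle a b) rho <-> qv rho a <= qv rho b.
Proof.
move=> ha hb; rewrite /qle sat_Or sat_qlt // sat_qeq // le_eqVlt.
by split=> [[->|->]|/orP [/eqP|]]; rewrite ?eqxx ?orbT //; [right|left].
Qed.

Lemma sat_qabs_lt V (rho : env M V) a b : qok rho a -> qok rho b ->
  sat (qabs_lt a b) rho <-> `|qv rho a| < qv rho b.
Proof.
move=> ha hb; rewrite /qabs_lt sat_And !sat_qlt // qv_opp ltr_norml ltrNl.
by split=> [[-> ->]|/andP [-> ->]].
Qed.

Lemma sat_qabs_le V (rho : env M V) a b : qok rho a -> qok rho b ->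
  sat (qabs_le a b) rho <-> `|qv rho a| <= qv rho b.
Proof.
move=> ha hb; rewrite /qabs_le sat_And !sat_qle // qv_opp ler_norml lerNl.
by split=> [[-> ->]|/andP [-> ->]].
Qed.

(** A code determines its components, so the three existential quantifiers of [decode] amount to one
    value [qof]. The body [F] need only be understood for expressions whose parts evaluate to the
    decoded components. *)
Lemma sat_decode V (c : tm V Nat) F (rho : env M V) (R : K -> Prop) :
  (forall x y z e,
     ev (econs z (econs y (econs x rho))) (qpos e) = x ->
     ev (econs z (econs y (econs x rho))) (qneg e) = y ->
     ev (econs z (econs y (econs x rho))) (qden e) = addM z (oneM M) ->
     qok (econs z (econs y (econs x rho))) e ->
     sat (F e) (econs z (econs y (econs x rho))) <->
     R (qv (econs z (econs y (econs x rho))) e)) ->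
  sat (decode c F) rho <-> isdec (ev rho c) /\ R (qof (ev rho c)).
Proof.
move=> h; rewrite /decode sat_ex_var.
pose x3 : tm (ext (ext (ext V Nat) Nat) Nat) Nat :=
  @wk _ _ (sub_ext _ _ Nat (sub_ext _ _ Nat (sub_refl (ext V Nat)))) _ (Var vz).
pose y3 : tm (ext (ext (ext V Nat) Nat) Nat) Nat :=
  @wk _ _ (sub_ext _ _ Nat (sub_refl (ext (ext V Nat) Nat))) _ (Var vz).
have h' x y z : sat (F (Qexp x3 y3 (Var vz ⊕ One)))
    (econs z (econs y (econs x rho))) <-> R ((f x - f y) / (f z + 1)).
  rewrite h //=; last by rewrite /qok /= -/(addM _ _) fD f1 ltr_wpDl ?f_ge0.
  by rewrite /qv /= -/(addM _ _) fD f1.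
split.
  move=> [x]; rewrite sat_ex_var => -[y]; rewrite sat_ex_var => -[z].
  rewrite sat_And => -[hc hF].
  have hd : dec (ev rho c) ((f x - f y) / (f z + 1)).
    by exists x, y, z; split=> //; move: hc; rewrite /= /wk ?ev_ren.
  by split; [exists ((f x - f y) / (f z + 1))|rewrite (qofE hd); apply/h'].
move=> [/isdec_qof [x [y [z [hc ->]]]] hR].
exists x; rewrite sat_ex_var; exists y; rewrite sat_ex_var; exists z.
by rewrite sat_And; split; [rewrite /= /wk ?ev_ren|apply/h'].
Qed.

Lemma qv_wk V W (i : Sub V W) (rho : env M W) e :
  qv rho (qwk e) = qv (fun t v => rho t (i t v)) e.
Proof. by rewrite /qv /= /wk ?ev_ren. Qed.

Lemma qok_wk V W (i : Sub V W) (rho : env M W) e :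
  qok rho (qwk e) = qok (fun t v => rho t (i t v)) e.
Proof. by rewrite /qok /= /wk ?ev_ren. Qed.

(** * Real numbers in a model *)

Definition xq (x : M (pure 1)) (n : M Nat) : K := qof (ap x n).
Definition alldec (x : M (pure 1)) := forall n, isdec (ap x n).

Definition is_realM (x : M (pure 1)) :=
  alldec x /\ forall n i, `|xq x n - xq x (addM n i)| < t2 n.

Definition reqM (x y : M (pure 1)) :=
  [/\ alldec x, alldec y & forall n, `|xq x n - xq y n| <= 2 * t2 n].

Definition rltM (x y : M (pure 1)) :=
  exists n, [/\ isdec (ap x n), isdec (ap y n) & xq x n + 2 * t2 n < xq y n].

Definition is_raddM (x y u : M (pure 1)) := forall n,
  [/\ isdec (ap x (addM n (oneM M))), isdec (ap y (addM n (oneM M))), isdec (ap u n) &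
    xq u n = xq x (addM n (oneM M)) + xq y (addM n (oneM M))].

Definition is_rsubM (x y u : M (pure 1)) := forall n,
  [/\ isdec (ap x (addM n (oneM M))), isdec (ap y (addM n (oneM M))), isdec (ap u n) &
    xq u n = xq x (addM n (oneM M)) - xq y (addM n (oneM M))].

Lemma forall_iff (T : Type) (P Q : T -> Prop) :
  (forall x, P x <-> Q x) -> (forall x, P x) <-> (forall x, Q x).
Proof. by move=> h; split=> H x; apply/h. Qed.

Lemma and_iff (A A' B B' : Prop) : (A <-> A') -> (B <-> B') -> A /\ B <-> A' /\ B'.
Proof. by move=> -> ->. Qed.

Lemma imp_iff (A B B' : Prop) : (B <-> B') -> (A -> B) <-> (A -> B').
Proof. by move=> ->. Qed.

Lemma exists_iff (T : Type) (P Q : T -> Prop) :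
  (forall x, P x <-> Q x) -> (exists x, P x) <-> (exists x, Q x).
Proof. by move=> h; split=> -[x hx]; exists x; apply/h. Qed.

Lemma sat_decode2 V (c : tm V Nat) D G (rho : env M V) (d : M Nat) (R : K -> K -> Prop) :
  (forall x y z, ev (econs z (econs y (econs x rho))) D = d) ->
  (forall x y z x' y' z' e e',
     let rho' := econs z (econs y (econs x rho)) in
     let rho'' := econs z' (econs y' (econs x' rho')) in
     qok rho' e -> qok rho'' e' -> sat (G e e') rho'' <-> R (qv rho' e) (qv rho'' e')) ->
  sat (decode c (fun a => decode D (G a))) rho <->
    [/\ isdec (ev rho c), isdec d & R (qof (ev rho c)) (qof d)].
Proof.
move=> hD hG.
apply: (iff_trans (@sat_decode _ _ _ _ (fun q => isdec d /\ R q (qof d)) _)); last first.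
  by split=> [[? [? ?]]|[? ? ?]].
move=> x y z e _ _ _ he.
apply: (iff_trans (@sat_decode _ _ _ _ (fun q => R (qv (econs z (econs y (econs x rho))) e) q) _)).
  by move=> x' y' z' e' _ _ _ he'; apply: hG.
by rewrite hD.
Qed.

Lemma sat_is_real V (x : tm V (pure 1)) (rho : env M V) :
  sat (is_real x) rho <-> is_realM (ev rho x).
Proof.
set X := ev rho x.
apply: (@iff_trans _ (forall n i, [/\ isdec (ap X n), isdec (ap X (addM n i)) &
    `|xq X n - xq X (addM n i)| < t2 n])); last first.
  split=> [h|[h h'] n i]; last by split.
  by split=> [n|n i]; [case: (h n n)|case: (h n i)].
rewrite /is_real sat_all_var; apply: forall_iff => n; rewrite sat_all_var.
apply: forall_iff => i.
apply: (iff_trans (@sat_decode2 _ _ _ _ _ (ap X (addM n i)) (fun a b => `|a - b| < t2 n) _ _)).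
- by move=> a b c; rewrite /= /wk ?ev_ren.
- move=> a b c a' b' c' e e' rho' rho'' he he'.
  have he1 : qok rho'' (qwk e) by rewrite qok_wk.
  rewrite sat_qabs_lt; [|exact: qok_sub|exact: qok_pow2].
  by rewrite qv_sub // qv_wk qv_pow2 /= /wk ?ev_ren.
- by rewrite /= /wk ?ev_ren.
Qed.

Lemma sat_req V (x y : tm V (pure 1)) (rho : env M V) :
  sat (req x y) rho <-> reqM (ev rho x) (ev rho y).
Proof.
set X := ev rho x; set Y := ev rho y.
apply: (@iff_trans _ (forall n, [/\ isdec (ap X n), isdec (ap Y n) &
    `|xq X n - xq Y n| <= 2 * t2 n])); last first.
  split=> [h|[h h' h''] n]; last by split.
  by split=> n; case: (h n).
rewrite /req sat_all_var; apply: forall_iff => n.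
apply: (iff_trans (@sat_decode2 _ _ _ _ _ (ap Y n) (fun a b => `|a - b| <= 2 * t2 n) _ _)).
- by move=> a b c; rewrite /= /wk ?ev_ren.
- move=> a b c a' b' c' e e' rho' rho'' he he'.
  have he1 : qok rho'' (qwk e) by rewrite qok_wk.
  rewrite sat_qabs_le; [|exact: qok_sub|exact: qok_pow2_pred].
  by rewrite qv_sub // qv_wk qv_pow2_pred /= /wk ?ev_ren.
- by rewrite /= /wk ?ev_ren.
Qed.

Lemma sat_rlt V (x y : tm V (pure 1)) (rho : env M V) :
  sat (rlt x y) rho <-> rltM (ev rho x) (ev rho y).
Proof.
set X := ev rho x; set Y := ev rho y.
rewrite /rlt sat_ex_var; apply: exists_iff => n.
apply: (iff_trans (@sat_decode2 _ _ _ _ _ (ap Y n) (fun a b => a + 2 * t2 n < b) _ _)).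
- by move=> a b c; rewrite /= /wk ?ev_ren.
- move=> a b c a' b' c' e e' rho' rho'' he he'.
  have he1 : qok rho'' (qwk e) by rewrite qok_wk.
  rewrite sat_qlt; [|apply: qok_add => //; exact: qok_pow2_pred|by []].
  rewrite qv_add //; last exact: qok_pow2_pred.
  by rewrite qv_wk qv_pow2_pred /= /wk ?ev_ren.
- by rewrite /= /wk ?ev_ren.
Qed.

Lemma sat_rle V (x y : tm V (pure 1)) (rho : env M V) :
  sat (rle x y) rho <-> ~ rltM (ev rho y) (ev rho x).
Proof. by rewrite /rle sat_Not sat_rlt. Qed.

Lemma sat_decode3 V (c : tm V Nat) D D' (G : qexp (ext (ext (ext V Nat) Nat) Nat) -> _)
    (rho : env M V) (d d' : M Nat) op :
  (forall x y z, ev (econs z (econs y (econs x rho))) D = d) ->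
  (forall x y z x' y' z', ev (econs z' (econs y' (econs x'
    (econs z (econs y (econs x rho)))))) D' = d') ->
  (forall x y z x' y' z' x'' y'' z'' e e' e'',
     let rho' := econs z (econs y (econs x rho)) in
     let rho'' := econs z' (econs y' (econs x' rho')) in
     let rho3 := econs z'' (econs y'' (econs x'' rho'')) in
     qok rho' e -> qok rho'' e' -> qok rho3 e'' ->
     sat (G e e' e'') rho3 <-> qv rho3 e'' = op (qv rho' e) (qv rho'' e')) ->
  sat (decode c (fun a => decode D (fun b => decode D' (G a b)))) rho <->
    [/\ isdec (ev rho c), isdec d, isdec d' & qof d' = op (qof (ev rho c)) (qof d)].
Proof.
move=> hD hD' hG.
apply: (iff_trans (@sat_decode2 _ _ _ _ _ d (fun a b => isdec d' /\ qof d' = op a b) hD _));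
  last by split=> [[? ? [? ?]]|[? ? ? ?]].
move=> x y z x' y' z' e e' rho' rho'' he he'.
apply: (iff_trans (@sat_decode _ _ _ _ (fun q => q = op (qv rho' e) (qv rho'' e')) _)).
  by move=> x'' y'' z'' e'' _ _ _ he''; apply: hG.
by rewrite hD'.
Qed.

Lemma sat_is_radd V (x y u : tm V (pure 1)) (rho : env M V) :
  sat (is_radd x y u) rho <-> is_raddM (ev rho x) (ev rho y) (ev rho u).
Proof.
set X := ev rho x; set Y := ev rho y; set U := ev rho u.
rewrite /is_radd sat_all_var; apply: forall_iff => n.
apply: (iff_trans (@sat_decode3 _ _ _ _ _ _ (ap Y (addM n (oneM M))) (ap U n)
  (fun a b => a + b) _ _ _)).
- by move=> a b c; rewrite /= /wk ?ev_ren.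
- by move=> a b c a' b' c'; rewrite /= /wk ?ev_ren.
- move=> a b c a' b' c' a'' b'' c'' e e' e'' rho' rho'' rho3 he he' he''.
  have he1 : qok rho3 (qwk e) by rewrite qok_wk.
  have he2 : qok rho3 (qwk e') by rewrite qok_wk.
  rewrite sat_qeq; [|by []|exact: qok_add].
  by rewrite qv_add // !qv_wk.
- by rewrite /= /wk ?ev_ren.
Qed.

Lemma sat_is_rsub V (x y u : tm V (pure 1)) (rho : env M V) :
  sat (is_rsub x y u) rho <-> is_rsubM (ev rho x) (ev rho y) (ev rho u).
Proof.
set X := ev rho x; set Y := ev rho y; set U := ev rho u.
rewrite /is_rsub sat_all_var; apply: forall_iff => n.
apply: (iff_trans (@sat_decode3 _ _ _ _ _ _ (ap Y (addM n (oneM M))) (ap U n)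
  (fun a b => a - b) _ _ _)).
- by move=> a b c; rewrite /= /wk ?ev_ren.
- by move=> a b c a' b' c'; rewrite /= /wk ?ev_ren.
- move=> a b c a' b' c' a'' b'' c'' e e' e'' rho' rho'' rho3 he he' he''.
  have he1 : qok rho3 (qwk e) by rewrite qok_wk.
  have he2 : qok rho3 (qwk e') by rewrite qok_wk.
  rewrite sat_qeq; [|by []|exact: qok_sub].
  by rewrite qv_sub // !qv_wk.
- by rewrite /= /wk ?ev_ren.
Qed.

Definition rzeroM : M (pure 1) := ev (self (M := M)) rzero.
Definition roneM : M (pure 1) := ev (self (M := M)) rone.

Definition in_unitM (x : M (pure 1)) :=
  [/\ is_realM x, ~ rltM x rzeroM & ~ rltM roneM x].

Lemma sat_in_unit V (x : tm V (pure 1)) (rho : env M V) :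
  sat (in_unit x) rho <-> in_unitM (ev rho x).
Proof.
rewrite /in_unit !sat_And sat_is_real !sat_rle.
by split=> [[? [? ?]]|[? ? ?]].
Qed.

Definition is_posfunM (P : M (Arr (pure 1) (pure 1))) :=
  (forall x, is_realM x -> is_realM (ap P x) /\ rltM rzeroM (ap P x)) /\
  (forall x y, is_realM x -> is_realM y -> reqM x y -> reqM (ap P x) (ap P y)).

Lemma sat_is_posfun V (P : tm V (Arr (pure 1) (pure 1))) (rho : env M V) :
  sat (is_posfun P) rho <-> is_posfunM (ev rho P).
Proof.
rewrite /is_posfun sat_And !sat_all_var; apply: and_iff; apply: forall_iff => x.
  rewrite sat_Imp sat_And !sat_is_real sat_rlt /= /wk ?ev_ren.
  by [].
rewrite sat_all_var; apply: forall_iff => y.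
by rewrite !sat_Imp !sat_is_real !sat_req /= /wk ?ev_ren.
Qed.

Definition in_intervalM (P : M (Arr (pure 1) (pure 1))) (y x : M (pure 1)) :=
  exists u v, [/\ is_rsubM y (ap P y) u, is_raddM y (ap P y) v, rltM u x & rltM x v].

Lemma sat_in_interval V P (y x : tm V (pure 1)) (rho : env M V) :
  sat (in_interval P y x) rho <-> in_intervalM (ev rho P) (ev rho y) (ev rho x).
Proof.
rewrite /in_interval sat_ex_var; apply: exists_iff => u.
rewrite sat_ex_var; apply: exists_iff => v.
rewrite !sat_And sat_is_rsub sat_is_radd !sat_rlt /= /wk ?ev_ren.
by split=> [[? [? [? ?]]]|[? ? ? ?]].
Qed.

Definition HBU_M := forall P, is_posfunM P -> exists (k : M Nat) (w : M (Arr Nat (pure 1))),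
  (forall i, ltM i k -> in_unitM (ap w i)) /\
  forall x, in_unitM x -> exists i, ltM i k /\ in_intervalM P (ap w i) x.

Lemma sat_HBU V (rho : env M V) : sat HBU rho <-> HBU_M.
Proof.
rewrite /HBU sat_all_var; apply: forall_iff => P; rewrite sat_Imp sat_is_posfun.
apply: imp_iff; rewrite sat_ex_var; apply: exists_iff => k.
rewrite sat_ex_var; apply: exists_iff => w.
rewrite sat_And !sat_all_var; apply: and_iff; apply: forall_iff => x.
  by rewrite sat_Imp sat_in_unit /= /wk ?ev_ren.
rewrite sat_Imp sat_in_unit sat_ex_var; apply: imp_iff; apply: exists_iff => i.
by rewrite sat_And sat_in_interval /= /wk ?ev_ren.
Qed.

End Reals.

Lemma rca_embedding (M : model) (hM : rca M)
    (hsub : forall a b, ltM a b -> exists c, b = addM (addM a c) (oneM M)) :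
  exists (K : realFieldType) (f : M Nat -> K), embedding f.
Proof.
have addC : commutative (@addM M) by exact: rca_addC.
have mulC : commutative (@mulM M) by exact: rca_mulC.
have add0 : left_id (zeroM M) (@addM M) by move=> x; rewrite addC rca_add0.
have mul1 : left_id (oneM M) (@mulM M) by move=> x; rewrite mulC rca_mul1.
have mul0 : left_zero (zeroM M) (@mulM M) by move=> x; rewrite mulC rca_mul0.
have distr : left_distributive (@mulM M) (@addM M).
  by move=> x y z; rewrite !(mulC _ z) rca_distr.
pose C := HB.pack_for choiceType (M Nat) (gen_eqMixin (M Nat)) (gen_choiceMixin (M Nat)).
pose Z := HB.pack_for nmodType C (GRing.isNmodule.Build C (rca_addA hM) addC add0).
pose N := HB.pack_for comPzSemiRingType Z
  (GRing.Nmodule_isComPzSemiRing.Build Z (rca_mulA hM) mulC mul1 distr mul0).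
have lt01 : @ltM M (zeroM M) (oneM M).
  by apply/(rca_lt_discrete hM); right; rewrite add0.
have [K [f [*]]] := @ordered_field_embedding N (@ltM M) (rca_lt_irr hM) (rca_lt_tr hM) (rca_lt_tot hM)
  (rca_lt_add hM) (rca_lt_mul hM) (rca_lt_0 hM) lt01 hsub.
by exists K, f.
Qed.

(** * Cousin's lemma inside a model *)

(** [x] lies in the closed interval [[j / 2^N, (j + 1) / 2^N]]. *)
Definition cellf {V} (N j : tm V Nat) (x : tm V (pure 1)) : fm V :=
  ∀[ n ∷ Nat ] decode (↑x ⋅ n) (fun a =>
    qle (Qexp ↑j Zero (pow2 ↑N)) (qadd a (inv_pow2_pred ↑n)) ∧∧
    qle a (qadd (Qexp (↑j ⊕ One) Zero (pow2 ↑N)) (inv_pow2_pred ↑n))).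

Definition ball_coversf {V} (P : tm V (Arr (pure 1) (pure 1))) (m j : tm V Nat)
    (y : tm V (pure 1)) : fm V :=
  in_unit y ∧∧
  ∀[ x ∷ pure 1 ] (in_unit x ⟶ cellf ↑m ↑j x ⟶ in_interval ↑P ↑y x).

Definition goodf {V} (P : tm V (Arr (pure 1) (pure 1))) (m j : tm V Nat) : fm V :=
  ∃[ y ∷ pure 1 ] ball_coversf ↑P ↑m ↑j y.

(** All cells of some level [n + d] to the left of [i / 2^n] are good. *)
Definition covf {V} (P : tm V (Arr (pure 1) (pure 1))) (n i : tm V Nat) : fm V :=
  ∃[ d ∷ Nat ] ∀[ j ∷ Nat ] (j ≺ ↑i ⊗ pow2 ↑d ⟶ goodf ↑P (↑n ⊕ ↑d) j).

Definition floorf {V} (p l : tm V Nat) : fm V :=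
  ∃[ j ∷ Nat ] (Not (↑l ≺ j ⊗ ↑p) ∧∧ ↑l ≺ (j ⊕ One) ⊗ ↑p).

(** [c] codes [i / 2^n] for the last [i] such that the cells to its left are covered. *)
Definition lastf {V} (P : tm V (Arr (pure 1) (pure 1))) (n c : tm V Nat) : fm V :=
  ∃[ i ∷ Nat ] ∃[ e ∷ Nat ] (↑c ≐ ratcode ↑i Zero e ∧∧ e ⊕ One ≐ pow2 ↑n ∧∧
    covf ↑P ↑n ↑i ∧∧ Not (covf ↑P ↑n (↑i ⊕ One))).

(** Expresses [j / 2^N <= x] for [j < 2^N]; the induction formula by which a point of the unit
    interval is located in a cell. *)
Definition lowerf {V} (N j : tm V Nat) (x : tm V (pure 1)) : fm V :=
  j ≺ pow2 N ⟶ ∀[ n ∷ Nat ] decode (↑x ⋅ n) (fun a =>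
    qle (Qexp ↑j Zero (pow2 ↑N)) (qadd a (inv_pow2_pred ↑n))).

Definition raddf {V} (x y : tm V (pure 1)) (n c : tm V Nat) : fm V :=
  decode (x ⋅ (n ⊕ One)) (fun a => decode (↑y ⋅ (↑n ⊕ One)) (fun b =>
    decode ↑c (fun c => qeq c (qadd (qwk a) (qwk b))))).

Definition rsubf {V} (x y : tm V (pure 1)) (n c : tm V Nat) : fm V :=
  decode (x ⋅ (n ⊕ One)) (fun a => decode (↑y ⋅ (↑n ⊕ One)) (fun b =>
    decode ↑c (fun c => qeq c (qsub (qwk a) (qwk b))))).

Section Cousin.
Local Open Scope ring_scope.
Variables (M : model) (hM : rca M) (K : realFieldType) (f : M Nat -> K).
Hypothesis hf : embedding f.
Let f0 := emb0 hf.
Let f1 := emb1 hf.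
Let fD := embD hf.
Let fM := embM hf.
Let flt := emb_lt hf.
Hypothesis hsub : forall a b : M Nat, ltM a b -> exists c, b = addM (addM a c) (oneM M).

Variable Q : ty -> Prop.
Hypotheses (Q0 : Q Nat) (Q1 : Q (pure 1)).
Hypothesis ind : forall V (A : fm (ext V Nat)) (rho : env M V), low Q A ->
  sat A (econs (zeroM M) rho) ->
  (forall n, sat A (econs n rho) -> sat A (econs (addM n (oneM M)) rho)) ->
  forall n, sat A (econs n rho).
Hypothesis ac01 : forall V (A : fm (ext (ext V Nat) (pure 1))) (rho : env M V), low Q A ->
  (forall x : M Nat, exists y : M (pure 1), sat A (econs y (econs x rho))) ->
  exists Y : M (Arr Nat (pure 1)), forall x, sat A (econs (ap Y x) (econs x rho)).

Notation "n .+1M" := (addM n (oneM M)) (at level 2, left associativity).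
Notation t := (t2 f).
Notation p2 := (p2M (M := M)).
Notation xq := (xq f).

Local Ltac low_tac := by do! split => //=; do! split.

(** A number is chosen in the guise of a function, of which only the value at [Zero] is read;
    constant functions show that this loses nothing. *)
Lemma ac00 V (A : fm (ext (ext V Nat) Nat)) (rho : env M V) : low Q A ->
  (forall x, exists y : M Nat, sat A (econs y (econs x rho))) ->
  exists Y : M (pure 1), forall x, sat A (econs (ap Y x) (econs x rho)).
Proof.
pose g : forall t, ext (ext V Nat) Nat t -> tm (ext (ext V Nat) (pure 1)) t :=
  scons (Var vz ⋅ Zero) (fun t v => Var (vs v)).
have e Y x : sat (subst_fm g A) (econs Y (econs x rho)) =
    sat A (econs (ap Y (zeroM M)) (econs x rho)).
  rewrite sat_subst; congr sat; apply: functional_extensionality_dep => t'.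
  by apply: funext => -[].
have low_subst (W : ctx) (p : fm W) : forall (W' : ctx) (r : forall t, W t -> tm W' t),
    low Q p -> low Q (subst_fm r p).
  by elim: p => {W} [W a b|W a b|W|W q IHq q' IHq'|W t' q IHq] W' r //= [h1 h2]; split; auto.
move=> /(low_subst _ _ _ g) lA h.
have [|Y hY] := ac01 (rho := rho) lA.
  move=> x; have [y hy] := h x; have [hK _] := rca_comb hM.
  by exists (ap (kM M Nat Nat) y); rewrite e hK.
have hc := rca_comb hM.
exists (ev (self (M := M)) (lam (Var (vs Y) ⋅ Var vz ⋅ Zero))) => x.
by rewrite ev_lam //= -e.
Qed.

Lemma t_gt0 n : 0 < t n. Proof. exact: t2_gt0. Qed.

Lemma t_p2 n : t n * f (p2 n) = 1.
Proof. exact: (t2_p2 hM hf n). Qed.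

Lemma p2_gt0 n : 0 < f (p2 n).
Proof. exact: (p2M_gt0 hM hf n). Qed.

Lemma lt_S a b : f a < f b <-> f a + 1 <= f b.
Proof. exact: (f_lt_discrete hM hf a b). Qed.

Lemma lt_mulS l j k : f l < (f j + 1) * f (p2 k) -> f l + 1 <= (f j + 1) * f (p2 k).
Proof.
have -> : (f j + 1) * f (p2 k) = f (mulM j.+1M (p2 k)) by rewrite fM fD f1.
by move/lt_S.
Qed.

Lemma f_S n : f n.+1M = f n + 1.
Proof. by rewrite fD f1. Qed.

Lemma le_addM a b : f a <= f b -> exists c, b = addM a c.
Proof.
rewrite le_eqVlt => /orP [/eqP /(f_inj hM hf) ->|/flt /hsub [c ->]].
  by exists (zeroM M); rewrite (rca_add0 hM).
by exists c.+1M; rewrite (rca_addA hM).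
Qed.

Lemma real_near x n m : is_realM f x -> `|xq x n - xq x m| < t n + t m.
Proof.
move=> [_ h]; have := t_gt0 n; have := t_gt0 m.
case: (leP (f n) (f m)) => [|/ltW] /le_addM [i ->] h1 h2.
  by apply: lt_le_trans (h n i) _; rewrite lerDl ltW.
by rewrite distrC; apply: lt_le_trans (h m i) _; rewrite lerDr ltW.
Qed.

Lemma dec_code a b c : dec f (codeM a b c) ((f a - f b) / (f c + 1)).
Proof. by exists a, b, c. Qed.

Lemma xq_rzero n : xq (rzeroM M) n = 0.
Proof.
have [hK _] := rca_comb hM; rewrite /xq /rzeroM /= hK.
by rewrite (qofE hM hf (dec_code _ _ _)) f0 subrr mul0r.
Qed.

Lemma xq_rone n : xq (roneM M) n = 1.
Proof.
have [hK _] := rca_comb hM; rewrite /xq /roneM /= hK.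
by rewrite (qofE hM hf (dec_code _ _ _)) f0 f1 subr0 add0r divr1.
Qed.

Lemma isdec_rzero n : isdec f (ap (rzeroM M) n).
Proof. by have [hK _] := rca_comb hM; rewrite /rzeroM /= hK; eexists; exact: dec_code. Qed.

Lemma isdec_rone n : isdec f (ap (roneM M) n).
Proof. by have [hK _] := rca_comb hM; rewrite /roneM /= hK; eexists; exact: dec_code. Qed.

Lemma in_unitE x : in_unitM f x <->
  is_realM f x /\ forall n, 0 <= xq x n + 2 * t n /\ xq x n <= 1 + 2 * t n.
Proof.
split=> [[hx h0 h1]|[hx h]].
  split=> // n; rewrite !leNgt; split; apply/negP => hn; [apply: h0|apply: h1]; exists n.
    by rewrite xq_rzero; split=> //; [exact: hx.1|exact: isdec_rzero].
  by rewrite xq_rone; split=> //; [exact: isdec_rone|exact: hx.1].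
split=> // -[n [_ _]]; have [hl hr] := h n; first by rewrite xq_rzero ltNge hl.
by rewrite xq_rone ltNge hr.
Qed.

Definition cellM N j x := forall n,
  [/\ isdec f (ap x n), f j * t N <= xq x n + 2 * t n & xq x n <= (f j + 1) * t N + 2 * t n].

Lemma qv_dyadic V (rho : env M V) a b :
  qv f rho (Qexp a Zero (pow2 b)) = f (ev rho a) * t (ev rho b).
Proof. by rewrite /qv /= f0 subr0. Qed.

Lemma qok_dyadic V (rho : env M V) a b : qok f rho (Qexp a Zero (pow2 b)).
Proof. exact: (p2M_gt0 hM hf (ev rho b)). Qed.

Lemma sat_cellf V N j (x : tm V (pure 1)) (rho : env M V) :
  sat (cellf N j x) rho <-> cellM (ev rho N) (ev rho j) (ev rho x).
Proof.
rewrite /cellf sat_all_var; apply: forall_iff => n.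
apply: (iff_trans (@sat_decode _ hM _ _ hf _ _ _ _ (fun q =>
  f (ev rho j) * t (ev rho N) <= q + 2 * t n /\
  q <= (f (ev rho j) + 1) * t (ev rho N) + 2 * t n) _)); last first.
  by rewrite /= /wk ?ev_ren; split=> [[? []]|[]].
move=> a b c e _ _ _ he; rewrite sat_And.
have h1 W (rho' : env M W) n' := @qok_pow2_pred _ hM _ _ hf _ rho' n'.
have h2 W (rho' : env M W) a' b' := @qok_dyadic _ rho' a' b'.
apply: and_iff; rewrite (sat_qle hM hf) ?(qv_add hf) ?(qv_pow2_pred hf) ?qv_dyadic //;
  try (by apply: qok_add).
  by rewrite /= /wk ?ev_ren.
by rewrite /= /wk ?ev_ren -!/(addM _ _) fD f1.
Qed.

Definition ball_coversM (P : M (Arr (pure 1) (pure 1))) m j y := in_unitM f y /\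
  forall x, in_unitM f x -> cellM m j x -> in_intervalM f P y x.

Lemma sat_ball_coversf V P m j (y : tm V (pure 1)) (rho : env M V) :
  sat (ball_coversf P m j y) rho <-> ball_coversM (ev rho P) (ev rho m) (ev rho j) (ev rho y).
Proof.
rewrite /ball_coversf sat_And (sat_in_unit hM hf) sat_all_var; apply: and_iff => //.
apply: forall_iff => x.
by rewrite sat_Imp (sat_in_unit hM hf) sat_Imp sat_cellf (sat_in_interval hM hf) /= /wk ?ev_ren.
Qed.

Definition goodM P m j := exists y, ball_coversM P m j y.

Lemma sat_goodf V P (m j : tm V Nat) (rho : env M V) :
  sat (goodf P m j) rho <-> goodM (ev rho P) (ev rho m) (ev rho j).
Proof.
rewrite /goodf sat_ex_var; apply: exists_iff => y.
by rewrite sat_ball_coversf /= /wk ?ev_ren.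
Qed.

Definition covM P n i := exists d, forall j, f j < f i * f (p2 d) -> goodM P (addM n d) j.

Lemma sat_covf V P (n i : tm V Nat) (rho : env M V) :
  sat (covf P n i) rho <-> covM (ev rho P) (ev rho n) (ev rho i).
Proof.
rewrite /covf sat_ex_var; apply: exists_iff => d; rewrite sat_all_var.
apply: forall_iff => j; rewrite sat_Imp sat_goodf.
by rewrite /= /wk ?ev_ren -/(mulM _ _) flt fM.
Qed.

(** Division by [2^k] with remainder, by internal induction on [l]: the quotient moves up when
    [l + 1] reaches the next multiple. *)
Lemma floor_p2 k l : exists j,
  f j * f (p2 k) <= f l /\ f l < (f j + 1) * f (p2 k).
Proof.
pose A : fm (ext (dom M) Nat) := floorf (Var (vs (p2 k))) (Var vz).
have e l' : sat A (econs l' (self (M := M))) <-> exists j,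
    f j * f (p2 k) <= f l' /\ f l' < (f j + 1) * f (p2 k).
  rewrite /A /floorf sat_ex_var; apply: exists_iff => j; rewrite sat_And sat_Not.
  rewrite -[sat _ _]/(ltM l' (mulM j (p2 k))) -[sat _ _]/(ltM l' (mulM j.+1M (p2 k))).
  by rewrite !flt !fM fD f1 leNgt; split=> -[/negP].
apply/e; move: l; apply: ind; first by low_tac.
  apply/e; exists (zeroM M); rewrite f0 mul0r lexx add0r mul1r.
  by split=> //; exact: p2_gt0.
move=> l /e [j [h1 h2]]; apply/e; rewrite fD f1.
case: (ltP (f l + 1) ((f j + 1) * f (p2 k))) => h3.
  by exists j; split=> //; apply: le_trans h1 _; rewrite lerDl.
exists j.+1M; rewrite fD f1; split=> //.
apply: le_lt_trans (lt_mulS h2) _; rewrite ltr_pM2r ?ltrDl //.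
exact: p2_gt0.
Qed.

Lemma t_split a m e : a * t m = a * f (p2 e) * t (addM m e).
Proof. by rewrite (t2D hM hf) mulrACA [f (p2 e) * _]mulrC t_p2 mulr1. Qed.

(** * Dyadic coverings and the point where they stop *)

Section Cover.
Variable P : M (Arr (pure 1) (pure 1)).

(** The cell [l] of level [m + e] is a part of the cell [j] of level [m], so the same ball contains
    it. *)
Lemma good_mono m j e l : goodM P m j ->
  f j * f (p2 e) <= f l -> f l < (f j + 1) * f (p2 e) -> goodM P (addM m e) l.
Proof.
move=> [y [hy h]] h1 h2; exists y; split=> // x hx hc; apply: h => // n.
have [d c1 c2] := hc n; split=> //.
  by apply: le_trans c1; rewrite (t_split _ m e) ler_pM2r ?t_gt0.
apply: (le_trans c2); rewrite lerD2r [leRHS](t_split _ m e) ler_pM2r ?t_gt0 //.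
exact: lt_mulS.
Qed.

Lemma cov_mono n i i' : f i' <= f i -> covM P n i -> covM P n i'.
Proof.
move=> h [d hd]; exists d => j hj; apply: hd; apply: lt_le_trans hj _.
by rewrite ler_pM2r ?p2_gt0.
Qed.

(** Both sides speak about the point [i / 2^n]. From left to right, the good cells of level [n + d]
    are subdivided [k] more times, and [floor_p2] finds the cell that a smaller one came from. *)
Lemma cov_level n k i : covM P n i <-> covM P (addM n k) (mulM i (p2 k)).
Proof.
split=> [[d hd]|[d hd]]; last first.
  exists (addM k d) => j hj; rewrite (rca_addA hM); apply: hd.
  by rewrite fM -mulrA -fM -(p2MD hM).
exists d => l hl; have [j [h1 h2]] := floor_p2 k l.
rewrite -(rca_addA hM) (rca_addC hM k) (rca_addA hM).
apply: (good_mono _ h1 h2); apply: hd.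
rewrite -(ltr_pM2r (p2_gt0 k)); apply: le_lt_trans h1 _.
by move: hl; rewrite fM; lra.
Qed.

Lemma cov0 n : covM P n (zeroM M).
Proof.
exists (zeroM M) => j; rewrite f0 mul0r => h.
by have := f_ge0 hM hf j; rewrite leNgt h.
Qed.

Hypothesis hP : is_posfunM f P.
Hypothesis ncov : ~ covM P (zeroM M) (oneM M).

Lemma ncov_p2 n : ~ covM P n (p2 n).
Proof.
move=> h; apply: ncov; apply/(cov_level _ n).
by rewrite !(rca_addC hM (zeroM M)) (rca_mulC hM) (rca_add0 hM) (rca_mul1 hM).
Qed.

(** Otherwise coverage would pass from every [i] to [i + 1], and induction from [cov0] would reach
    [2^n]. The induction is permitted because [covf] quantifies over numbers and functions only. *)
Lemma cov_last n : exists i, covM P n i /\ ~ covM P n i.+1M.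
Proof.
apply: contrapT => h; apply: (@ncov_p2 n); move: (p2 n).
pose A : fm (ext (dom M) Nat) := covf (Var (vs P)) (Var (vs n)) (Var vz).
have e i : sat A (econs i (self (M := M))) <-> covM P n i by rewrite sat_covf.
move=> i; apply/e; move: i; apply: ind; first by low_tac.
  by apply/e/cov0.
move=> i /e hi; apply/e; apply: contrapT => hi'; apply: h; by exists i.
Qed.

Lemma path_ex : exists X : M (pure 1), forall n, exists i,
  [/\ isdec f (ap X n), xq X n = f i * t n, covM P n i & ~ covM P n i.+1M].
Proof.
pose A : fm (ext (ext (dom M) Nat) Nat) := lastf (Var (vs (vs P))) (Var (vs vz)) (Var vz).
have lA : low Q A by low_tac.
have e n c : sat A (econs c (econs n (self (M := M)))) <-> exists i e,
    [/\ c = codeM i (zeroM M) e, e.+1M = p2 n, covM P n i & ~ covM P n i.+1M].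
  rewrite /A /lastf sat_ex_var; apply: exists_iff => i.
  rewrite sat_ex_var; apply: exists_iff => k.
  rewrite !sat_And sat_Not !sat_covf.
  by split=> [[? [? [? ?]]]|[? ? ? ?]].
have [|X hX] := @ac00 _ A (self (M := M)) lA.
  move=> n; have [i [h1 h2]] := cov_last n.
  (* A code stores its denominator less one, so the code of [i / 2^n] needs [2^n - 1]. *)
  have [c hc] : exists c, p2 n = addM (addM (zeroM M) c) (oneM M).
    by apply/hsub/flt; rewrite f0 p2_gt0.
  exists (codeM i (zeroM M) c); apply/e; exists i, c; split=> //.
  by rewrite hc (rca_addC hM _ c) (rca_add0 hM).
exists X => n; have /e [i [c [h1 h2 h3 h4]]] := hX n; exists i.
have d : dec f (ap X n) (f i * t n).
  rewrite h1; have := dec_code i (zeroM M) c.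
  by rewrite f0 subr0 -f1 -fD h2.
by split=> //; [exists (f i * t n)|exact: (qofE hM hf d)].
Qed.

Lemma dec_add c d q r : dec f c q -> dec f d r -> exists e, dec f e (q + r).
Proof.
move=> [a [b [k [_ ->]]]] [a' [b' [k' [_ ->]]]].
exists (codeM (addM (mulM a k'.+1M) (mulM a' k.+1M)) (addM (mulM b k'.+1M) (mulM b' k.+1M))
  (addM (mulM k k') (addM k k'))).
eexists _, _, _; split; first by [].
rewrite !(fD, fM) f1; have := f_ge0 hM hf k; have := f_ge0 hM hf k'.
move: (f a) (f b) (f k) (f a') (f b') (f k') => {}a {}b {}k {}a' {}b' {}k' hk hk'.
field; apply/andP; split; last apply/andP; try split; apply: lt0r_neq0; nra.
Qed.

Lemma dec_opp c q : dec f c q -> exists e, dec f e (- q).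
Proof.
move=> [a [b [k [_ ->]]]]; exists (codeM b a k), b, a, k; split=> //.
by rewrite -mulNr opprB.
Qed.

Lemma radd_ex x y : alldec f x -> alldec f y -> exists u, is_raddM f x y u.
Proof.
move=> hx hy.
pose A : fm (ext (ext (dom M) Nat) Nat) :=
  raddf (Var (vs (vs x))) (Var (vs (vs y))) (Var (vs vz)) (Var vz).
have lA : low Q A by low_tac.
have e n c : sat A (econs c (econs n (self (M := M)))) <->
    [/\ isdec f (ap x n.+1M), isdec f (ap y n.+1M), isdec f c &
      qof f c = xq x n.+1M + xq y n.+1M].
  apply: (iff_trans (@sat_decode3 _ hM _ _ hf _ _ _ _ _ _ (ap y n.+1M) c
    (fun a b => a + b) _ _ _)) => //.
  move=> a b k a' b' k' a'' b'' k'' q q' q'' rho' rho'' rho3 hq hq' hq''.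
  have h1 : qok f rho3 (qwk q) by rewrite qok_wk.
  have h2 : qok f rho3 (qwk q') by rewrite qok_wk.
  rewrite (sat_qeq hM hf); [|by []|exact: (qok_add hf)].
  by rewrite (qv_add hf) // !qv_wk.
have [|u hu] := @ac00 _ A (self (M := M)) lA; last by exists u => n; apply/e/hu.
move=> n; have [c hc] := dec_add (isdec_qof hM hf (hx n.+1M)) (isdec_qof hM hf (hy n.+1M)).
by exists c; apply/e; split=> //; [exists (xq x n.+1M + xq y n.+1M)|exact: (qofE hM hf hc)].
Qed.

Lemma rsub_ex x y : alldec f x -> alldec f y -> exists u, is_rsubM f x y u.
Proof.
move=> hx hy.
pose A : fm (ext (ext (dom M) Nat) Nat) :=
  rsubf (Var (vs (vs x))) (Var (vs (vs y))) (Var (vs vz)) (Var vz).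
have lA : low Q A by low_tac.
have e n c : sat A (econs c (econs n (self (M := M)))) <->
    [/\ isdec f (ap x n.+1M), isdec f (ap y n.+1M), isdec f c &
      qof f c = xq x n.+1M - xq y n.+1M].
  apply: (iff_trans (@sat_decode3 _ hM _ _ hf _ _ _ _ _ _ (ap y n.+1M) c
    (fun a b => a - b) _ _ _)) => //.
  move=> a b k a' b' k' a'' b'' k'' q q' q'' rho' rho'' rho3 hq hq' hq''.
  have h1 : qok f rho3 (qwk q) by rewrite qok_wk.
  have h2 : qok f rho3 (qwk q') by rewrite qok_wk.
  rewrite (sat_qeq hM hf); [|by []|exact: (qok_sub hf)].
  by rewrite (qv_sub hf) // !qv_wk.
have [|u hu] := @ac00 _ A (self (M := M)) lA; last by exists u => n; apply/e/hu.
move=> n; have [d hd] := dec_opp (isdec_qof hM hf (hy n.+1M)).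
have [c hc] := dec_add (isdec_qof hM hf (hx n.+1M)) hd.
by exists c; apply/e; split=> //; [exists (xq x n.+1M - xq y n.+1M)|exact: (qofE hM hf hc)].
Qed.

(** By [cov_level] the indices can be compared at the finer level, where coverage is downward
    closed. Hence all later approximations stay in the cell chosen at level [n]; this yields both
    the Cauchy property of the path and the location of its limit. *)
Lemma path_step n k i i' :
  covM P n i -> ~ covM P n i.+1M -> covM P (addM n k) i' -> ~ covM P (addM n k) i'.+1M ->
  f i * f (p2 k) <= f i' /\ f i' < (f i + 1) * f (p2 k).
Proof.
move=> h1 h2 h3 h4; rewrite !leNgt; split; [|rewrite ltNge]; apply/negP => h5.
  apply: h4; move/(cov_level n k): h1; apply: cov_mono.
  by rewrite fM fD f1; move: h5; rewrite -fM => /lt_S; rewrite fM.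
apply: h2; apply/(cov_level n k); apply: cov_mono h3.
by rewrite fM fD f1.
Qed.

Lemma path_absurd : False.
Proof.
have [X hX] := path_ex.
have boundX n k i : covM P n i -> ~ covM P n i.+1M ->
    f i * t n <= xq X (addM n k) /\ xq X (addM n k) < (f i + 1) * t n.
  move=> h1 h2; have [i' [_ -> h3 h4]] := hX (addM n k).
  have [h5 h6] := path_step h1 h2 h3 h4.
  by rewrite !(t_split _ n k) ler_pM2r ?ltr_pM2r ?t_gt0.
have realX : is_realM f X.
  split=> [n|n k]; first by have [i []] := hX n.
  have [i [_ -> h1 h2]] := hX n; have [h3 h4] := boundX n k i h1 h2.
  by rewrite distrC ger0_norm ?subr_ge0 // ltrBlDl -[X in _ + X]mul1r -mulrDl.
have unitX : in_unitM f X.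
  apply/in_unitE; split=> // n; have [i [_ -> h1 h2]] := hX n.
  have tn := t_gt0 n; have fi := f_ge0 hM hf i; split.
    by apply: addr_ge0; apply: mulr_ge0 => //; exact: ltW.
  have : f i < f (p2 n).
    by rewrite ltNge; apply/negP => /cov_mono /(_ h1); exact: ncov_p2.
  move=> /ltW; rewrite -(ler_pM2r tn) [f (p2 n) * _]mulrC t_p2 => h; lra.
have [/(_ X realX) [[decp realp] [n [_ _ pn]]] _] := hP.
rewrite xq_rzero add0r in pn.
have [i [_ _ h1 h2]] := hX n.+1M.
apply: (h2).
suff good : goodM P n.+1M i.
  have [d hd] := h1; exists d => j; rewrite fD f1 => hj.
  case: (ltP (f j) (f i * f (p2 d))) => hj'; first exact: hd.
  exact: good_mono good hj' hj.
exists X; split=> // x hx hcell.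
have [u hu] := rsub_ex realX.1 decp; have [v hv] := radd_ex realX.1 decp.
(* By [pn] the radius, read at [k + 1], exceeds [t n - t (k+1)], while the cell of level [n + 1] has
   length [t n / 2]. The comparisons at index [k] lose [4 * t k], and [k = n + 4] makes this
   [t n / 4], which still fits. *)
pose k := n.+1M.+1M.+1M.+1M.
have [c hc] : exists c, k.+1M = addM n.+1M c.
  by apply: le_addM; rewrite /k !f_S; lra.
have [h3 h4] := boundX _ c i h1 h2; rewrite -hc in h3 h4.
have [dx h5 h6] := hcell k; have [_ _ du eu] := hu k; have [_ _ dv ev] := hv k.
have near : `|xq (ap P X) n - xq (ap P X) k.+1M| < t n + t k.+1M by apply: real_near.
have tn := t_gt0 n.
move: near h3 h4 h5 h6; rewrite ltr_norml /k !(t2S hM hf) -/k => /andP [near1 near2] h3 h4 h5 h6.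
exists u, v; split=> //; exists k; split=> //; rewrite ?eu ?ev /k !(t2S hM hf) -/k; lra.
Qed.

End Cover.

(** If [x] were in no cell, then [j / 2^N <= x] would propagate from [j] to [j + 1], since not lying
    in cell [j] leaves only the right side. At [j = 2^N - 1] the bound [x <= 1] puts [x] into the
    last cell after all. *)
Lemma cell_ex N x : in_unitM f x -> exists j, ltM j (p2 N) /\ cellM N j x.
Proof.
move=> /in_unitE [hx hb]; apply: contrapT => hno.
pose A : fm (ext (dom M) Nat) := lowerf (Var (vs N)) (Var vz) (Var (vs x)).
have lA : low Q A by low_tac.
have e j : sat A (econs j (self (M := M))) <->
    (ltM j (p2 N) -> forall n, isdec f (ap x n) /\ f j * t N <= xq x n + 2 * t n).
  rewrite /A /lowerf sat_Imp; apply: imp_iff; rewrite sat_all_var; apply: forall_iff => n.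
  apply: (iff_trans (@sat_decode _ hM _ _ hf _ _ _ _ (fun q =>
    f j * t N <= q + 2 * t n) _)) => //.
  move=> a b c q _ _ _ hq.
  have h1 W (rho' : env M W) n' := @qok_pow2_pred _ hM _ _ hf _ rho' n'.
  have h2 W (rho' : env M W) a' b' := @qok_dyadic _ rho' a' b'.
  rewrite (sat_qle hM hf) ?(qv_add hf) ?(qv_pow2_pred hf) ?qv_dyadic //.
  by apply: qok_add.
have all j : sat A (econs j (self (M := M))).
  move: j; apply: ind => //.
    apply/e => _ n; rewrite f0 mul0r; split; [exact: hx.1|exact: (hb n).1].
  move=> j /e hj; apply/e => hjN m; split; first exact: hx.1.
  have hjN' : ltM j (p2 N).
    by apply: (rca_lt_tr hM) hjN; apply/flt; rewrite f_S ltrDl.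
  have {}hj := hj hjN'.
  have [n hn] : exists n, ~ (xq x n <= (f j + 1) * t N + 2 * t n).
    apply: contrapT => h; apply: hno; exists j; split=> // n; have [? ?] := hj n; split=> //.
    by apply: contrapT => h'; apply: h; exists n.
  move/negP: hn; rewrite -ltNge => hn.
  have := real_near n m hx; rewrite ltr_norml f_S => /andP [_ h2].
  have := t_gt0 n; have := t_gt0 m; lra.
have [j hj] : exists j, p2 N = addM (addM (zeroM M) j) (oneM M).
  by apply/hsub/flt; rewrite f0 p2_gt0.
have fj : f j + 1 = f (p2 N) by rewrite hj !fD f1 f0 add0r.
have ltj : ltM j (p2 N) by apply/flt; rewrite -fj ltrDl.
apply: hno; exists j; split=> // n; have [d h1] := (e j).1 (all j) ltj n; split=> //.
by rewrite fj mulrC t_p2; exact: (hb n).2.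
Qed.

Lemma cousin : HBU_M f.
Proof.
move=> P hP; have [d hd] : covM P (zeroM M) (oneM M).
  by apply: contrapT; exact: path_absurd.
pose A : fm (ext (ext (dom M) Nat) (pure 1)) := Var (vs vz) ≺ Var (vs (vs (p2 d))) ⟶
  ball_coversf (Var (vs (vs P))) (Var (vs (vs d))) (Var (vs vz)) (Var vz).
have lA : low Q A by low_tac.
have e j y : sat A (econs y (econs j (self (M := M)))) <->
    (ltM j (p2 d) -> ball_coversM P d j y).
  by rewrite /A sat_Imp; apply: imp_iff; rewrite sat_ball_coversf.
have [|w hw] := ac01 (rho := self (M := M)) lA.
  (* Choice ranges over all [j]; indices beyond the level get an arbitrary real. *)
  move=> j; case: (EM (ltM j (p2 d))) => hj; last by exists (rzeroM M); apply/e.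
  have [|y hy] := hd j; first by rewrite f1 mul1r; apply/flt.
  exists y; apply/e => _; move: hy.
  by rewrite (rca_addC hM) (rca_add0 hM).
exists (p2 d), w; split=> [j hj|x hx]; first exact: ((e _ _).1 (hw j) hj).1.
have [j [hj hc]] := cell_ex d hx.
by exists j; split=> //; apply: ((e _ _).1 (hw j) hj).2.
Qed.

End Cousin.

(** * The positive part *)

Definition diff_f {V} (a b : tm V Nat) : fm V :=
  a ≺ b ⟶ ∃[ c ∷ Nat ] ↑b ≐ (↑a ⊕ c) ⊕ One.

Definition low_ty (s : ty) : Prop :=
  match s with Nat | Arr Nat Nat => True | _ => False end.

Lemma Z2Omega_proves_HBU : proves (tunion Z2Omega (QF_AC (pure 0) (pure 1))) HBU.
Proof.
apply: completeness.
- move=> V W f p [[h|->]|h]; [left; left; exact: RCA0w_subst|by left; right|].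
  by right; exact: QF_AC_subst.
- by move=> V p h; left; left.
move=> M hext hT rho.
have hM : rca M by apply: rca_of_sat => // V p r h; apply: hT; left; left.
have hc := rca_comb hM.
have [eqb [ltb [impb [h1 h2 h3]]]] := rca_deciders hM.
have [E1 hE1] : exists E1 : M (pure 3), forall Y,
    ap E1 Y = zeroM M <-> exists x, ap Y x = zeroM M.
  have : sat Exists3 rho by apply: hT; left; right.
  rewrite /Exists3 sat_ex_var => -[E1]; rewrite sat_And => -[_]; rewrite sat_all_var => h.
  exists E1 => Y; have := h Y; rewrite sat_Iff sat_ex_var => -[h4 h5].
  by split=> [/h5|/h4].
(* A search over numbers is a search over functions [x] through the value [x(0)]. *)
pose E0 : M (pure 2) := ev (self (M := M)) (lam (Var (vs E1) ⋅
  lam (Var (vs vz) ⋅ (Var vz ⋅ Zero)))).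
have hE0 (Y : M (pure 1)) : ap E0 Y = zeroM M <-> exists x, ap Y x = zeroM M.
  pose g : M (pure 2) := ev (econs Y (self (M := M))) (lam (Var (vs vz) ⋅ (Var vz ⋅ Zero))).
  have gE x : ap g x = ap Y (ap x (zeroM M)) by rewrite /g ev_lam.
  have -> : ap E0 Y = ap E1 g by rewrite /E0 ev_lam.
  rewrite hE1.
  split=> [[x]|[x hx]]; first by rewrite gE => hx; exists (ap x (zeroM M)).
  by exists (ap (kM M Nat Nat) x); rewrite gE hc.1.
pose E s : M (Arr (Arr s Nat) Nat) := match s with
  | Nat => E0 | Arr Nat Nat => E1 | s => ap (kM M _ _) (zeroM M) end.
have hdec : decides eqb ltb impb low_ty E.
  split=> // [e|s]; last by case: s => [|[|? ?] [|? ?]] //.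
  have : ltM (zeroM M) (oneM M).
    by apply/(rca_lt_discrete hM); right; rewrite (rca_addC hM) (rca_add0 hM).
  by rewrite e => /(rca_lt_irr hM).
have ind := ind_low hc hdec hM.
have ac01 := @ac_low M hc eqb ltb impb low_ty E hdec Nat (pure 1)
  (fun V A r hA => (@sat_QF_AC M _ _ V A r).1 (hT _ _ r (or_intror (qf_ac Nat (pure 1) V A hA)))).
(* Induction on [b] for an existential formula, which [E0] decides. *)
have hsub a b : ltM a b -> exists c, b = addM (addM a c) (oneM M).
  pose A : fm (ext (dom M) Nat) := diff_f (Var (vs a)) (Var vz).
  have e b' : sat A (econs b' (self (M := M))) <->
      (ltM a b' -> exists c, b' = addM (addM a c) (oneM M)).
    by rewrite /A sat_Imp sat_ex_var.
  apply/e; move: b; apply: ind; first by do! split.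
    by apply/e => /(rca_lt_0 hM).
  move=> b /e hb; apply/e => hab.
  case: (rca_lt_tot hM a b) => h.
  - by have [c ->] := hb h; exists (addM c (oneM M)); rewrite (rca_addA hM).
  - by exists (zeroM M); rewrite (rca_add0 hM) h.
  - move/(rca_lt_add hM (oneM M)) in h; case/(rca_lt_discrete hM): hab => h'.
      by case: (rca_lt_irr hM (rca_lt_tr hM h h')).
    by move: h; rewrite h' => /(rca_lt_irr hM).
have [K [f hf]] := rca_embedding hM hsub.
by apply/(sat_HBU hM hf); exact: (cousin hM hf hsub I I ind ac01).
Qed.

(** * Programs with a self-referential oracle *)

(** All oracles share one type: two functions and a number. [OMu] serves the choice axiom, [ODec]
    the functionals [S_k^2]; [OSk], [OJoin] and [OBar] supply witnesses and initial segments for the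
    second-order formulas; [OCan] and [OOut] enter the counterexample. *)
Inductive oracle : Set :=
| OPlus | OTimes | OEq | OLt | OImp | ORec | OMu | OJoin | OBar | OCan | OOut
| ODec of nat
| OSk of nat & bool & nat.

Inductive prog : Set :=
| PNum of nat
| PApp of prog & prog
| PK
| PS
| POrc of oracle
| PPsi.

Definition code_oracle (o : oracle) : nat :=
  match o with
  | OPlus => pr 0 0 | OTimes => pr 1 0 | OEq => pr 2 0 | OLt => pr 3 0 | OImp => pr 4 0
  | ORec => pr 5 0 | OMu => pr 6 0 | OJoin => pr 7 0 | OBar => pr 8 0 | OCan => pr 9 0
  | OOut => pr 10 0
  | ODec k => pr 11 k
  | OSk k b j => pr 12 (pr k (pr b j))
  end.

Lemma code_oracle_inj o o' : code_oracle o = code_oracle o' -> o = o'.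
Proof.
case: o => [|||||||||||k|k b j]; case: o' => [|||||||||||k'|k' b' j'] //=;
  try by move=> /pr_inj [].
  by move=> /pr_inj [_ ->].
move=> /pr_inj [_ /pr_inj [-> /pr_inj [h ->]]].
by case: b b' h => -[].
Qed.

Fixpoint code_prog (p : prog) : nat :=
  match p with
  | PNum n => pr 0 n
  | PApp p q => pr 1 (pr (code_prog p) (code_prog q))
  | PK => pr 2 0
  | PS => pr 3 0
  | POrc o => pr 4 (code_oracle o)
  | PPsi => pr 5 0
  end.

Lemma code_prog_inj p q : code_prog p = code_prog q -> p = q.
Proof.
elim: p q => [n|p IHp q IHq|||o|] [n'|p' q'|||o'|] //=; try by move=> /pr_inj [].
- by move=> /pr_inj [_ ->].
- by move=> /pr_inj [_ /pr_inj [/IHp -> /IHq ->]].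
- by move=> /pr_inj [_ /code_oracle_inj ->].
Qed.

Notation "p $ q" := (PApp p q) (at level 33, left associativity).

(** Only the head is reduced. Reduction is therefore deterministic, and numerals and complete oracle
    calls are irreducible. *)
Inductive step : prog -> prog -> Prop :=
| step_K a b : step (PK $ a $ b) a
| step_S a b c : step (PS $ a $ b $ c) (a $ c $ (b $ c))
| step_app a a' b : step a a' -> step (a $ b) (a' $ b).

Section Eval.
Variable orc : oracle -> (nat -> nat) -> (nat -> nat) -> nat -> nat.

Definition partial_oracle := (nat -> nat) -> prog -> Prop.

(** [PPsi] returns the code of the program that the partial oracle [X] assigns to
    a function. *)
Inductive eval (X : partial_oracle) : prog -> nat -> Prop :=
| eval_step p q n : step p q -> eval X q n -> eval X p n
| eval_num n : eval X (PNum n) n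
| eval_orc o p q r g h m : (forall n, eval X (p $ PNum n) (g n)) ->
    (forall n, eval X (q $ PNum n) (h n)) -> eval X r m ->
    eval X (POrc o $ p $ q $ r) (orc o g h m)
| eval_psi p g e : (forall n, eval X (p $ PNum n) (g n)) -> X g e ->
    eval X (PPsi $ p) (code_prog e).

Definition computes (X : partial_oracle) (p : prog) (g : nat -> nat) :=
  forall n, eval X (p $ PNum n) (g n).

Definition functional_oracle (X : partial_oracle) := forall g p q, X g p -> X g q -> p = q.

Definition sound (X : partial_oracle) :=
  functional_oracle X /\ forall g p, X g p -> computes X p g.

Lemma eval_mono (X Y : partial_oracle) p n :
  (forall g e, X g e -> Y g e) -> eval X p n -> eval Y p n.
Proof.
move=> h; elim=> {p n} [p q n hs _ IH|n|o p q r g g' m _ IH1 _ IH2 _ IH3|p g e _ IH /h hg].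
- exact: eval_step IH.
- exact: eval_num.
- exact: eval_orc.
- exact: eval_psi hg.
Qed.

Lemma step_det p q q' : step p q -> step p q' -> q = q'.
Proof.
have noK a q'' : step (PK $ a) q'' -> False by move=> h; inversion h; inversion H2.
have noS a b q'' : step (PS $ a $ b) q'' -> False.
  by move=> h; inversion h; inversion H2; inversion H6.
move=> h; elim: h q' => {p q} [a b|a b c|a a' b h IH] q' h'.
- by inversion h' => //; subst; case: (noK _ _ H2).
- by inversion h' => //; subst; case: (noS _ _ _ H2).
- inversion h'; subst; [by case: (noK _ _ h)|by case: (noS _ _ _ h)|].
  by rewrite (IH _ H2).
Qed.

Lemma step_orc o p q r s : ~ step (POrc o $ p $ q $ r) s.
Proof. by move=> h; inversion h; inversion H2; inversion H6; inversion H10. Qed.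

Lemma step_psi p s : ~ step (PPsi $ p) s.
Proof. by move=> h; inversion h; inversion H2. Qed.

Lemma eval_step_inv X p q m : step p q -> eval X p m -> eval X q m.
Proof.
move=> hs h; case: h hs => {p m} [p p' m hs' h hs|m hs|o p p' r g g' m _ _ _ /step_orc|p g e _ _ /step_psi] //.
  by rewrite (step_det hs hs').
by inversion hs.
Qed.

Lemma eval_num_inv X n m : eval X (PNum n) m -> n = m.
Proof.
move E: (PNum n) => p h; case: h E => {p m} [p p' m hs _ E|m [->]|o p p' r g g' m _ _ _|p g e _ _] //.
by move: hs; rewrite -E => hs; inversion hs.
Qed.

Lemma eval_orc_inv X o p q r m : eval X (POrc o $ p $ q $ r) m ->
  exists g h k, [/\ computes X p g, computes X q h, eval X r k & m = orc o g h k].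
Proof.
move E: (_ $ r) => s h; case: h E => {s m} [s s' m hs _ E|//|o' p' q' r' g h m h1 h2 h3|//].
  by move: hs; rewrite -E => /step_orc.
by case=> ? ? ? ?; subst; exists g, h, m.
Qed.

Lemma eval_psi_inv X p m : eval X (PPsi $ p) m ->
  exists g e, [/\ computes X p g, X g e & m = code_prog e].
Proof.
move E: (_ $ p) => s h; case: h E => {s m} [s s' m hs _ E|//|o' p' q' r' g h m _ _ _|p' g e h1 h2] //.
  by move: hs; rewrite -E => /step_psi.
by case=> ?; subst; exists g, e.
Qed.

(** Induction on the derivation, which branches infinitely at oracle calls: the function passed to
    an oracle is determined value by value, and then its answer is. *)
Lemma eval_det X p n m : functional_oracle X -> eval X p n -> eval X p m -> n = m.
Proof.
move=> hX h; elim: h m => {p n} [p q n hs _ IH|n|o p q r g g' m _ IH1 _ IH2 _ IH3|p g e _ IH hg] m'.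
- by move/(eval_step_inv hs)/IH.
- by move/eval_num_inv.
- move/eval_orc_inv => [g0 [h0 [k [h1 h2 /IH3 -> ->]]]].
  have -> : g = g0 by apply: funext => n; exact: IH1.
  by have -> : g' = h0 by apply: funext => n; exact: IH2.
- move/eval_psi_inv => [g0 [e0 [h1 h2 ->]]].
  have eg : g = g0 by apply: funext => n; exact: IH.
  by rewrite eg in hg; rewrite (hX _ _ _ hg h2).
Qed.

Lemma computes_det X p g h : functional_oracle X -> computes X p g -> computes X p h -> g = h.
Proof. by move=> hX h1 h2; apply: funext => n; apply: eval_det (h1 n) (h2 n). Qed.

(** In a maximal sound oracle every computable [g] has a value: otherwise a program
    for [g] could be added, since evaluation is monotone in the oracle. *)
Lemma complete_oracle : exists X, sound X /\ forall g p, computes X p g -> exists q, X g q.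
Proof.
pose P (A : set ((nat -> nat) * prog)) := sound (fun g e => A (g, e)).
have [F FP tot|A [sA maxA]] := @Zorn_bigcup _ P.
  split=> [g p q [X FX hp] [Y FY hq]|g p [X FX hp] n].
    have [h|h] := tot _ _ FX FY.
      exact: (FP _ FY).1 (h _ hp) hq.
    exact: (FP _ FX).1 hp (h _ hq).
  apply: (@eval_mono (fun g e => X (g, e))); first by move=> g' e h; exists X.
  exact: (FP _ FX).2 hp n.
pose X : partial_oracle := fun g e => A (g, e).
have sX : sound X by [].
exists X; split=> // g p hp; apply: contrapT => hno.
(* The new entry cannot clash with an old one, as [X] has no value at [g]. The program [p] computes
   [g] already with [X], so it never asks for the code of [g] itself. *)
pose Y g' q := X g' q \/ (g' = g /\ q = p).
have XY g' e : X g' e -> Y g' e by left.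
have sY : sound Y.
  split=> [g' q r [h1|[-> ->]] [h2|[e ->]] //|g' q [h|[-> ->]] n].
  - exact: sX.1 h1 h2.
  - by case: hno; exists q; rewrite -e.
  - by case: hno; exists r.
  - by apply: eval_mono XY _; exact: sX.2 h n.
  - by apply: eval_mono XY _; exact: hp.
pose B : set ((nat -> nat) * prog) := fun ge => Y ge.1 ge.2.
have := maxA B; apply; last exact: sY.
split=> [[g' e] h|h]; first exact: XY.
by apply: hno; exists p; apply: (h (g, p)); right.
Qed.

End Eval.

(** * The model of realized functionals *)

Section RealizedModel.
Variable orc : oracle -> (nat -> nat) -> (nat -> nat) -> nat -> nat.
Hypothesis orc_plus : forall g h m, orc OPlus g h m = (g 0 + m)%N.
Hypothesis orc_times : forall g h m, orc OTimes g h m = (g 0 * m)%N.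
Hypothesis orc_eq : forall g h m, orc OEq g h m = (g 0 != m) :> nat.
Hypothesis orc_lt : forall g h m, orc OLt g h m = ~~ (g 0 < m)%N :> nat.
Hypothesis orc_imp : forall g h m, orc OImp g h m = ~~ ((g 0 == 0%N) ==> (m == 0%N)) :> nat.
Hypothesis orc_rec : forall g h m, orc ORec g h m = iter m g (h 0).
Hypothesis orc_mu : forall g h m n, g n = 0 -> g (orc OMu g h m) = 0.
Variable X : partial_oracle.
Hypothesis soundX : sound orc X.
Hypothesis completeX : forall g p, computes orc X p g -> exists q, X g q.

Notation evalX := (eval orc X).

(** The domain at an arrow type depends on the realizability relations below it, so domain and
    relation are defined together. Elements are set-theoretic functions for which some program works
    uniformly, hence extensionality holds outright. *)
Fixpoint tstr (s : ty) : {D : Set & prog -> D -> Prop} :=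
  match s with
  | Nat => existT (fun D : Set => prog -> D -> Prop) nat evalX
  | Arr s t => existT (fun D : Set => prog -> D -> Prop)
      {g : projT1 (tstr s) -> projT1 (tstr t) |
        exists p, forall q x, projT2 (tstr s) q x -> projT2 (tstr t) (p $ q) (g x)}
      (fun p g => forall q x, projT2 (tstr s) q x -> projT2 (tstr t) (p $ q) (sval g x))
  end.

Definition rdom (s : ty) : Set := projT1 (tstr s).
Definition rlz (s : ty) : prog -> rdom s -> Prop := projT2 (tstr s).
Arguments rlz : clear implicits.

Definition rap s t (g : rdom (Arr s t)) (x : rdom s) : rdom t := sval g x.

Definition rfun s t (g : rdom s -> rdom t)
    (h : exists p, forall q x, rlz s q x -> rlz t (p $ q) (g x)) : rdom (Arr s t) := exist _ g h.

Lemma rlz_ex s (x : rdom s) : exists p, rlz s p x.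
Proof.
by case: s x => [x|s t [g [p hp]]]; [exists (PNum x); exact: eval_num|exists p].
Qed.

Lemma rlz_step s p p' (x : rdom s) : step p p' -> rlz s p' x -> rlz s p x.
Proof.
elim: s p p' x => [|s _ t IH] p p' x hs; first exact: eval_step.
by move=> h q y hq; apply: IH (h q y hq); exact: step_app.
Qed.

Lemma rlz_app s t p q (g : rdom (Arr s t)) x : rlz _ p g -> rlz s q x -> rlz t (p $ q) (rap g x).
Proof. by apply. Qed.

Lemma rlz_K a b s (x : rdom s) : rlz s a x -> rlz s (PK $ a $ b) x.
Proof. exact/rlz_step/step_K. Qed.

Lemma rlz_S a b c s (x : rdom s) : rlz s (a $ c $ (b $ c)) x -> rlz s (PS $ a $ b $ c) x.
Proof. exact/rlz_step/step_S. Qed.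

Lemma rk_proof s t (a : rdom s) : exists p, forall q (x : rdom t), rlz t q x -> rlz s (p $ q) a.
Proof. by have [p hp] := rlz_ex a; exists (PK $ p) => q x _; apply: rlz_K. Qed.

Definition rk1 s t (a : rdom s) : rdom (Arr t s) := rfun (rk_proof t a).

Definition rk s t : rdom (Arr s (Arr t s)).
Proof.
apply: (@rfun s (Arr t s) (@rk1 s t)); exists PK => p a hp q x _; exact: rlz_K.
Defined.

Lemma rs_proof2 r s t (a : rdom (Arr r (Arr s t))) (b : rdom (Arr r s)) :
  exists p, forall q (x : rdom r), rlz r q x -> rlz t (p $ q) (rap (rap a x) (rap b x)).
Proof.
have [p hp] := rlz_ex a; have [q hq] := rlz_ex b.
exists (PS $ p $ q) => u x hu; apply: rlz_S.
exact: (rlz_app (rlz_app hp hu) (rlz_app hq hu)).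
Qed.

Definition rs2 r s t a b : rdom (Arr r t) := rfun (@rs_proof2 r s t a b).

Lemma rs_proof1 r s t (a : rdom (Arr r (Arr s t))) :
  exists p, forall q (b : rdom (Arr r s)), rlz _ q b -> rlz (Arr r t) (p $ q) (rs2 a b).
Proof.
have [p hp] := rlz_ex a; exists (PS $ p) => q b hq u x hu; apply: rlz_S.
exact: (rlz_app (rlz_app hp hu) (rlz_app hq hu)).
Qed.

Definition rs1 r s t a : rdom (Arr (Arr r s) (Arr r t)) := rfun (@rs_proof1 r s t a).

Lemma rs_proof r s t : exists p, forall q (a : rdom (Arr r (Arr s t))), rlz _ q a ->
  rlz (Arr (Arr r s) (Arr r t)) (p $ q) (rs1 a).
Proof.
exists PS => p a hp q b hq u x hu; apply: rlz_S.
exact: (rlz_app (rlz_app hp hu) (rlz_app hq hu)).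
Qed.

Definition rs r s t : rdom (Arr (Arr r (Arr s t)) (Arr (Arr r s) (Arr r t))) :=
  rfun (@rs_proof r s t).

Lemma rlz_computes p (g : rdom (Arr Nat Nat)) : rlz _ p g -> computes orc X p (sval g).
Proof. by move=> h n; apply: (h (PNum n) n); exact: eval_num. Qed.

Lemma rorc_proof3 o (g h : rdom (Arr Nat Nat)) :
  exists p, forall q m, rlz Nat q m -> rlz Nat (p $ q) (orc o (sval g) (sval h) m).
Proof.
have [p hp] := rlz_ex g; have [q hq] := rlz_ex h.
by exists (POrc o $ p $ q) => r m hr; apply: eval_orc => //; exact: rlz_computes.
Qed.

Definition rorc2 o g h : rdom (Arr Nat Nat) := rfun (@rorc_proof3 o g h).

Lemma rorc_proof2 o g : exists p, forall q h, rlz (Arr Nat Nat) q h ->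
  rlz (Arr Nat Nat) (p $ q) (rorc2 o g h).
Proof.
have [p hp] := rlz_ex g.
by exists (POrc o $ p) => q h hq r m hr; apply: eval_orc => //; exact: rlz_computes.
Qed.

Definition rorc1 o g : rdom (Arr (Arr Nat Nat) (Arr Nat Nat)) := rfun (@rorc_proof2 o g).

Lemma rorc_proof1 o : exists p, forall q g, rlz (Arr Nat Nat) q g ->
  rlz (Arr (Arr Nat Nat) (Arr Nat Nat)) (p $ q) (rorc1 o g).
Proof.
by exists (POrc o) => p g hp q h hq r m hr; apply: eval_orc => //; exact: rlz_computes.
Qed.

Definition rorc o : rdom (Arr (Arr Nat Nat) (Arr (Arr Nat Nat) (Arr Nat Nat))) :=
  rfun (@rorc_proof1 o).

(** [fun a => o (fun _ => a) (fun _ => a)] as a combinator. *)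
Definition Pbin (o : oracle) := PS $ (PS $ (PK $ POrc o) $ PK) $ PK.

Lemma rlz_bin o (op : nat -> nat -> nat) : (forall g h m, orc o g h m = op (g 0) m) ->
  forall p q a b, evalX p a -> evalX q b -> evalX (Pbin o $ p $ q) (op a b).
Proof.
move=> ho p q a b hp hq.
have hK n : evalX (PK $ p $ PNum n) a by exact: (@rlz_K p _ Nat).
have h := eval_orc o hK hK hq; rewrite ho in h.
apply: eval_step (step_app _ (step_S _ _ _)) _.
apply: eval_step (step_app _ (step_app _ (step_S _ _ _))) _.
by apply: eval_step (step_app _ (step_app _ (step_app _ (step_K _ _)))) _.
Qed.

Section Bin.
Variables (o : oracle) (op : nat -> nat -> nat).
Hypothesis ho : forall g h m, orc o g h m = op (g 0) m.

Lemma rbin_proof1 (a : nat) : exists p, forall q b, rlz Nat q b -> rlz Nat (p $ q) (op a b).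
Proof. by exists (Pbin o $ PNum a) => q b; apply: rlz_bin ho _ _ _ _ (eval_num _ _ _). Qed.

Definition rbin1 a : rdom (Arr Nat Nat) := @rfun Nat Nat _ (rbin_proof1 a).

Lemma rbin_proof : exists p, forall q a, rlz Nat q a -> rlz (Arr Nat Nat) (p $ q) (rbin1 a).
Proof. by exists (Pbin o) => p a hp q b; apply: rlz_bin ho _ _ _ _ hp. Qed.

Definition rbin : rdom (Arr Nat (Arr Nat Nat)) := @rfun Nat (Arr Nat Nat) _ rbin_proof.
End Bin.

(** [fun g a => ORec g (fun _ => a)] as a combinator. *)
Definition Prec := PS $ (PS $ (PK $ PS) $ (PS $ (PK $ PK) $ POrc ORec)) $ (PK $ PK).

Lemma rlz_rec p q r g a n : computes orc X p g -> evalX q a -> evalX r n ->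
  evalX (Prec $ p $ q $ r) (iter n g a).
Proof.
move=> hp hq hr.
have hK k : evalX (PK $ PK $ p $ q $ PNum k) a.
  apply: eval_step (step_app _ (step_app _ (step_K _ _))) _.
  exact: eval_step (step_K _ _) hq.
have h := eval_orc ORec hp hK hr; rewrite orc_rec in h.
apply: eval_step (step_app _ (step_app _ (step_S _ _ _))) _.
apply: eval_step (step_app _ (step_app _ (step_app _ (step_S _ _ _)))) _.
apply: eval_step (step_app _ (step_app _ (step_app _ (step_app _ (step_K _ _))))) _.
apply: eval_step (step_app _ (step_S _ _ _)) _.
apply: eval_step (step_app _ (step_app _ (step_app _ (step_S _ _ _)))) _.
apply: eval_step (step_app _ (step_app _ (step_app _ (step_app _ (step_K _ _))))) _.
by apply: eval_step (step_app _ (step_app _ (step_K _ _))) _.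
Qed.

Lemma rrec_proof3 (g : rdom (Arr Nat Nat)) (a : rdom Nat) :
  exists p, forall q n, rlz Nat q n -> rlz Nat (p $ q) (iter n (sval g) a).
Proof.
have [p hp] := rlz_ex g; have [q hq] := rlz_ex a.
by exists (Prec $ p $ q) => r n; apply: rlz_rec => //; exact: rlz_computes.
Qed.

Definition rrec2 g a : rdom (Arr Nat Nat) := @rfun Nat Nat _ (@rrec_proof3 g a).

Lemma rrec_proof2 (g : rdom (Arr Nat Nat)) :
  exists p, forall q a, rlz Nat q a -> rlz (Arr Nat Nat) (p $ q) (rrec2 g a).
Proof.
have [p hp] := rlz_ex g.
by exists (Prec $ p) => q a hq r n; apply: rlz_rec => //; exact: rlz_computes.
Qed.

Definition rrec1 g : rdom (Arr Nat (Arr Nat Nat)) := rfun (@rrec_proof2 g).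

Lemma rrec_proof1 : exists p, forall q g, rlz (Arr Nat Nat) q g ->
  rlz (Arr Nat (Arr Nat Nat)) (p $ q) (rrec1 g).
Proof.
by exists Prec => p g hp q a hq r n; apply: rlz_rec => //; exact: rlz_computes.
Qed.

Definition rrec : rdom (Arr (Arr Nat Nat) (Arr Nat (Arr Nat Nat))) := rfun rrec_proof1.

Definition rmodel : model :=
  @Model rdom rap (0 : nat) (1 : nat) (rbin orc_plus) (rbin orc_times) rk rs rrec
    (fun a b : nat => (a < b)%N).

Lemma rmodel_ext : extensional rmodel.
Proof.
move=> s t [g hg] [h hh] e; have {}e : g = h by apply: funext => x; exact: e.
by subst; congr exist; exact: Prop_irrelevance.
Qed.

Lemma rmodel_comb : combinatory rmodel.
Proof. by split. Qed.

Definition rdefault s : rdom (Arr (Arr s Nat) Nat) := rk1 (s := Nat) (Arr s Nat) (0 : nat).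

Lemma rmodel_decides : decides (M := rmodel)
  (rbin (op := fun a b => nat_of_bool (a != b)) orc_eq)
  (rbin (op := fun a b => nat_of_bool (~~ (a < b)%N)) orc_lt)
  (rbin (op := fun a b => nat_of_bool (~~ ((a == 0%N) ==> (b == 0%N)))) orc_imp)
  (fun _ => False) rdefault.
Proof.
split=> //= a b; rewrite /rap /=.
- by case: eqP.
- by case: ltnP.
- by case: eqP => ha; case: eqP => hb; split=> //= h; case: hb; exact: h ha.
Qed.

Lemma qf_low V (p : fm V) : qf p -> low (fun _ => False) p.
Proof. by elim: p => {V} //= V p IHp q IHq [/IHp ? /IHq]. Qed.

Lemma rmodel_RCA V (p : fm V) (rho : env rmodel V) : RCA0w V p -> sat p rho.
Proof.
have he := rmodel_ext.
move=> h; case: h rho => {V p} V.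
- by [].
- by move=> a b rho /= ->.
- by move=> a b c rho /= -> ->.
- by move=> a b c d rho /= -> ->.
- by move=> a b c rho /=; exact: addnA.
- by move=> a b rho /=; exact: addnC.
- by move=> a rho /=; exact: addn0.
- by move=> a b c rho /=; exact: mulnA.
- by move=> a b rho /=; exact: mulnC.
- by move=> a rho /=; exact: muln1.
- by move=> a rho /=; exact: muln0.
- by move=> a b c rho /=; exact: mulnDr.
- by move=> a rho /=; rewrite ltnn.
- by move=> a b c rho /=; exact: ltn_trans.
- by move=> a b rho; rewrite !sat_Or /=; case: ltngtP; auto.
- by move=> a b c rho /= h; rewrite /rap /= ltn_add2r.
- by move=> a b c rho /= h0 h; rewrite /rap /= ltn_mul2r h0.
- by move=> a rho.
- move=> a b rho; rewrite sat_Iff sat_Or /= /rap /= addn1 -/(is_true _) leq_eqVlt.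
  by split=> [/orP [/eqP|]|[h|->]]; rewrite ?h ?eqxx ?orbT; auto.
- by move=> s t a b rho; rewrite sat_eq_ty.
- by move=> r s t a b c rho; rewrite sat_eq_ty.
- by [].
- by move=> g m n rho /=; rewrite /rap /= addn1.
- by move=> s t g a b rho; rewrite sat_Imp !sat_eq_ty //= => ->.
(* The numbers of this model are standard, so ordinary induction applies. *)
- move=> A _ rho; rewrite sat_Imp sat_Imp sat_inst sat_All => h0 hS n.
  elim: n => [|n IH]; first exact: h0.
  have := hS n; rewrite sat_Imp sat_subst => /(_ IH); congr sat.
  apply: functional_extensionality_dep => t; apply: funext => -[|t' v] //.
  by rewrite /= /rap /= addn1.
- move=> p [{V p} V A hA] rho.
  apply/sat_QF_AC => h.
  (* [F] decides the quantifier-free matrix inside the model, and the choice functional searches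
     with [OMu] for a zero of [F x]. *)
  have [F hF] := decide2 rmodel_comb rmodel_decides rho (qf_low hA).
  pose Y : rdom (pure 2) := ev (self (M := rmodel)) (lam
    (Var (vs (rorc OMu)) ⋅ (Var (vs F) ⋅ Var vz) ⋅ (Var (vs F) ⋅ Var vz) ⋅ Zero)).
  exists Y => x; apply/hF; have [n /hF hn] := h x.
  exact: orc_mu hn.
Qed.

Lemma rpsi_proof (g : rdom (Arr Nat Nat)) : exists q, X (sval g) q.
Proof. by have [p /rlz_computes] := rlz_ex g; exact: completeX. Qed.

(** Depends on the function [g] alone and not on the realizer at hand; otherwise it would not be an
    element of type 2. *)
Definition program_index (g : rdom (Arr Nat Nat)) : nat := code_prog (sval (cid (rpsi_proof g))).

Lemma program_index_inj g h : program_index g = program_index h -> sval g = sval h.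
Proof.
rewrite /program_index; case: cid => p hp; case: cid => q hq /= /code_prog_inj e; subst q.
exact: computes_det soundX.1 (soundX.2 _ _ hp) (soundX.2 _ _ hq).
Qed.

Lemma rpsi_ex : exists p, forall q g, rlz (Arr Nat Nat) q g -> rlz Nat (p $ q) (program_index g).
Proof.
exists PPsi => q g /rlz_computes hq; rewrite /program_index; case: cid => e he /=.
exact: eval_psi he.
Qed.

Definition rpsi : rdom (pure 2) := @rfun (Arr Nat Nat) Nat program_index rpsi_ex.

End RealizedModel.

(** * The negative part *)

Definition npair (a b : nat) : nat := ((a + b) * (a + b) + a)%N.
Definition ncode (a b c : nat) : nat := npair a (npair b c).

Fixpoint ntuple (l : list nat) : nat :=
  match l with
  | List.nil => 0
  | List.cons a List.nil => a
  | List.cons a l => npair a (ntuple l)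
  end.

Fixpoint bar (g : nat -> nat) (n : nat) : nat :=
  match n with 0 => 0 | S n => (npair (bar g n) (g n) + 1)%N end.

(** The truth of [sigma] with quantifiers over all functions, not only those of a model. *)
Fixpoint tsig (k : nat) (b : bool) (hs : list (nat -> nat)) (g : nat -> nat) : Prop :=
  match k with
  | 0 => if b then exists n, g (ntuple (List.map (fun h => h n) hs)) = 0
         else forall n, g (ntuple (List.map (fun h => h n) hs)) = 0
  | S k => if b then exists w, tsig k false (hs ++ [:: bar w]) g
           else forall w, tsig k true (hs ++ [:: bar w]) g
  end.

Definition join (g h : nat -> nat) (n : nat) : nat := if odd n then h n./2 else g n./2.

Lemma join_inj g h g' h' : join g h = join g' h' -> g = g' /\ h = h'.
Proof.
move=> e; split; apply: funext => n.
  by have := congr1 (fun u => u n.*2) e; rewrite /join odd_double doubleK.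
have := congr1 (fun u => u n.*2.+1) e; rewrite /join /= odd_double /=.
by rewrite uphalf_double.
Qed.

(** Packs the matrix and the initial segment functions into one argument of an oracle. The number of
    packed functions is lost, which is why [OSk] carries it as a parameter. *)
Definition enc (g : nat -> nat) (hs : list (nat -> nat)) := foldl join g hs.

Lemma enc_inj hs : forall g g' hs', size hs = size hs' -> enc g hs = enc g' hs' ->
  g = g' /\ hs = hs'.
Proof.
rewrite /enc; elim/last_ind: hs => [|hs h IH] g g' hs'; case/lastP: hs' => [|hs' h'] //;
  rewrite ?size_rcons // => -[/IH {}IH].
by rewrite !foldl_rcons => /join_inj [/IH [-> ->] ->].
Qed.

(** For an existential block a witness, for a universal one a counterexample. *)
Definition step_witness k (b : bool) hs g w :=
  if b then tsig k false (hs ++ [:: bar w]) g else ~ tsig k true (hs ++ [:: bar w]) g.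

(** As the model is closed under these witnesses, it satisfies [sigma] iff [tsig] holds. *)
Definition skolem (k : nat) (b : bool) (j : nat) (c : nat -> nat) : nat -> nat :=
  epsilon (inhabits (fun _ : nat => 0))
    (fun w => exists g hs, [/\ size hs = j, enc g hs = c & step_witness k b hs g w]).

Lemma skolemP k b hs g w : step_witness k b hs g w ->
  step_witness k b hs g (skolem k b (size hs) (enc g hs)).
Proof.
move=> h; have [|g' [hs' [h1 h2 h3]]] := epsilon_spec (inhabits (fun _ : nat => 0))
    (fun w => exists g' hs', [/\ size hs' = size hs, enc g' hs' = enc g hs &
      step_witness k b hs' g' w]).
  by exists w, g, hs.
by have [eg ehs] := enc_inj h1 h2; subst.
Qed.

(** * Meaning of the oracles and elementarity *)

Section Oracles.
Variable canon : (nat -> nat) -> nat -> nat.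

(** The value of [OOut] is the code of [(1 - 0) / ((2^(m+3) - 1) + 1)], that is of [2^-(m+3)]. *)
Definition orc_sem (o : oracle) (g h : nat -> nat) (m : nat) : nat :=
  match o with
  | OPlus => (g 0 + m)%N
  | OTimes => (g 0 * m)%N
  | OEq => g 0 != m
  | OLt => ~~ (g 0 < m)%N
  | OImp => ~~ ((g 0 == 0%N) ==> (m == 0%N))
  | ORec => iter m g (h 0)
  | OMu => epsilon (inhabits 0) (fun n => g n = 0)
  | OJoin => join g h m
  | OBar => bar g m
  | OCan => canon g m
  | OOut => ncode 1 0 (2 ^ (m + 3)).-1
  | ODec k => if pselect (tsig k true [::] g) then 0 else 1
  | OSk k b j => skolem k b j g m
  end.

Lemma orc_sem_mu g h m n : g n = 0 -> g (orc_sem OMu g h m) = 0.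
Proof.
by move=> hn; apply: (epsilon_spec (inhabits 0) (fun n => g n = 0)); exists n.
Qed.

Variable X : partial_oracle.
Hypothesis soundX : sound orc_sem X.
Hypothesis completeX : forall g p, computes orc_sem X p g -> exists q, X g q.

Definition smodel : model := rmodel (orc := orc_sem) (fun _ _ _ => erefl) (fun _ _ _ => erefl)
  (fun _ _ _ => erefl) X.
Notation M := smodel.
Notation M1 := (M (pure 1)).

Lemma smodel_RCA V (p : fm V) (rho : env M V) : RCA0w V p -> sat p rho.
Proof. by apply: rmodel_RCA => //; exact: orc_sem_mu. Qed.

Lemma smodel_rca : rca M.
Proof. by apply: rca_of_sat; [exact: rmodel_ext|exact: smodel_RCA]. Qed.

Definition fn (g : M1) : nat -> nat := sval g.

Definition call (o : oracle) (g h : M1) : M1 := @ap M _ _ (@ap M _ _ (rorc orc_sem X o) g) h.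

Lemma fn_call o g h m : fn (call o g h) m = orc_sem o (fn g) (fn h) m.
Proof. by []. Qed.

Lemma fn_inj (g h : M1) : fn g = fn h -> g = h.
Proof. by move=> e; apply: (@rmodel_ext _ _ _ _ X) => n; exact: (congr1 (fun u => u n) e). Qed.

Lemma ev_tuple V (rho : env M V) l :
  ev rho (tuple l) = ntuple (List.map (@ev M V rho Nat) l).
Proof. by elim: l => //= a [|b l] // <-. Qed.

Lemma sat_is_bar V (g h : tm V (pure 1)) (rho : env M V) :
  sat (is_bar g h) rho <-> fn (ev rho h) = bar (fn (ev rho g)).
Proof.
rewrite /is_bar sat_And sat_all_var; set G := fn (ev rho g); set H := fn (ev rho h).
apply: (@iff_trans _ (H 0 = 0 /\ forall n, H n.+1 = (npair (H n) (G n) + 1)%N)).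
  apply: and_iff => //; apply: forall_iff => n; rewrite -[in X in _ <-> X]addn1.
  by rewrite /= /wk !ev_ren.
split=> [[h0 hS]|->//]; apply: funext; elim=> [//|n IH].
by rewrite hS IH.
Qed.

Lemma fn_enc (g : M1) hs : exists e : M1, fn e = enc (fn g) (List.map fn hs).
Proof.
elim/last_ind: hs => [|hs h [e he]]; first by exists g.
have -> : enc (fn g) (List.map fn (rcons hs h)) = join (enc (fn g) (List.map fn hs)) (fn h).
  by rewrite -cats1 List.map_app /enc foldl_cat.
by exists (call OJoin e h); rewrite -he; apply: funext.
Qed.

Lemma witness_closed k b hs (g : M1) w : step_witness k b (List.map fn hs) (fn g) w ->
  exists u : M1, step_witness k b (List.map fn hs) (fn g) (fn u).
Proof.
move=> /skolemP h; have [e he] := fn_enc g hs.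
by exists (call (OSk k b (size (List.map fn hs))) e e); move: h; rewrite -he.
Qed.

(** A Tarski-Vaught argument: a true witness or counterexample may lie outside the model, but
    [witness_closed] replaces it by one inside, and [OBar] supplies the initial segment function
    that [sigma] asks for. *)
Lemma sat_sigma k : forall b V hs g (rho : env M V),
  sat (sigma k b hs g) rho <->
  tsig k b (List.map (fun h => fn (ev rho h)) hs) (fn (ev rho g)).
Proof.
elim: k => [|k IH] b V hs g rho.
  have e n : (ap (ev rho g) (ntuple (List.map (fun h => fn (ev rho h) n) hs)) : nat) =
      fn (ev rho g) (ntuple (List.map (fun u => u n) (List.map (fun h => fn (ev rho h)) hs))).
    by rewrite List.map_map.
  case: b; cbn [sigma tsig]; rewrite ?sat_ex_var ?sat_all_var;
    [apply: exists_iff|apply: forall_iff] => n; rewrite -e /= ev_tuple List.map_map /wk !ev_ren;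
    by rewrite (@List.map_ext _ _ _ (fun h => fn (ev rho h) n)) // => h; rewrite /= ev_ren.
have bar_ex (w : M1) : exists h : M1, fn h = bar (fn w).
  by exists (call OBar w w); apply: funext.
have mapE (W : ctx) (i : Sub V W) (rho' : env M W) : (fun t v => rho' t (i t v)) = rho ->
    List.map (fun h => fn (ev rho' h)) (List.map wk hs) = List.map (fun h => fn (ev rho h)) hs.
  by move=> <-; rewrite List.map_map; apply: List.map_ext => h; rewrite ev_wk.
have hs_eq : List.map (fun h => fn (ev rho h)) hs =
    List.map fn (List.map (@ev M V rho (pure 1)) hs).
  by rewrite List.map_map.
case: b; cbn [sigma tsig]; rewrite ?sat_ex_var ?sat_all_var.
- apply: (@iff_trans _ (exists w : M1, tsig k false
    (List.map (fun h => fn (ev rho h)) hs ++ [:: bar (fn w)]) (fn (ev rho g)))).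
    apply: exists_iff => w; rewrite sat_ex_var; split=> [[h]|hw].
      rewrite sat_And sat_is_bar IH List.map_app mapE // => -[<-].
      by rewrite /wk !ev_ren.
    have [h hh] := bar_ex w; exists h; rewrite sat_And sat_is_bar IH List.map_app mapE //.
    by rewrite -hh in hw; rewrite /wk !ev_ren.
  split=> [[w hw]|[w hw]]; first by exists (fn w).
  rewrite hs_eq in hw *.
  by have [u hu] := @witness_closed k true _ _ w hw; exists u.
- apply: (@iff_trans _ (forall w : M1, tsig k true
    (List.map (fun h => fn (ev rho h)) hs ++ [:: bar (fn w)]) (fn (ev rho g)))).
    apply: forall_iff => w; rewrite sat_ex_var; split=> [[h]|hw].
      rewrite sat_And sat_is_bar IH List.map_app mapE // => -[<-].
      by rewrite /wk !ev_ren.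
    have [h hh] := bar_ex w; exists h; rewrite sat_And sat_is_bar IH List.map_app mapE //.
    by rewrite -hh in hw; rewrite /wk !ev_ren.
  split=> [h w|h w]; last exact: h.
  apply: contrapT => hw; rewrite hs_eq in hw h.
  by have [u hu] := @witness_closed k false _ _ w hw; apply: hu.
Qed.

Lemma sat_S2 k V (rho : env M V) : sat (S2 k) rho.
Proof.
have hc := rca_comb smodel_rca.
rewrite /S2 sat_ex_var.
exists (ev (self (M := M)) (lam (Var (vs (rorc orc_sem X (ODec k))) ⋅ Var vz ⋅ Var vz ⋅ Zero))).
set F := ev _ _.
have FE (g : M1) : (ap F g : nat) = if pselect (tsig k true [::] (fn g)) then 0 else 1.
  by rewrite /F ev_lam.
rewrite sat_And; split.
  move=> g; rewrite sat_Or; change (((ap F g : nat) < 1)%N \/ (ap F g : nat) = 1).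
  by rewrite FE; case: pselect => h; [left|right].
rewrite sat_all_var => g; rewrite sat_Iff sat_sigma.
change ((ap F g : nat) = 0 <-> tsig k true [::] (fn g)).
by rewrite FE; case: pselect.
Qed.

End Oracles.

(** * Total length of rational intervals, and reals as sequences *)

Section Measure.
Local Open Scope ring_scope.

(** Induction on [L], removing an interval that contains the right end point. *)
Lemma interval_cover (L : seq (rat * rat)) (a b : rat) :
  (forall cr : rat * rat, cr \in L -> 0 <= cr.2) ->
  (forall q : rat, a <= q -> q <= b -> exists2 cr : rat * rat, cr \in L & `|q - cr.1| < cr.2) ->
  b - a < \sum_(cr <- L) 2 * cr.2 \/ b < a.
Proof.
move: {2}(size L) (erefl (size L)) => n.
elim: n L b => [|n IH] L b hn hr hL.
  case: (ltP b a) => hab; first by right.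
  by move/size0nil: hn hL => -> /(_ _ hab (lexx b)) [].
case: (ltP b a) => hab; first by right.
left; have [[c r] hcr hb] := hL b hab (lexx b).
have hr' (cr : rat * rat) : cr \in rem (c, r) L -> 0 <= cr.2 by move/mem_rem/hr.
rewrite (big_rem _ hcr) /=; have h0 : 0 <= \sum_(cr <- rem (c, r) L) 2 * cr.2.
  by rewrite big_seq; apply: sumr_ge0 => cr /hr' h; rewrite mulr_ge0.
move: hb; rewrite ltr_norml /= => /andP [h1 h2].
have hn' : size (rem (c, r) L) = n by rewrite size_rem // hn.
(* The interval around [b] is open and misses [c - r], so the remaining intervals cover the closed
   interval from [a] to [c - r]. *)
have {}IH := IH _ (c - r) hn' hr'; clear hn hn'.
have [|h|h] := IH.
- move=> q haq hq; have [|[c' r'] hin hqc] := hL q haq; first by lra.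
  exists (c', r') => //; rewrite /= in hqc.
  have : (c', r') != (c, r).
    by apply/eqP => -[ec er]; move: hqc; rewrite ec er ltr_norml => /andP [h3 h4]; lra.
  move=> hne; move: hin; rewrite (perm_mem (perm_to_rem hcr)) in_cons (negbTE hne) //.
- lra.
- by have := hr _ hcr => /= hr0; lra.
Qed.

Definition inv2 (n : nat) : rat := ((2 ^ n)%:R)^-1.

Lemma inv2_gt0 n : 0 < inv2 n.
Proof. by rewrite invr_gt0 ltr0n expn_gt0. Qed.

Lemma inv2S n : inv2 n.+1 = inv2 n / 2.
Proof. by rewrite /inv2 expnS natrM invfM mulrC. Qed.

(** Each radius [2^-(e+3)] is enlarged by [3 * d] because centres are replaced by rational
    approximations. The sum stays below [1/2 + 6 * d * B]. *)
Lemma sum_radii (d : rat) B : \sum_(e <- iota 0 B) 2 * (inv2 (e + 3) + 3 * d) =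
  2^-1 - inv2 B / 2 + 6 * d * B%:R.
Proof.
elim: B => [|B IH]; first by rewrite big_nil /inv2 expn0 invr1 mulr0; lra.
rewrite -{1}addn1 iotaD big_cat /= big_cons big_nil IH add0n addr0 -[B.+1%:R]natr1 addn3.
by rewrite !inv2S; lra.
Qed.

Lemma inv2_lt n : n%:R * inv2 n < 1.
Proof. by rewrite ltr_pdivrMr ?ltr0n ?expn_gt0 // mul1r ltr_nat ltn_expl. Qed.

Lemma inv2_archi (d : rat) : 0 < d -> exists n, inv2 n < d.
Proof.
move=> hd; have h := archi_boundP (ltW (etrans (invr_gt0 d) hd)).
set n := Num.bound _ in h; exists n.
rewrite /inv2 -[d]invrK ltf_pV2 ?posrE ?invr_gt0 ?ltr0n ?expn_gt0 //.
by apply: lt_trans h _; rewrite ltr_nat ltn_expl.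
Qed.

Lemma le_inv2 (a b c : rat) : 0 <= c -> (forall k, a <= b + c * inv2 k) -> a <= b.
Proof.
move=> hc h; rewrite leNgt; apply/negP => hab.
have [|n hn] := inv2_archi (d := (a - b) / (c + 1)).
  by apply: divr_gt0; lra.
move: hn; rewrite ltr_pdivlMr; last by lra.
move=> hn.
have := h n; have := inv2_gt0 n; lra.
Qed.

Definition decN (c : nat) (q : rat) := exists x y z : nat,
  c = ncode x y z /\ q = (x%:R - y%:R) / (z%:R + 1).
Definition isdecN c := exists q, decN c q.
Definition qofN (c : nat) : rat := xget 0 (decN c).
Definition is_realN (g : nat -> nat) := (forall n, isdecN (g n)) /\
  forall n i, `|qofN (g n) - qofN (g (n + i)%N)| < inv2 n.
Definition reqN (g h : nat -> nat) := [/\ forall n, isdecN (g n), forall n, isdecN (h n) &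
  forall n, `|qofN (g n) - qofN (h n)| <= 2 * inv2 n].

Lemma realN_near g n m : is_realN g -> `|qofN (g n) - qofN (g m)| < inv2 n + inv2 m.
Proof.
move=> [_ h]; have hn := inv2_gt0 n; have hm := inv2_gt0 m.
case: (leqP n m) => [|/ltnW] /subnKC <-.
  by apply: lt_le_trans (h _ _) _; rewrite lerDl ltW // inv2_gt0.
by rewrite distrC; apply: lt_le_trans (h _ _) _; rewrite lerDr ltW // inv2_gt0.
Qed.

Lemma reqN_refl g : is_realN g -> reqN g g.
Proof.
by move=> [h _]; split=> // n; rewrite subrr normr0 mulr_ge0 // ltW // inv2_gt0.
Qed.

Lemma reqN_sym g h : reqN g h -> reqN h g.
Proof. by move=> [h1 h2 h3]; split=> // n; rewrite distrC. Qed.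

Lemma reqN_trans g h u : is_realN g -> is_realN h -> is_realN u ->
  reqN g h -> reqN h u -> reqN g u.
Proof.
move=> hg hh hu [h1 _ h3] [_ h4 h5]; split=> // n.
(* A detour through index [k] costs [1 + 2 + 2 + 1] times [2^-k]: two regularity errors and two
   equalities. *)
apply: (@le_inv2 _ _ 6) => // k.
have := realN_near n k hg; have := realN_near k n hu; have := h3 k; have := h5 k.
rewrite !(ler_norml, ltr_norml) => /andP [? ?] /andP [? ?] /andP [? ?] /andP [? ?].
by apply/andP; split; lra.
Qed.

(** Choosing a representative of each real makes [small] below respect their equality. *)
Definition canon (g : nat -> nat) : nat -> nat :=
  epsilon (inhabits (fun _ : nat => 0%N)) (fun h => is_realN h /\ reqN h g).

Lemma canonP g : is_realN g -> is_realN (canon g) /\ reqN (canon g) g.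
Proof.
move=> hg; apply: (epsilon_spec (inhabits (fun _ : nat => 0%N))
  (fun h => is_realN h /\ reqN h g)).
by exists g; split=> //; exact: reqN_refl.
Qed.

Lemma canon_eq g h : is_realN g -> is_realN h -> reqN g h -> canon g = canon h.
Proof.
move=> hg hh e; rewrite /canon; congr epsilon; apply: funext => u; apply: propext.
by split=> -[hu e']; split=> //; apply: reqN_trans e' _ => //; exact: reqN_sym.
Qed.

End Measure.

(** * A positive functional without finite subcover *)

Section Counterexample.
Local Open Scope ring_scope.
Variable X : partial_oracle.
Hypothesis soundX : sound (orc_sem canon) X.
Hypothesis completeX : forall g p, computes (orc_sem canon) X p g -> exists q, X g q.

Notation M := (smodel canon X).
Notation M1 := (M (pure 1)).
Let hM : rca M := smodel_rca canon X.

Definition natq (n : M Nat) : rat := (n : nat)%:R.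

Lemma natq_embedding : embedding natq.
Proof.
split=> //.
- by move=> a b; exact: natrD.
- by move=> a b; exact: natrM.
- by move=> a b; rewrite /natq ltr_nat.
Qed.
Let hf := natq_embedding.

Lemma smodel_sub (a b : M Nat) : ltM a b -> exists c, b = addM (addM a c) (oneM M).
Proof.
move=> h; exists ((b : nat) - (a : nat).+1)%N; rewrite /addM /ap /= /rap /=.
by move: h => /= h; lia.
Qed.

Lemma t2E (n : M Nat) : t2 natq n = inv2 n.
Proof.
rewrite /t2 /inv2; congr (_^-1); rewrite /natq; congr (_%:R).
elim: (n : nat) => [|m IH]; first exact: (p2M0 hM).
have := p2MS hM m; rewrite IH => e.
have -> : p2M (M := M) m.+1 = p2M (M := M) (addM (M := M) m (oneM M)).
  by congr p2M; rewrite /addM /= /rap /= addn1.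
by rewrite e expnS mul2n -addnn.
Qed.

Lemma is_realME (x : M1) : is_realM natq x <-> is_realN (fn x).
Proof.
apply: and_iff => //; apply: forall_iff => n; apply: forall_iff => i.
by rewrite t2E.
Qed.

Lemma reqME (x y : M1) : reqM natq x y <-> reqN (fn x) (fn y).
Proof. by split=> -[h1 h2 h3]; split=> // n; have := h3 n; rewrite t2E. Qed.

Definition can (x : M1) : M1 := call OCan x x.

Definition idx (x : M1) : nat := program_index completeX (can x).

Lemma idx_eq x y : is_realM natq x -> is_realM natq y -> reqM natq x y -> idx x = idx y.
Proof.
move=> /is_realME hx /is_realME hy /reqME h; rewrite /idx; congr program_index.
by apply: fn_inj; apply: funext => n; rewrite !fn_call /= (canon_eq hx hy h).
Qed.

Lemma idx_inj x y : is_realM natq x -> is_realM natq y -> idx x = idx y ->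
  reqN (fn x) (fn y).
Proof.
move=> /is_realME hx /is_realME hy /(program_index_inj soundX) e.
have {}e : canon (fn x) = canon (fn y) := e.
have [h1 h2] := canonP hx; have [h3 h4] := canonP hy.
by apply: (reqN_trans hx h1 hy); [exact: reqN_sym|rewrite e].
Qed.

(** [small x] is [2^-(e+3)] for the code [e] of a program for the representative of [x]. *)
Definition small : M (Arr (pure 1) (pure 1)) := ev (self (M := M)) (lam
  (Kc Nat Nat ⋅ (Var (vs (rorc _ X OOut)) ⋅ Var vz ⋅ Var vz ⋅
    (Var (vs (rpsi completeX)) ⋅ (Var (vs (rorc _ X OCan)) ⋅ Var vz ⋅ Var vz))))).

Lemma ap_small x : ap small x = rk1 (s := Nat) Nat (ncode 1 0 (2 ^ (idx x + 3)).-1).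
Proof. by rewrite /small (ev_lam (rca_comb hM)). Qed.

Lemma decN_const (a b d : nat) : decN (ncode a b d) ((a%:R - b%:R) / (d%:R + 1)).
Proof. by exists a, b, d. Qed.

Lemma qof_code (a b d : nat) : qofN (ncode a b d) = (a%:R - b%:R) / (d%:R + 1).
Proof. exact: (qofE hM hf (decN_const a b d)). Qed.

Lemma qof_dyadic m : qofN (ncode 1 0 (2 ^ m).-1) = inv2 m.
Proof.
rewrite qof_code subr0 div1r /inv2; congr (_^-1).
by rewrite -(natrD _ _ 1) addn1 prednK // expn_gt0.
Qed.

Lemma xq_small x n : xq natq (ap small x) n = inv2 (idx x + 3).
Proof. by rewrite ap_small -qof_dyadic. Qed.

Lemma isdec_small x n : isdec natq (ap (ap small x) n).
Proof. by rewrite ap_small; eexists; exact: decN_const. Qed.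

Lemma small_real x : is_realM natq (ap small x).
Proof.
split=> [n|n i]; first exact: isdec_small.
by rewrite !xq_small subrr normr0 t2E inv2_gt0.
Qed.

Lemma small_posfun : is_posfunM natq small.
Proof.
split=> [x hx|x y hx hy e].
  split; first exact: small_real.
  (* [rlt] requires a gap of [2 * 2^-n]; with [n = e + 5] this is [2^-(e+4)], half of the value. *)
  exists (idx x + 5)%N; split; [exact: (isdec_rzero hM)|exact: isdec_small|].
  rewrite (xq_rzero hM hf) add0r t2E xq_small.
  have := inv2_gt0 (idx x + 3); rewrite (_ : (idx x + 5 = (idx x + 3).+2)%N); last by lia.
  by rewrite !inv2S; lra.
apply/reqME; rewrite !ap_small (idx_eq hx hy e) -ap_small.
by apply: reqN_refl; apply/is_realME; exact: small_real.
Qed.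

Lemma rat_in_unit (q : rat) : 0 <= q -> q <= 1 ->
  exists x, in_unitM natq x /\ forall n, xq natq x n = q.
Proof.
move=> q0 q1; have [a [d e]] : exists a d : nat, q = (a%:R - 0%:R) / (d%:R + 1).
  exists `|numq q|%N, `|denq q|%N.-1.
  rewrite subr0 -(natrD _ _ 1) addn1 prednK; last by rewrite absz_gt0 denq_neq0.
  by rewrite !natr_absz normr_denq ger0_norm ?numq_ge0 // divq_num_den.
pose x : M1 := rk1 (s := Nat) Nat (ncode a 0 d).
have xE n : xq natq x n = q by rewrite e -qof_code.
exists x; split=> //; apply/(in_unitE hM hf); split.
  split=> [n|n i]; first by eexists; exact: decN_const.
  by rewrite !xE subrr normr0 t2E inv2_gt0.
by move=> n; rewrite xE t2E; have := inv2_gt0 n; split; lra.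
Qed.

(** The endpoints read [y] at shifted indices [k + 1] and [l + 1], but the gaps [2 * 2^-k] and
    [2 * 2^-l] in [rlt] absorb that error. Only the error [2^-n] of reading [y] at [n] remains. *)
Lemma interval_near y x q n : is_realM natq y -> (forall m, xq natq x m = q) ->
  in_intervalM natq small y x -> `|q - xq natq y n| < inv2 (idx y + 3) + inv2 n.
Proof.
move=> hy hq [u [v [hu hv [k [_ _ hk]] [l [_ _ hl]]]]].
have [_ _ _ eu] := hu k; have [_ _ _ ev] := hv l.
move: hk hl; rewrite eu ev !hq !xq_small !t2E.
have near m := real_near hM hf smodel_sub n (addM m (oneM M)) hy.
have t2S' m : t2 natq (addM m (oneM M)) = inv2 m / 2 by rewrite (t2S hM hf) t2E.
move: (near k) (near l); rewrite !t2S' !t2E !ltr_norml => /andP [h1 h2] /andP [h3 h4] h5 h6.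
by have := inv2_gt0 k; have := inv2_gt0 l; move=> h7 h8; apply/andP; split; lra.
Qed.

Lemma not_HBU : ~ HBU_M natq.
Proof.
move=> /(_ _ small_posfun) [k [w [hw hcov]]].
pose y (i : nat) : M1 := ap w i.
have realy i : (i < k)%N -> is_realM natq (y i) by move=> hi; have [] := hw i hi.
(* The intervals are listed by codes [e < B] rather than by positions [i < k]: many centres may
   represent the same real, and counting each code once keeps the total length bounded. With
   [n = 12 * B] the enlargements add up to [6 * B * 2^-n < 1/2]. *)
pose B := (\max_(i < (k : nat)) idx (y i)).+1.
pose n := (12 * B)%N.
(* One centre stands for all those with code [e]; codes that do not occur get the harmless centre
   0. *)
pose c (e : nat) : rat := match pselect (exists i, (i < k)%N /\ idx (y i) = e) with
  | left h => qofN (fn (y (sval (cid h))) n) | right _ => 0 end.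
pose L := [seq (c e, inv2 (e + 3) + 3 * inv2 n) | e <- iota 0 B].
have [| |h|] := @interval_cover L 0 1; last by rewrite ltr10.
- move=> cr /mapP [e _ ->] /=; have := inv2_gt0 (e + 3); have := inv2_gt0 n; lra.
- move=> q q0 q1; have [x [hx hxq]] := rat_in_unit q0 q1.
  have [i [hi hin]] := hcov x hx.
  exists (c (idx (y i)), inv2 (idx (y i) + 3) + 3 * inv2 n).
    apply: map_f; rewrite mem_iota /= add0n ltnS.
    exact: (leq_bigmax (F := fun i : 'I_k => idx (y i)) (Ordinal hi)).
  have near := interval_near n (realy i hi) hxq hin.
  (* Equal codes mean equal reals, whose approximations at [n] differ by at most [2 * 2^-n].
     Together with the [2^-n] of [interval_near] this gives the enlargement [3 * inv2 n]. *)
  have : `|xq natq (y i) n - c (idx (y i))| <= 2 * inv2 n.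
    rewrite /c; case: pselect => [h|[]]; last by exists i.
    case: cid => j [hj ej] /=.
    have [_ _ +] := idx_inj (realy i hi) (realy j hj) (esym ej); exact.
  move: near; rewrite /= !(ltr_norml, ler_norml) => /andP [h1 h2] /andP [h3 h4].
  by apply/andP; split; lra.
move: h; rewrite subr0 big_map.
rewrite (eq_bigr (fun e => 2 * (inv2 (e + 3) + 3 * inv2 n))) // sum_radii.
have := inv2_lt n; rewrite {1}/n natrM; have := inv2_gt0 B; have := inv2_gt0 n.
by move=> h1 h2 h3 h4; lra.
Qed.

End Counterexample.

Lemma Pi1kCA0w_not_HBU (k : nat) : ~ proves (Pi1kCA0w k) HBU.
Proof.
have [X [sX cX]] := complete_oracle (orc_sem canon).
have hM := smodel_rca canon X.
move=> h; apply: (not_HBU sX cX).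
have rho : env (smodel canon X) empty_ctx by move=> t [].
apply/(sat_HBU hM (natq_embedding X) rho).
apply: (soundness (T := Pi1kCA0w k) _ h) => // V p r [hp|->].
  exact: smodel_RCA.
exact: sat_S2.
Qed.

Theorem theorem3p1 :
  proves (tunion Z2Omega (QF_AC (pure 0) (pure 1))) HBU /\
  forall k : nat, (1 <= k)%coq_nat -> ~ proves (Pi1kCA0w k) HBU.
Proof.
by split=> [|k _]; [exact: Z2Omega_proves_HBU|exact: Pi1kCA0w_not_HBU].
Qed.
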